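(* Let $\Psi_1,\dots,\Psi_m$ be bounded sets of nonnegative matrices that define operators on $\ell^2$, let $\alpha\ge\frac1m$ and $r\in\{\rho_{ess},\hat\rho_{ess}\}$. Indices are taken cyclically modulo $m$ (so $\Psi_{m+i}=\Psi_i$). If $m$ is even, let $\Sigma_\alpha=\{C_1^{(\alpha)}\circ\cdots\circ C_m^{(\alpha)}: C_j\in P_j\}$ where $P_j=\Psi_j^*\Psi_{j+1}\Psi_{j+2}^*\Psi_{j+3}\cdots\Psi_{j+m-2}^*\Psi_{j+m-1}$ ($m$ factors, adjoints on odd-numbered positions). Then $$\gamma(\Psi_1^{(\alpha)}\circ\cdots\circ\Psi_m^{(\alpha)})\le r(\Sigma_\alpha)^{1/m}\le\left(r(\Psi_1^*\Psi_2\Psi_3^*\Psi_4\cdots\Psi_{m-1}^*\Psi_m)\,r(\Psi_m\Psi_{m-1}^*\cdots\Psi_4\Psi_3^*\Psi_2\Psi_1^* )\right)^{\alpha/2}.$$ If $m$ is odd, let $\Omega_\alpha=\{C_1^{(\alpha)}\circ\cdots\circ C_m^{(\alpha)}:C_j\in Q_j\}$ where $Q_j=\Psi_j^*\Psi_{j+1}\Psi_{j+2}^*\cdots\Psi_{j+2m-2}^*\Psi_{j+2m-1}$ ($2m$ factors, adjoints on odd-numbered positions). Then $$\gamma(\Psi_1^{(\alpha)}\circ\cdots\circ\Psi_m^{(\alpha)})\le r(\Omega_\alpha)^{1/(2m)}\le r(\Psi_1\Psi_2^*\Psi_3\Psi_4^*\cdots\Psi_{m-2}\Psi_{m-1}^*\Psi_m\Psi_1^*\Psi_2\cdots\Psi_{m-1}\Psi_m^*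 )^{\alpha/2},$$ where the last product has $2m$ factors $\Psi_1,\dots,\Psi_m,\Psi_1,\dots,\Psi_m$ with adjoints on exactly the even-numbered positions.
   Context: A nonnegative matrix $A=[a_{ij}]_{i,j\in\mathbb{N}}$ defines an operator on $\ell^2$ if $(Ax)_i=\sum_j a_{ij}x_j$ converges absolutely and $Ax\in\ell^2$ for all $x\in\ell^2$; $A^*$ is the transpose. Hadamard power $A^{(t)}=[a_{ij}^t]$, Hadamard product $A\circ B=[a_{ij}b_{ij}]$. For sets: $\Psi^*=\{A^*:A\in\Psi\}$, $\Psi\Sigma=\{AB:A\in\Psi,B\in\Sigma\}$, $\Psi_1^{(\alpha)}\circ\cdots\circ\Psi_m^{(\alpha)}=\{A_1^{(\alpha)}\circ\cdots\circ A_m^{(\alpha)}:A_j\in\Psi_j\}$, $\Sigma^k=\{A_1\cdots A_k:A_i\in\Sigma\}$. For a bounded set $\Omega$: $\gamma(\Omega)=\sup_{T\in\Omega}\gamma(T)$ with $\gamma(T)$ the Hausdorff measure of noncompactness; $\rho_{ess}(\Omega)=\sup_k[\sup_{A\in\Omega^k}\rho_{ess}(A)]^{1/k}$ and $\hat\rho_{ess}(\Omega)=\lim_k[\sup_{A\in\Omega^k}\gamma(A)]^{1/k}$, with $\rho_{ess}$ the essential spectral radius. *)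

(* Defs.v *)
From Stdlib Require Import Reals List Bool Arith.
From Coquelicot Require Import Coquelicot.
Open Scope R_scope.

Definition Mat := nat -> nat -> R.
Definition vec := nat -> R.
Definition matset := Mat -> Prop.

Definition l2 (x : vec) : Prop := ex_series (fun n => (x n) ^ 2).
Definition l2norm (x : vec) : R := sqrt (Series (fun n => (x n) ^ 2)).
Definition vsub (x y : vec) : vec := fun n => x n - y n.

Definition nonneg_mat (A : Mat) : Prop := forall i j, 0 <= A i j.
Definition mat_apply (A : Mat) (x : vec) : vec :=
  fun i => Series (fun j => A i j * x j).
Definition defines_op (A : Mat) : Prop :=
  forall x, l2 x ->
    (forall i, ex_series (fun j => Rabs (A i j * x j))) /\ l2 (mat_apply A x).

Definition bounded_set (S : matset) : Prop :=
  exists M, forall A x, S A -> l2 x -> l2norm (mat_apply A x) <= M * l2norm x.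

(** supremum of a set of reals (0 if empty or unbounded; only used on
    nonempty bounded sets of nonnegative reals, or empty ones) *)
Definition Rsup (E : R -> Prop) : R := real (Lub_Rbar E).

Definition covered_by (S : vec -> Prop) (d : R) : Prop :=
  exists cs : list vec, List.Forall l2 cs /\
    forall y, S y -> List.Exists (fun c => l2norm (vsub y c) <= d) cs.
Definition hnc (S : vec -> Prop) : R :=
  real (Glb_Rbar (fun d => 0 < d /\ covered_by S d)).
Definition unit_ball_image (A : Mat) : vec -> Prop :=
  fun y => exists x, l2 x /\ l2norm x <= 1 /\ y = mat_apply A x.
Definition gamma (A : Mat) : R := hnc (unit_ball_image A).
Definition gamma_set (S : matset) : R :=
  Rsup (fun t => exists A, S A /\ t = gamma A).

Definition cvec := nat -> C.
Definition cop := cvec -> cvec.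
Definition cl2 (z : cvec) : Prop := ex_series (fun n => (Cmod (z n)) ^ 2).
Definition cnorm (z : cvec) : R := sqrt (Series (fun n => (Cmod (z n)) ^ 2)).
Definition cadd (z w : cvec) : cvec := fun n => Cplus (z n) (w n).
Definition csub (z w : cvec) : cvec := fun n => Cminus (z n) (w n).
Definition cscal (c : C) (z : cvec) : cvec := fun n => Cmult c (z n).

Definition bounded_linear (T : cop) : Prop :=
  (forall z, cl2 z -> cl2 (T z)) /\
  (forall z w c, cl2 z -> cl2 w ->
     forall n, T (cadd z (cscal c w)) n = cadd (T z) (cscal c (T w)) n) /\
  (exists M, forall z, cl2 z -> cnorm (T z) <= M * cnorm z).

Definition compact_op (T : cop) : Prop :=
  bounded_linear T /\
  forall eps, 0 < eps -> exists cs : list cvec, List.Forall cl2 cs /\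
    forall z, cl2 z -> cnorm z <= 1 ->
      List.Exists (fun c => cnorm (csub (T z) c) <= eps) cs.

Definition cx_apply (A : Mat) (z : cvec) : cvec :=
  fun i => (Series (fun j => A i j * fst (z j)), Series (fun j => A i j * snd (z j))).
Definition shifted (A : Mat) (lam : C) : cop :=
  fun z => csub (cscal lam z) (cx_apply A z).

(** lam is in the essential spectrum iff lam I - A is not invertible
    modulo the compact operators (Calkin algebra) *)
Definition ess_spec (A : Mat) (lam : C) : Prop :=
  ~ exists B K1 K2, bounded_linear B /\ compact_op K1 /\ compact_op K2 /\
      forall z, cl2 z -> forall n,
        B (shifted A lam z) n = cadd z (K1 z) n /\
        shifted A lam (B z) n = cadd z (K2 z) n.
Definition rho_ess (A : Mat) : R :=
  Rsup (fun t => exists lam, ess_spec A lam /\ t = Cmod lam).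

Definition mmul (A B : Mat) : Mat := fun i j => Series (fun k => A i k * B k j).
Definition transp (A : Mat) : Mat := fun i j => A j i.
Definition adjset (S : matset) : matset := fun C => exists A, S A /\ C = transp A.
Definition prodset (S T : matset) : matset :=
  fun C => exists A B, S A /\ T B /\ C = mmul A B.
(** mchain f n = f 0 * f 1 * ... * f n  (n+1 factors) *)
Fixpoint mchain (f : nat -> matset) (n : nat) : matset :=
  match n with
  | O => f O
  | S n' => prodset (mchain f n') (f n)
  end.
(** spow S n = S^(n+1) *)
Definition spow (S : matset) (n : nat) : matset := mchain (fun _ => S) n.

(** real power with 0^t = 0 (t > 0) *)
Definition rpow (x t : R) : R := if Rlt_dec 0 x then Rpower x t else 0.

Definition hadset (f : nat -> matset) (m : nat) (a : R) : matset :=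
  fun C => exists As : nat -> Mat, (forall j, (j < m)%nat -> f j (As j)) /\
    C = (fun i k => fold_right Rmult 1 (map (fun j => rpow (As j i k) a) (seq 0 m))).

Definition rho_ess_set (Om : matset) : R :=
  Rsup (fun t => exists n : nat,
    t = rpow (Rsup (fun s => exists A, spow Om n A /\ s = rho_ess A)) (/ INR (S n))).
Definition rho_hat_set (Om : matset) : R :=
  real (Lim_seq (fun n => rpow (gamma_set (spow Om n)) (/ INR (S n)))).

(* Main.v *)
(** On [l2], [gamma A] is the limit of the norms of the row tails [rtail n A], which makes it
    monotone in the entries, submultiplicative, invariant under transposition, and such that
    [gamma A ^ 2 <= gamma (A^T A)].  The arithmetic-geometric mean inequality, applied entry by
    entry after normalising the factors, gives
    [gamma (A_1^(a) o ... o A_m^(a)) <= prod (gamma A_j)^a], and likewise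
    [had F * had G <= had (F G)] entrywise, so that powers of Hadamard products are controlled.

    For a nonnegative matrix the radius [rho_ess A], defined through invertibility modulo compact
    operators, equals [lim gamma (A^n)^(1/n)].  Consequently both radii of a set are monotone,
    unchanged by adjoints and by cyclic permutation of factors, and satisfy the Hadamard
    inequality.  For [A] in [Psi_1^(a) o ... o Psi_m^(a)], the word [A^T A A^T A ...] with [L]
    letters ([L = m] or [2 m]) is dominated by an element of [Sigma] (or [Omega]), obtained by
    shifting the Hadamard factors of the [t]-th letter cyclically by [t]; since
    [gamma A ^ L <= rho_ess (A^T A A^T A ...)] this is the first inequality.  In the second one,
    every [P_j] is up to adjoints a cyclic permutation of one of the two words on the right. *)

(* The entrywise order takes the place of operator theory: bounds on norms, row tails and powers
   pass from a nonnegative matrix to every nonnegative matrix that it dominates. The condition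
   [/ INR m <= alpha] does its work in the mean inequality for numbers in [0, 1], where a larger
   exponent only lowers the left side. The bound obtained is linear in the factors, and this is why
   it survives the passage from entries to operator norms.

   For all starting indices to give rotations of one or two words, both the index modulo m and the
   parity of the adjoints must return after a full turn. The length is therefore a common multiple
   of m and 2: m itself when m is even, 2 m when m is odd.

   The delicate point is that [rho_ess A] is not smaller than the Gelfand-type limit. The usual
   proof relies on analyticity of the resolvent in the Calkin algebra. Positivity permits an
   elementary one, which exhibits a specific point of the essential spectrum, the real number
   [ess A], by comparing finite Neumann sums at real points slightly above it with a single power of
   A. *)
Require Import Defs.
From Stdlib Require Import Reals List Bool Arith.
From Coquelicot Require Import Coquelicot.
From Stdlib Require Import Lra Lia FunctionalExtensionality PropExtensionality Classical.
Open Scope R_scope.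

(** * Finite sums and series *)

(* [sum_n] typed in [R], so that [ring] and [lra] recognise the equalities it occurs in. *)
Definition rsum (f : nat -> R) (n : nat) : R := sum_n f n.

Lemma rsum_ext_loc (f g : nat -> R) n :
  (forall i, (i <= n)%nat -> f i = g i) -> rsum f n = rsum g n.
Proof. exact (sum_n_ext_loc f g n). Qed.

Lemma rsum_S (f : nat -> R) n : rsum f (S n) = rsum f n + f (S n).
Proof. exact (sum_Sn f n). Qed.

Lemma rsum_0 (f : nat -> R) : rsum f 0 = f 0%nat.
Proof. exact (sum_O f). Qed.

Lemma rsum_add (f g : nat -> R) n :
  rsum (fun i => f i + g i) n = rsum f n + rsum g n.
Proof. exact (sum_n_plus f g n). Qed.

Lemma rsum_scal_l a (f : nat -> R) n : rsum (fun i => a * f i) n = a * rsum f n.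
Proof. exact (sum_n_mult_l (K := R_Ring) a f n). Qed.

Lemma rsum_scal_r a (f : nat -> R) n : rsum (fun i => f i * a) n = rsum f n * a.
Proof. exact (sum_n_mult_r (K := R_Ring) a f n). Qed.

Lemma rsum_le_loc (f g : nat -> R) n :
  (forall i, (i <= n)%nat -> f i <= g i) -> rsum f n <= rsum g n.
Proof.
induction n as [|n IH]; intros H.
- rewrite !rsum_0; auto.
- rewrite !rsum_S; apply Rplus_le_compat; auto.
Qed.

Lemma rsum_le (f g : nat -> R) n : (forall i, f i <= g i) -> rsum f n <= rsum g n.
Proof. intros; apply rsum_le_loc; auto. Qed.

Lemma rsum_zero n : rsum (fun _ => 0) n = 0.
Proof. induction n; [apply rsum_0 | rewrite rsum_S, IHn; ring]. Qed.

Lemma rsum_nonneg (f : nat -> R) n : (forall i, 0 <= f i) -> 0 <= rsum f n.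
Proof. intros H; rewrite <- (rsum_zero n); apply rsum_le; auto. Qed.

Lemma rsum_term (f : nat -> R) n k : (forall i, 0 <= f i) -> (k <= n)%nat -> f k <= rsum f n.
Proof.
intros H; induction n; intros Hk.
- replace k with 0%nat by lia; rewrite rsum_0; lra.
- rewrite rsum_S; destruct (Nat.eq_dec k (S n)) as [->|].
  + generalize (rsum_nonneg f n H); lra.
  + generalize (IHn ltac:(lia)) (H (S n)); lra.
Qed.

Lemma rsum_incr (f : nat -> R) n k :
  (forall i, 0 <= f i) -> (n <= k)%nat -> rsum f n <= rsum f k.
Proof.
intros H; induction 1; [lra|]. rewrite rsum_S; generalize (H (S m)); lra.
Qed.

Lemma rsum_single (f : nat -> R) n k :
  (k <= n)%nat -> (forall i, (i <= n)%nat -> i <> k -> f i = 0) -> rsum f n = f k.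
Proof.
induction n; intros Hk H.
- replace k with 0%nat by lia; apply rsum_0.
- rewrite rsum_S; destruct (Nat.eq_dec k (S n)) as [->|].
  + rewrite (rsum_ext_loc f (fun _ => 0)), rsum_zero; [apply Rplus_0_l|].
    intros i Hi; apply H; lia.
  + rewrite IHn, (H (S n)); [ring | lia | lia | lia |].
    intros; apply H; lia.
Qed.

Lemma cauchy_schwarz_sum (f g : nat -> R) n :
  rsum (fun i => f i * g i) n
  <= sqrt (rsum (fun i => f i ^ 2) n) * sqrt (rsum (fun i => g i ^ 2) n).
Proof.
rewrite <- sqrt_mult_alt by (apply rsum_nonneg; intros; apply pow2_ge_0).
assert (H : (rsum (fun i => f i * g i) n) ^ 2
        <= rsum (fun i => f i ^ 2) n * rsum (fun i => g i ^ 2) n).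
{ induction n.
  - rewrite !rsum_0; apply Req_le; ring.
  - rewrite !rsum_S.
    set (a := rsum (fun i => f i * g i) n) in *.
    set (b := rsum (fun i => f i ^ 2) n) in *.
    set (c := rsum (fun i => g i ^ 2) n) in *.
    assert (Hb : 0 <= b) by (apply rsum_nonneg; intros; apply pow2_ge_0).
    assert (Hc : 0 <= c) by (apply rsum_nonneg; intros; apply pow2_ge_0).
    set (u := f (S n)); set (v := g (S n)).
    (* The new cross term is handled through its square: a^2 <= b c by induction, and 4 b c (u v)^2
       <= (b v^2 + c u^2)^2. *)
    assert (2 * a * (u * v) <= b * v ^ 2 + c * u ^ 2); [|nra].
    assert (Hs : (2 * a * (u * v)) ^ 2 <= (b * v ^ 2 + c * u ^ 2) ^ 2).
    { apply Rle_trans with (4 * (b * c) * (u * v) ^ 2).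
      - replace ((2 * a * (u * v)) ^ 2) with (4 * a ^ 2 * (u * v) ^ 2) by ring.
        generalize (pow2_ge_0 (u * v)); nra.
      - generalize (pow2_ge_0 (b * v ^ 2 - c * u ^ 2)); nra. }
    assert (0 <= b * v ^ 2 + c * u ^ 2)
      by (generalize (pow2_ge_0 u) (pow2_ge_0 v); nra).
    apply Rnot_lt_le; intros Hlt; nra. }
apply Rle_trans with (sqrt ((rsum (fun i => f i * g i) n) ^ 2)).
- rewrite <- Rsqr_pow2, sqrt_Rsqr_abs; apply Rle_abs.
- apply sqrt_le_1_alt, H.
Qed.

Lemma series_bounded (a : nat -> R) M :
  (forall n, 0 <= a n) -> (forall n, rsum a n <= M) -> ex_series a /\ Series a <= M.
Proof.
intros Ha HM.
assert (Hex : ex_series a).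
{ destruct (ex_finite_lim_seq_incr (rsum a) M) as [l Hl]; [|exact HM|exists l; exact Hl].
  intros n; rewrite rsum_S; generalize (Ha (S n)); lra. }
split; [exact Hex|].
apply (is_lim_seq_le (rsum a) (fun _ => M) (Series a) M);
  [exact HM | exact (Series_correct a Hex) | apply is_lim_seq_const].
Qed.

Lemma rsum_le_Series (a : nat -> R) n :
  (forall n, 0 <= a n) -> ex_series a -> rsum a n <= Series a.
Proof.
intros Ha Hex.
apply (is_lim_seq_incr_compare (rsum a) (Series a)); [exact (Series_correct a Hex)|].
intros k; rewrite rsum_S; generalize (Ha (S k)); lra.
Qed.

Lemma term_le_Series (a : nat -> R) n :
  (forall n, 0 <= a n) -> ex_series a -> a n <= Series a.
Proof.
intros Ha Hex; eapply Rle_trans; [apply (rsum_term a n n Ha); lia|].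
now apply rsum_le_Series.
Qed.

Lemma Series_nonneg (a : nat -> R) : (forall n, 0 <= a n) -> ex_series a -> 0 <= Series a.
Proof.
intros Ha Hex; eapply Rle_trans; [apply (Ha 0%nat)|]; now apply term_le_Series.
Qed.

Lemma ex_series_le_nonneg (a b : nat -> R) :
  (forall n, Rabs (a n) <= b n) -> ex_series b -> ex_series (fun n => Rabs (a n)).
Proof.
intros H Hb; apply (ex_series_le (K := R_AbsRing) (V := R_CompleteNormedModule) _ b);
  [|exact Hb]. intros n; simpl.
change (norm (Rabs (a n))) with (Rabs (Rabs (a n))); rewrite Rabs_Rabsolu; apply H.
Qed.

Lemma ex_series_finite_sum (f : nat -> nat -> R) L :
  (forall l, ex_series (fun k => f k l)) ->
  ex_series (fun k => rsum (f k) L) /\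
  Series (fun k => rsum (f k) L) = rsum (fun l => Series (fun k => f k l)) L.
Proof.
intros H; induction L.
- rewrite rsum_0; split.
  + apply (ex_series_ext (fun k => f k 0%nat)); [intros; now rewrite rsum_0|auto].
  + apply Series_ext; intros; now rewrite rsum_0.
- destruct IHL as [I1 I2]; rewrite rsum_S; split.
  + apply (ex_series_ext (fun k => rsum (f k) L + f k (S L)));
      [intros; now rewrite rsum_S|].
    now apply (ex_series_plus (V := R_NormedModule)).
  + rewrite <- I2, <- Series_plus; auto.
    apply Series_ext; intros; now rewrite rsum_S.
Qed.

(** Tonelli's theorem. [Half] gives only an inequality, because finite sums in one index are bounded
    by the full series; applied again with the two indices exchanged, it gives the reverse one. *)
Lemma Series_exchange_nonneg (f : nat -> nat -> R) :
  (forall k l, 0 <= f k l) ->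
  (forall k, ex_series (f k)) -> ex_series (fun k => Series (f k)) ->
  (forall l, ex_series (fun k => f k l)) /\ ex_series (fun l => Series (fun k => f k l)) /\
  Series (fun l => Series (fun k => f k l)) = Series (fun k => Series (f k)).
Proof.
assert (Half : forall f : nat -> nat -> R, (forall k l, 0 <= f k l) ->
  (forall k, ex_series (f k)) -> ex_series (fun k => Series (f k)) ->
  (forall l, ex_series (fun k => f k l)) /\ ex_series (fun l => Series (fun k => f k l)) /\
  Series (fun l => Series (fun k => f k l)) <= Series (fun k => Series (f k))).
{ clear f; intros f Hf Hr Hs.
  assert (Hc : forall l, ex_series (fun k => f k l)).
  { intros l; apply (ex_series_ext (fun k => Rabs (f k l)));
      [intros; apply Rabs_pos_eq, Hf|].
    apply (ex_series_le_nonneg _ (fun k => Series (f k))); [|exact Hs].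
    intros k; rewrite Rabs_pos_eq by apply Hf; now apply term_le_Series. }
  split; [exact Hc|].
  apply series_bounded; [intros; now apply Series_nonneg|].
  intros L; destruct (ex_series_finite_sum f L Hc) as [E1 E2]; rewrite <- E2.
  apply Series_le; [|exact Hs].
  intros k; split; [now apply rsum_nonneg | now apply rsum_le_Series]. }
intros Hf Hr Hs; destruct (Half f Hf Hr Hs) as (H1 & H2 & H3).
split; [exact H1|]; split; [exact H2|]; apply Rle_antisym; [exact H3|].
destruct (Half (fun l k => f k l)) as (_ & _ & H4); auto.
Qed.

(** Fubini's theorem, from Tonelli's applied to the nonnegative families |f| + f and |f|, whose
    difference is f. *)
Lemma Series_exchange (f : nat -> nat -> R) :
  (forall k, ex_series (fun l => Rabs (f k l))) ->
  ex_series (fun k => Series (fun l => Rabs (f k l))) ->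
  Series (fun l => Series (fun k => f k l)) = Series (fun k => Series (f k)).
Proof.
intros Hr Hs.
assert (Hdec : forall g : nat -> R, ex_series (fun l => Rabs (g l)) ->
   ex_series (fun l => Rabs (g l) + g l) /\
   Series g = Series (fun l => Rabs (g l) + g l) - Series (fun l => Rabs (g l))).
{ intros g Hg; assert (Hg' : ex_series g) by now apply ex_series_Rabs.
  split; [now apply (ex_series_plus (V := R_NormedModule))|].
  rewrite Series_plus by assumption; ring. }
destruct (Series_exchange_nonneg (fun k l => Rabs (f k l))) as (A1 & A2 & A3); auto.
{ intros; apply Rabs_pos. }
assert (Hp : forall k l, 0 <= Rabs (f k l) + f k l).
{ intros; generalize (Rle_abs (- f k l)); rewrite Rabs_Ropp; lra. }
assert (Hp2 : forall k l, Rabs (f k l) + f k l <= 2 * Rabs (f k l)).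
{ intros; generalize (Rle_abs (f k l)); lra. }
assert (Hs' : ex_series (fun k => Series (fun l => Rabs (f k l) + f k l))).
{ apply (ex_series_ext (fun k => Rabs (Series (fun l => Rabs (f k l) + f k l)))).
  { intros k; apply Rabs_pos_eq, Series_nonneg; [apply Hp | now apply Hdec]. }
  apply (ex_series_le_nonneg _ (fun k => 2 * Series (fun l => Rabs (f k l)))).
  - intros k; rewrite Rabs_pos_eq
      by (apply Series_nonneg; [apply Hp | now apply Hdec]).
    rewrite <- Series_scal_l; apply Series_le; [auto|].
    now apply (ex_series_scal (V := R_NormedModule)).
  - now apply (ex_series_scal (V := R_NormedModule) 2). }
destruct (Series_exchange_nonneg (fun k l => Rabs (f k l) + f k l)) as (B1 & B2 & B3); auto.
{ intros; now apply Hdec. }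
rewrite (Series_ext _ _ (fun l => proj2 (Hdec _ (A1 l)))).
rewrite (Series_ext (fun k => Series (f k)) _ (fun k => proj2 (Hdec _ (Hr k)))).
rewrite !Series_minus by assumption.
now rewrite A3, B3.
Qed.

(** * Matrices bounded on l2 *)

Lemma rsum_switch (f : nat -> nat -> R) m n :
  rsum (fun i => rsum (f i) n) m = rsum (fun j => rsum (fun i => f i j) m) n.
Proof. exact (sum_n_switch f m n). Qed.

Lemma rsum_ext (f g : nat -> R) n : (forall i, f i = g i) -> rsum f n = rsum g n.
Proof. intros; apply rsum_ext_loc; auto. Qed.

Definition fnorm (N : nat) (x : vec) : R := sqrt (rsum (fun i => x i ^ 2) N).

Lemma fnorm_ge0 N x : 0 <= fnorm N x.
Proof. apply sqrt_pos. Qed.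

Lemma rsum_sq_ge0 N x : 0 <= rsum (fun i => x i ^ 2) N.
Proof. apply rsum_nonneg; intros; apply pow2_ge_0. Qed.

Lemma fnorm_sq N x : fnorm N x * fnorm N x = rsum (fun i => x i ^ 2) N.
Proof. apply sqrt_sqrt, rsum_sq_ge0. Qed.

Lemma fnorm_le_loc N x y : (forall i, (i <= N)%nat -> Rabs (x i) <= Rabs (y i)) -> fnorm N x <= fnorm N y.
Proof.
intros H; apply sqrt_le_1_alt, rsum_le_loc; intros i Hi.
rewrite <- (pow2_abs (x i)), <- (pow2_abs (y i)).
apply pow_incr; split; [apply Rabs_pos | auto].
Qed.

Lemma fnorm_le N x y : (forall i, Rabs (x i) <= Rabs (y i)) -> fnorm N x <= fnorm N y.
Proof. intros; apply fnorm_le_loc; auto. Qed.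

Definition basis (k : nat) : vec := fun i => if Nat.eqb i k then 1 else 0.

Lemma basis_ge0 k i : 0 <= basis k i.
Proof. unfold basis; destruct Nat.eqb; lra. Qed.

Lemma basis_same k : basis k k = 1.
Proof. unfold basis; now rewrite Nat.eqb_refl. Qed.

Lemma basis_diff k i : i <> k -> basis k i = 0.
Proof. intros H; unfold basis; now destruct (Nat.eqb_spec i k). Qed.

Lemma fnorm_basis N k : fnorm N (basis k) <= 1.
Proof.
rewrite <- sqrt_1; apply sqrt_le_1_alt.
destruct (le_lt_dec k N).
- rewrite (rsum_single _ _ k); auto.
  + rewrite basis_same; lra.
  + intros; rewrite basis_diff by auto; ring.
- rewrite (rsum_ext_loc _ (fun _ => 0)), rsum_zero; [lra|].
  intros; rewrite basis_diff by lia; ring.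
Qed.

(* A bilinear bound over finite sections: unlike a bound on |A x|, it is symmetric under
   transposition and makes sense before any series is known to converge. *)
Definition opb (A : Mat) (c : R) : Prop :=
  0 <= c /\ forall N J x y, (forall i, 0 <= x i) -> (forall i, 0 <= y i) ->
    rsum (fun i => rsum (fun j => y i * (Rabs (A i j) * x j)) J) N
    <= c * (fnorm J x * fnorm N y).

Definition bmat (A : Mat) : Prop := exists c, opb A c.

Lemma opb_ge0 A c : opb A c -> 0 <= c.
Proof. now intros []. Qed.

Lemma opb_mono A B c d :
  opb B c -> (forall i j, Rabs (A i j) <= Rabs (B i j)) -> c <= d -> opb A d.
Proof.
intros [Hc H] HAB Hd; split; [lra|]; intros N J x y Hx Hy.
apply Rle_trans with (c * (fnorm J x * fnorm N y)).
- eapply Rle_trans; [|apply H; assumption].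
  apply rsum_le; intros i; apply rsum_le; intros j.
  apply Rmult_le_compat_l; [auto|]; apply Rmult_le_compat_r; auto.
- apply Rmult_le_compat_r; [|exact Hd].
  apply Rmult_le_pos; apply fnorm_ge0.
Qed.

Lemma opb_weaken A c d : opb A c -> c <= d -> opb A d.
Proof. intros H Hd; apply (opb_mono A A c); auto; intros; lra. Qed.

Lemma opb_transp A c : opb A c -> opb (transp A) c.
Proof.
intros [Hc H]; split; [exact Hc|]; intros N J x y Hx Hy.
rewrite rsum_switch, (Rmult_comm (fnorm J x)).
eapply Rle_trans; [|apply (H J N y x); assumption].
apply Req_le, rsum_ext; intros; apply rsum_ext; intros; unfold transp; ring.
Qed.

Definition madd (A B : Mat) : Mat := fun i j => A i j + B i j.
Definition mscal (s : R) (A : Mat) : Mat := fun i j => s * A i j.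
Definition mone : Mat := fun i j => basis j i.
Definition mzero : Mat := fun _ _ => 0.

Lemma opb_add A B a b : opb A a -> opb B b -> opb (madd A B) (a + b).
Proof.
intros [Ha HA] [Hb HB]; split; [lra|]; intros N J x y Hx Hy.
rewrite Rmult_plus_distr_r.
eapply Rle_trans; [|apply Rplus_le_compat; [apply HA | apply HB]; assumption].
rewrite <- rsum_add; apply rsum_le; intros i.
rewrite <- rsum_add; apply rsum_le; intros j.
unfold madd; rewrite <- Rmult_plus_distr_l, <- Rmult_plus_distr_r.
apply Rmult_le_compat_l; [auto|]; apply Rmult_le_compat_r; [auto|]; apply Rabs_triang.
Qed.

Lemma opb_scal s A a : opb A a -> opb (mscal s A) (Rabs s * a).
Proof.
intros [Ha HA]; split; [apply Rmult_le_pos; auto using Rabs_pos|]; intros N J x y Hx Hy.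
rewrite Rmult_assoc.
eapply Rle_trans; [|apply Rmult_le_compat_l; [apply Rabs_pos | apply HA; assumption]].
apply Req_le; rewrite <- rsum_scal_l; apply rsum_ext; intros i.
rewrite <- rsum_scal_l; apply rsum_ext; intros j.
unfold mscal; rewrite Rabs_mult; ring.
Qed.

Lemma opb_zero : opb mzero 0.
Proof.
split; [lra|]; intros N J x y _ _.
rewrite (rsum_ext _ (fun _ => 0)), rsum_zero; [lra|]; intros i.
rewrite (rsum_ext _ (fun _ => 0)), rsum_zero; [reflexivity|]; intros j.
unfold mzero; rewrite Rabs_R0; ring.
Qed.

Lemma opb_entry A c i j : opb A c -> Rabs (A i j) <= c.
Proof.
intros [Hc H].
generalize (H i j (basis j) (basis i) (basis_ge0 j) (basis_ge0 i)).
rewrite (rsum_single _ i i); [|auto|].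
2:{ intros k _ Hk; rewrite (rsum_ext _ (fun _ => 0)); [apply rsum_zero|].
    intros; rewrite basis_diff by auto; ring. }
rewrite (rsum_single _ j j); [|auto|].
2:{ intros k _ Hk; rewrite (basis_diff j k) by auto; ring. }
rewrite !basis_same; intros H'.
assert (fnorm j (basis j) * fnorm i (basis i) <= 1).
{ rewrite <- (Rmult_1_r 1); apply Rmult_le_compat; auto using fnorm_ge0, fnorm_basis. }
nra.
Qed.

(** The form of the identity is a sum of y_i x_i over the indices common to both sections. Padding
    both vectors with zeros up to length [K] makes Cauchy-Schwarz applicable. *)
Lemma opb_one : opb mone 1.
Proof.
split; [lra|]; intros N J x y Hx Hy; rewrite Rmult_1_l.
set (K := Nat.max N J).
assert (Hk : forall L v, (forall i, 0 <= v i) -> (L <= K)%nat ->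
  fnorm K (fun i => if Nat.leb i L then v i else 0) = fnorm L v).
{ intros L v Hv HL; unfold fnorm; f_equal.
  clearbody K; induction HL.
  - apply rsum_ext_loc; intros i Hi.
    now rewrite (proj2 (Nat.leb_le i L) Hi).
  - rewrite rsum_S, IHHL, (proj2 (Nat.leb_gt (S m) L)) by lia; ring. }
rewrite <- (Hk J x), <- (Hk N y), Rmult_comm by (auto; unfold K; lia).
eapply Rle_trans; [|apply cauchy_schwarz_sum].
assert (HN : rsum (fun i => (if Nat.leb i N then y i else 0) * (if Nat.leb i J then x i else 0)) N
  <= rsum (fun i => (if Nat.leb i N then y i else 0) * (if Nat.leb i J then x i else 0)) K).
{ apply rsum_incr; [|unfold K; lia].
  intros i; apply Rmult_le_pos; destruct Nat.leb; auto; lra. }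
eapply Rle_trans; [|exact HN].
apply rsum_le_loc; intros i Hi.
rewrite (proj2 (Nat.leb_le i N) Hi).
destruct (Nat.leb_spec i J).
- rewrite (rsum_single _ J i); auto.
  + unfold mone; rewrite basis_same, Rabs_R1; lra.
  + intros; unfold mone; rewrite basis_diff, Rabs_R0 by auto; ring.
- rewrite (rsum_ext_loc _ (fun _ => 0)), rsum_zero; [lra|].
  intros; unfold mone; rewrite basis_diff, Rabs_R0 by lia; ring.
Qed.

Lemma opb_single_column A k e :
  0 <= e -> (forall i j, j <> k -> A i j = 0) ->
  (forall N, rsum (fun i => A i k ^ 2) N <= e ^ 2) -> opb A e.
Proof.
intros He Hz Hk; split; [exact He|]; intros N J x y Hx Hy.
assert (Hx1 : (k <= J)%nat -> x k <= fnorm J x).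
{ intros HkJ; rewrite <- (sqrt_pow2 (x k)) by auto; apply sqrt_le_1_alt.
  apply (rsum_term (fun i => x i ^ 2)); auto; intros; apply pow2_ge_0. }
apply Rle_trans with (rsum (fun i => y i * Rabs (A i k)) N * fnorm J x).
- rewrite <- rsum_scal_r; apply rsum_le; intros i.
  destruct (le_lt_dec k J) as [HkJ|HkJ].
  + rewrite (rsum_single _ J k); auto.
    * rewrite <- Rmult_assoc; apply Rmult_le_compat_l; auto.
      apply Rmult_le_pos; auto using Rabs_pos.
    * intros j _ Hj; rewrite Hz, Rabs_R0 by auto; ring.
  + rewrite (rsum_ext_loc _ (fun _ => 0)), rsum_zero.
    * apply Rmult_le_pos; [apply Rmult_le_pos; auto using Rabs_pos | apply fnorm_ge0].
    * intros j Hj; rewrite Hz, Rabs_R0 by lia; ring.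
- rewrite (Rmult_comm (fnorm J x)), <- Rmult_assoc; apply Rmult_le_compat_r; [apply fnorm_ge0|].
  eapply Rle_trans; [apply cauchy_schwarz_sum|]; fold (fnorm N y).
  rewrite Rmult_comm; apply Rmult_le_compat_r; [apply fnorm_ge0|].
  rewrite <- (sqrt_pow2 e He); apply sqrt_le_1_alt.
  rewrite (rsum_ext _ (fun i => A i k ^ 2)); [auto|intros; apply pow2_abs].
Qed.

(** Duality: the bilinear bound is tested with y equal to the image vector [w] itself, and one
    factor [fnorm N w] is cancelled. *)
Lemma opb_section A c J N x : opb A c -> (forall i, 0 <= x i) ->
  fnorm N (fun i => rsum (fun j => Rabs (A i j) * x j) J) <= c * fnorm J x.
Proof.
intros [Hc H] Hx.
set (w := fun i => rsum (fun j => Rabs (A i j) * x j) J).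
assert (Hw : forall i, 0 <= w i).
{ intros; apply rsum_nonneg; intros; apply Rmult_le_pos; auto using Rabs_pos. }
generalize (H N J x w Hx Hw).
rewrite (rsum_ext _ (fun i => w i ^ 2)), <- fnorm_sq
  by (intros; rewrite rsum_scal_l; fold (w i); ring).
generalize (fnorm_ge0 N w) (fnorm_ge0 J x); intros.
destruct (Req_dec (fnorm N w) 0) as [->|]; [nra|].
apply Rmult_le_reg_r with (fnorm N w); lra.
Qed.

(** With k outermost the double sum factors into the k-th coordinates of |A|^T y and of |B| x, so
    Cauchy-Schwarz in k applies. The bound is uniform in K, which later yields convergence of the
    series defining the product. *)
Lemma product_section A B a b N J K x y :
  opb A a -> opb B b -> (forall i, 0 <= x i) -> (forall i, 0 <= y i) ->
  rsum (fun k => rsum (fun i => rsum (fun j =>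
     y i * (Rabs (A i k) * Rabs (B k j) * x j)) J) N) K
  <= a * b * (fnorm J x * fnorm N y).
Proof.
intros HA HB Hx Hy.
rewrite (rsum_ext _ (fun k => rsum (fun i => Rabs (transp A k i) * y i) N *
   rsum (fun j => Rabs (B k j) * x j) J)).
2:{ intros k; rewrite <- rsum_scal_r; apply rsum_ext; intros i.
    rewrite <- rsum_scal_l; apply rsum_ext; intros j; unfold transp; ring. }
eapply Rle_trans; [apply cauchy_schwarz_sum|].
replace (a * b * (fnorm J x * fnorm N y)) with ((a * fnorm N y) * (b * fnorm J x)) by ring.
apply Rmult_le_compat; try apply sqrt_pos; apply opb_section; auto using opb_transp.
Qed.

Lemma mmul_ex_series A B i j : bmat A -> bmat B -> ex_series (fun k => Rabs (A i k * B k j)).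
Proof.
intros [a HA] [b HB].
apply (series_bounded _ (a * b)); [intros; apply Rabs_pos|]; intros K.
apply Rle_trans with (a * b * (fnorm j (basis j) * fnorm i (basis i))).
- eapply Rle_trans; [|apply (product_section A B a b i j K); auto using basis_ge0].
  apply rsum_le; intros k.
  assert (Hnn : forall i0 j0, 0 <= basis i i0 * (Rabs (A i0 k) * Rabs (B k j0) * basis j j0)).
  { intros; repeat apply Rmult_le_pos; auto using Rabs_pos, basis_ge0. }
  eapply Rle_trans;
    [|apply (rsum_term (fun i0 => rsum (fun j0 =>
       basis i i0 * (Rabs (A i0 k) * Rabs (B k j0) * basis j j0)) j) i i);
      [intros; apply rsum_nonneg; auto | auto]].
  eapply Rle_trans; [|apply (rsum_term _ j j); auto]; simpl.
  rewrite !basis_same, Rabs_mult; lra.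
- generalize (opb_ge0 _ _ HA) (opb_ge0 _ _ HB) (fnorm_ge0 j (basis j))
    (fnorm_ge0 i (basis i)) (fnorm_basis j j) (fnorm_basis i i); intros.
  rewrite <- (Rmult_1_r (a * b)) at 2; apply Rmult_le_compat_l; [nra|].
  rewrite <- (Rmult_1_r 1); apply Rmult_le_compat; auto.
Qed.

(** The finite sums are moved inside the series over the middle index; [product_section] then bounds
    every partial sum of that series. *)
Lemma opb_mmul A B a b : opb A a -> opb B b -> opb (mmul A B) (a * b).
Proof.
intros HA HB; split.
{ apply Rmult_le_pos; eapply opb_ge0; eauto. }
intros N J x y Hx Hy.
assert (Hex : forall i j, ex_series (fun k => Rabs (A i k * B k j)))
  by (intros; apply mmul_ex_series; eexists; eauto).
assert (Hex' : forall i j, ex_series (fun k => y i * (Rabs (A i k) * Rabs (B k j) * x j))).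
{ intros i j; apply (ex_series_ext (fun k => (y i * x j) * Rabs (A i k * B k j))).
  { intros; rewrite Rabs_mult; ring_simplify; reflexivity. }
  now apply (ex_series_scal (V := R_NormedModule)). }
apply Rle_trans with (rsum (fun i => rsum (fun j =>
   Series (fun k => y i * (Rabs (A i k) * Rabs (B k j) * x j))) J) N).
- apply rsum_le; intros i; apply rsum_le; intros j.
  rewrite Series_scal_l; apply Rmult_le_compat_l; [auto|].
  rewrite Series_scal_r; apply Rmult_le_compat_r; [auto|].
  unfold mmul; eapply Rle_trans; [apply Series_Rabs, Hex|].
  apply Req_le, Series_ext; intros; apply Rabs_mult.
- assert (H1 : forall i, ex_series (fun k => rsum (fun j => y i * (Rabs (A i k) * Rabs (B k j) * x j)) J)).
  { intros i; apply (ex_series_finite_sum (fun k j => y i * (Rabs (A i k) * Rabs (B k j) * x j)) J).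
    auto. }
  rewrite (rsum_ext _ (fun i => Series (fun k => rsum (fun j => y i * (Rabs (A i k) * Rabs (B k j) * x j)) J))).
  2:{ intros i; symmetry.
      apply (ex_series_finite_sum (fun k j => y i * (Rabs (A i k) * Rabs (B k j) * x j)) J); auto. }
  rewrite <- (proj2 (ex_series_finite_sum
    (fun k i => rsum (fun j => y i * (Rabs (A i k) * Rabs (B k j) * x j)) J) N H1)).
  apply series_bounded.
  + intros k; apply rsum_nonneg; intros i; apply rsum_nonneg; intros j.
    repeat apply Rmult_le_pos; auto using Rabs_pos.
  + intros K; apply product_section; auto.
Qed.

Lemma opb_abs A c : opb A c -> opb (fun i j => Rabs (A i j)) c.
Proof. intros H; apply (opb_mono _ A c); auto; intros; rewrite ?Rabs_Rabsolu; lra. Qed.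

Lemma bmat_mmul A B : bmat A -> bmat B -> bmat (mmul A B).
Proof. intros [a HA] [b HB]; exists (a * b); now apply opb_mmul. Qed.

Lemma bmat_add A B : bmat A -> bmat B -> bmat (madd A B).
Proof. intros [a HA] [b HB]; exists (a + b); now apply opb_add. Qed.

Lemma bmat_scal s A : bmat A -> bmat (mscal s A).
Proof. intros [a HA]; exists (Rabs s * a); now apply opb_scal. Qed.

Lemma bmat_abs A : bmat A -> bmat (fun i j => Rabs (A i j)).
Proof. intros [a HA]; exists a; now apply opb_abs. Qed.

Lemma bmat_transp A : bmat A -> bmat (transp A).
Proof. intros [a HA]; exists a; now apply opb_transp. Qed.

Lemma bmat_one : bmat mone.
Proof. exists 1; apply opb_one. Qed.

Lemma bmat_mono A B : bmat B -> (forall i j, Rabs (A i j) <= Rabs (B i j)) -> bmat A.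
Proof. intros [b HB] H; exists b; apply (opb_mono _ B b); auto; lra. Qed.

Lemma mat_ext (A B : Mat) : (forall i j, A i j = B i j) -> A = B.
Proof.
intros H; apply functional_extensionality; intros i.
apply functional_extensionality; intros j; apply H.
Qed.

(** Fubini; the absolute summability it requires is the convergence of an entry of |A| (|B| |D|). *)
Lemma mmul_assoc A B D :
  bmat A -> bmat B -> bmat D -> mmul A (mmul B D) = mmul (mmul A B) D.
Proof.
intros HA HB HD; apply mat_ext; intros i j; unfold mmul.
transitivity (Series (fun k => Series (fun l => A i k * (B k l * D l j)))).
{ apply Series_ext; intros k; now rewrite Series_scal_l. }
transitivity (Series (fun l => Series (fun k => A i k * (B k l * D l j)))).
2:{ apply Series_ext; intros l; rewrite <- Series_scal_r; apply Series_ext; intros; ring. }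
symmetry; apply Series_exchange.
- intros k; apply (ex_series_ext (fun l => Rabs (A i k) * Rabs (B k l * D l j))).
  { intros; symmetry; apply Rabs_mult. }
  apply (ex_series_scal (V := R_NormedModule)); now apply mmul_ex_series.
- apply (ex_series_ext (fun k => Rabs (Rabs (A i k) *
     mmul (fun i j => Rabs (B i j)) (fun i j => Rabs (D i j)) k j))).
  2:{ apply (mmul_ex_series (fun i j => Rabs (A i j))); auto using bmat_abs, bmat_mmul. }
  intros k; rewrite Rabs_pos_eq.
  + unfold mmul; rewrite <- Series_scal_l; apply Series_ext; intros; now rewrite !Rabs_mult.
  + apply Rmult_le_pos; [apply Rabs_pos|]; apply Series_nonneg.
    * intros; apply Rmult_le_pos; apply Rabs_pos.
    * apply ex_series_Rabs, (mmul_ex_series (fun i j => Rabs (B i j)) (fun i j => Rabs (D i j)));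
        now apply bmat_abs.
Qed.

Lemma mmul_1_l A : mmul mone A = A.
Proof.
apply mat_ext; intros i j; unfold mmul, mone.
apply is_series_unique; change (is_lim_seq (sum_n (fun k => basis k i * A k j)) (A i j)).
apply (is_lim_seq_ext_loc (fun _ => A i j)); [|apply is_lim_seq_const].
exists i; intros n Hn; symmetry.
change (rsum (fun k => basis k i * A k j) n = A i j).
rewrite (rsum_single _ n i Hn), basis_same; [ring|].
intros k _ Hk; rewrite basis_diff by auto; ring.
Qed.

Lemma mmul_1_r A : mmul A mone = A.
Proof.
apply mat_ext; intros i j; unfold mmul, mone.
apply is_series_unique; change (is_lim_seq (sum_n (fun k => A i k * basis j k)) (A i j)).
apply (is_lim_seq_ext_loc (fun _ => A i j)); [|apply is_lim_seq_const].
exists j; intros n Hn; symmetry.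
change (rsum (fun k => A i k * basis j k) n = A i j).
rewrite (rsum_single _ n j Hn), basis_same; [ring|].
intros k _ Hk; rewrite basis_diff by auto; ring.
Qed.

Lemma mmul_add_l A B D : bmat A -> bmat B -> bmat D ->
  mmul (madd A B) D = madd (mmul A D) (mmul B D).
Proof.
intros; apply mat_ext; intros i j; unfold mmul, madd.
rewrite <- Series_plus; try (apply ex_series_Rabs; now apply mmul_ex_series).
apply Series_ext; intros; ring.
Qed.

Lemma mmul_add_r A B D : bmat A -> bmat B -> bmat D ->
  mmul D (madd A B) = madd (mmul D A) (mmul D B).
Proof.
intros; apply mat_ext; intros i j; unfold mmul, madd.
rewrite <- Series_plus; try (apply ex_series_Rabs; now apply mmul_ex_series).
apply Series_ext; intros; ring.
Qed.

Lemma mmul_scal_l s A B : mmul (mscal s A) B = mscal s (mmul A B).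
Proof.
apply mat_ext; intros i j; unfold mmul, mscal; rewrite <- Series_scal_l.
apply Series_ext; intros; ring.
Qed.

Lemma mmul_scal_r s A B : mmul A (mscal s B) = mscal s (mmul A B).
Proof.
apply mat_ext; intros i j; unfold mmul, mscal; rewrite <- Series_scal_l.
apply Series_ext; intros; ring.
Qed.

Lemma transp_mmul A B : transp (mmul A B) = mmul (transp B) (transp A).
Proof.
apply mat_ext; intros i j; unfold transp, mmul; apply Series_ext; intros; ring.
Qed.

Lemma nonneg_mmul A B : nonneg_mat A -> nonneg_mat B -> bmat A -> bmat B -> nonneg_mat (mmul A B).
Proof.
intros HA HB HA' HB' i j; apply Series_nonneg.
- intros; now apply Rmult_le_pos.
- apply ex_series_Rabs; now apply mmul_ex_series.
Qed.

Lemma mmul_le A A' B B' : nonneg_mat A -> nonneg_mat B -> bmat A' -> bmat B' ->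
  (forall i j, A i j <= A' i j) -> (forall i j, B i j <= B' i j) ->
  forall i j, mmul A B i j <= mmul A' B' i j.
Proof.
intros HA HB HA' HB' LA LB i j; apply Series_le.
- intros k; split; [now apply Rmult_le_pos | apply Rmult_le_compat; auto].
- apply ex_series_Rabs; now apply mmul_ex_series.
Qed.

(** * Vectors and the measure of noncompactness *)

Lemma l2norm_ge0 x : 0 <= l2norm x.
Proof. apply sqrt_pos. Qed.

Lemma fnorm_le_l2norm N x : l2 x -> fnorm N x <= l2norm x.
Proof.
intros Hx; apply sqrt_le_1_alt, rsum_le_Series; [intros; apply pow2_ge_0 | exact Hx].
Qed.

Lemma l2_of_fnorm x c : (forall N, fnorm N x <= c) -> l2 x /\ l2norm x <= c.
Proof.
intros H.
assert (Hc : 0 <= c) by (eapply Rle_trans; [apply (fnorm_ge0 0 x) | apply H]).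
destruct (series_bounded (fun n => x n ^ 2) (c ^ 2)) as [H1 H2].
- intros; apply pow2_ge_0.
- intros N; rewrite <- fnorm_sq; generalize (H N) (fnorm_ge0 N x); nra.
- split; [exact H1|]. rewrite <- (sqrt_pow2 c Hc); now apply sqrt_le_1_alt.
Qed.

(* A vector as a matrix supported on column [0]: then [mat_apply A x] is column [0] of
   [mmul A (colm x)] by conversion, and facts about vectors follow from those about matrices. *)
Definition colm (x : vec) : Mat := fun k j => match j with O => x k | S _ => 0 end.

Lemma opb_column A c j : opb A c -> l2 (fun i => A i j) /\ l2norm (fun i => A i j) <= c.
Proof.
intros H; apply l2_of_fnorm; intros N.
apply Rle_trans with (c * fnorm j (basis j)).
- eapply Rle_trans; [|apply (opb_section A c j N (basis j) H (basis_ge0 j))].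
  apply fnorm_le; intros i; rewrite (rsum_single _ j j); auto.
  + rewrite basis_same, Rmult_1_r, Rabs_Rabsolu; lra.
  + intros; rewrite basis_diff by auto; ring.
- generalize (opb_ge0 _ _ H) (fnorm_basis j j); nra.
Qed.

Lemma l2_opb x : l2 x -> opb (colm x) (l2norm x).
Proof.
intros Hx; apply (opb_single_column _ 0).
- apply l2norm_ge0.
- intros i [|j] Hj; [easy | reflexivity].
- intros N; simpl colm; rewrite <- fnorm_sq.
  generalize (fnorm_le_l2norm N x Hx) (fnorm_ge0 N x); nra.
Qed.

Lemma l2_bmat x : l2 x -> bmat (colm x).
Proof. intros; eexists; now apply l2_opb. Qed.

Lemma opb_vec M c (x : vec) : opb M c -> (forall i, M i O = x i) -> l2 x /\ l2norm x <= c.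
Proof.
intros H Hx; rewrite <- (functional_extensionality _ _ Hx); now apply opb_column.
Qed.

Lemma l2_lincomb s x y : l2 x -> l2 y ->
  l2 (fun i => x i + s * y i) /\
  l2norm (fun i => x i + s * y i) <= l2norm x + Rabs s * l2norm y.
Proof.
intros Hx Hy; apply (opb_vec (madd (colm x) (mscal s (colm y)))); [|reflexivity].
apply opb_add, opb_scal; now apply l2_opb.
Qed.

Lemma l2_le x y : l2 y -> (forall i, Rabs (x i) <= Rabs (y i)) -> l2 x /\ l2norm x <= l2norm y.
Proof.
intros Hy H; apply l2_of_fnorm; intros N.
eapply Rle_trans; [apply fnorm_le, H | now apply fnorm_le_l2norm].
Qed.

Lemma l2_zero : l2 (fun _ => 0) /\ l2norm (fun _ => 0) = 0.
Proof.
destruct (opb_vec mzero 0 (fun _ => 0) opb_zero) as [H1 H2]; [reflexivity|].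
split; [exact H1|]; apply Rle_antisym; auto using l2norm_ge0.
Qed.

Lemma l2_scal s x : l2 x -> l2 (fun i => s * x i) /\ l2norm (fun i => s * x i) <= Rabs s * l2norm x.
Proof.
intros Hx; apply (opb_vec (mscal s (colm x))); [|reflexivity].
now apply opb_scal, l2_opb.
Qed.

Lemma mat_apply_bound A c x : opb A c -> l2 x ->
  l2 (mat_apply A x) /\ l2norm (mat_apply A x) <= c * l2norm x.
Proof.
intros HA Hx; apply (opb_vec (mmul A (colm x))); [|reflexivity].
now apply opb_mmul; [|apply l2_opb].
Qed.

Lemma mat_apply_l2 A x : bmat A -> l2 x -> l2 (mat_apply A x).
Proof. intros [c HA] Hx; now apply (mat_apply_bound A c). Qed.

Lemma mat_apply_mmul A B x i : bmat A -> bmat B -> l2 x ->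
  mat_apply (mmul A B) x i = mat_apply A (mat_apply B x) i.
Proof.
intros HA HB Hx.
change (mmul (mmul A B) (colm x) i 0%nat = mmul A (mmul B (colm x)) i 0%nat).
now rewrite mmul_assoc by auto using l2_bmat.
Qed.

Lemma mat_apply_lincomb A x y s i : bmat A -> l2 x -> l2 y ->
  mat_apply A (fun i => x i + s * y i) i = mat_apply A x i + s * mat_apply A y i.
Proof.
intros HA Hx Hy.
change (mmul A (madd (colm x) (mscal s (colm y))) i 0%nat =
  madd (mmul A (colm x)) (mscal s (mmul A (colm y))) i 0%nat).
now rewrite mmul_add_r, mmul_scal_r by auto using l2_bmat, bmat_scal.
Qed.

Lemma mat_apply_madd A B x i : bmat A -> bmat B -> l2 x ->
  mat_apply (madd A B) x i = mat_apply A x i + mat_apply B x i.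
Proof.
intros HA HB Hx.
change (mmul (madd A B) (colm x) i 0%nat = madd (mmul A (colm x)) (mmul B (colm x)) i 0%nat).
now rewrite mmul_add_l by auto using l2_bmat.
Qed.

Lemma mat_apply_mscal s A x i : mat_apply (mscal s A) x i = s * mat_apply A x i.
Proof.
change (mmul (mscal s A) (colm x) i 0%nat = mscal s (mmul A (colm x)) i 0%nat).
now rewrite mmul_scal_l.
Qed.

Lemma mat_apply_one x i : mat_apply mone x i = x i.
Proof.
change (mmul mone (colm x) i 0%nat = colm x i 0%nat); now rewrite mmul_1_l.
Qed.

(** * Truncation of vectors and of the rows of a matrix *)

Definition vhead (n : nat) (x : vec) : vec := fun i => if Nat.leb n i then 0 else x i.
Definition vtail (n : nat) (x : vec) : vec := fun i => if Nat.leb n i then x i else 0.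
Definition rhead (n : nat) (A : Mat) : Mat := fun i j => if Nat.leb n i then 0 else A i j.
Definition rtail (n : nat) (A : Mat) : Mat := fun i j => if Nat.leb n i then A i j else 0.

Lemma vtail_le n x i : Rabs (vtail n x i) <= Rabs (x i).
Proof. unfold vtail; destruct Nat.leb; rewrite ?Rabs_R0; auto using Rabs_pos; lra. Qed.

Lemma vhead_le n x i : Rabs (vhead n x i) <= Rabs (x i).
Proof. unfold vhead; destruct Nat.leb; rewrite ?Rabs_R0; auto using Rabs_pos; lra. Qed.

Lemma rtail_le n A i j : Rabs (rtail n A i j) <= Rabs (A i j).
Proof. unfold rtail; destruct Nat.leb; rewrite ?Rabs_R0; auto using Rabs_pos; lra. Qed.

Lemma rhead_le n A i j : Rabs (rhead n A i j) <= Rabs (A i j).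
Proof. unfold rhead; destruct Nat.leb; rewrite ?Rabs_R0; auto using Rabs_pos; lra. Qed.

Lemma rtail_anti n k A i j : (n <= k)%nat -> Rabs (rtail k A i j) <= Rabs (rtail n A i j).
Proof.
intros H; unfold rtail; destruct (Nat.leb_spec k i), (Nat.leb_spec n i);
  rewrite ?Rabs_R0; auto using Rabs_pos; try lra; lia.
Qed.

Lemma vtail_anti n k x i : (n <= k)%nat -> Rabs (vtail k x i) <= Rabs (vtail n x i).
Proof.
intros H; unfold vtail; destruct (Nat.leb_spec k i), (Nat.leb_spec n i);
  rewrite ?Rabs_R0; auto using Rabs_pos; try lra; lia.
Qed.

Lemma mat_apply_rtail n A x i : mat_apply (rtail n A) x i = vtail n (mat_apply A x) i.
Proof.
unfold mat_apply, rtail, vtail; destruct Nat.leb; [reflexivity|].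
rewrite (Series_ext _ (fun j => 0 * (A i j * x j))) by (intros; ring).
rewrite Series_scal_l; ring.
Qed.

Lemma vhead_vtail n x i : x i = vhead n x i + vtail n x i.
Proof. unfold vhead, vtail; destruct Nat.leb; ring. Qed.

Lemma rhead_rtail n A : A = madd (rhead n A) (rtail n A).
Proof. apply mat_ext; intros; unfold madd, rhead, rtail; destruct Nat.leb; ring. Qed.

Lemma rtail_mmul n A B : rtail n (mmul A B) = mmul (rtail n A) B.
Proof.
apply mat_ext; intros i j.
change (vtail n (mat_apply A (fun k => B k j)) i = mat_apply (rtail n A) (fun k => B k j) i).
now rewrite mat_apply_rtail.
Qed.

Lemma Series_finite (f : nat -> R) J : (forall j, (J < j)%nat -> f j = 0) -> Series f = rsum f J.
Proof.
intros H; apply is_series_unique.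
change (is_lim_seq (sum_n f) (rsum f J)).
apply (is_lim_seq_ext_loc (fun _ => rsum f J)); [|apply is_lim_seq_const].
exists J; intros n Hn; induction Hn; [reflexivity|].
rewrite IHHn; symmetry; change (rsum f (S m) = rsum f m).
rewrite rsum_S, H by lia; ring.
Qed.

(** A finite section of x becomes a genuine l2 vector [x'] by setting its later coordinates to zero,
    and it is rescaled to norm one unless it vanishes. Nonnegativity identifies |A| with A, so that
    the bilinear form is a pairing of y with A x'. *)
Lemma opb_of_apply A c : 0 <= c -> nonneg_mat A ->
  (forall x, l2 x -> l2norm x <= 1 -> forall N, fnorm N (mat_apply A x) <= c) -> opb A c.
Proof.
intros Hc HA H; split; [exact Hc|]; intros N J x y Hx Hy.
set (x' := vhead (S J) x).
assert (Hx' : l2 x' /\ l2norm x' <= fnorm J x).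
{ apply l2_of_fnorm; intros M; apply sqrt_le_1_alt.
  destruct (le_lt_dec M J).
  - eapply Rle_trans; [|apply (rsum_incr _ M J); auto; intros; apply pow2_ge_0].
    apply rsum_le; intros i; rewrite <- (pow2_abs (x' i)), <- (pow2_abs (x i)).
    apply pow_incr; split; [apply Rabs_pos | apply vhead_le].
  - rewrite <- (Series_finite (fun i => x' i ^ 2) M).
    + rewrite (Series_finite _ J).
      * apply rsum_le; intros i; rewrite <- (pow2_abs (x' i)), <- (pow2_abs (x i)).
        apply pow_incr; split; [apply Rabs_pos | apply vhead_le].
      * intros j Hj; unfold x', vhead; rewrite (proj2 (Nat.leb_le (S J) j)) by lia; ring.
    + intros j Hj; unfold x', vhead; rewrite (proj2 (Nat.leb_le (S J) j)) by lia; ring. }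
destruct Hx' as [Hx1 Hx2].
assert (HAx : forall i, mat_apply A x' i = rsum (fun j => A i j * x j) J).
{ intros i; unfold mat_apply; rewrite (Series_finite _ J).
  - apply rsum_ext_loc; intros j Hj; unfold x', vhead.
    now rewrite (proj2 (Nat.leb_gt (S J) j)) by lia.
  - intros j Hj; unfold x', vhead; rewrite (proj2 (Nat.leb_le (S J) j)) by lia; ring. }
assert (Hn : fnorm N (mat_apply A x') <= c * fnorm J x).
{ generalize (fnorm_ge0 J x); intros Hf.
  destruct (Req_dec (fnorm J x) 0) as [E|E].
  - rewrite E, Rmult_0_r.
    assert (Z : forall j, (j <= J)%nat -> x j = 0).
    { intros j Hj; apply Rle_antisym; [|apply Hx].
      rewrite <- E, <- (sqrt_pow2 (x j)) by auto; apply sqrt_le_1_alt.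
      apply (rsum_term (fun i => x i ^ 2)); auto; intros; apply pow2_ge_0. }
    unfold fnorm; rewrite (rsum_ext _ (fun _ => 0)), rsum_zero, sqrt_0; [lra|].
    intros i; rewrite HAx, (rsum_ext_loc _ (fun _ => 0)), rsum_zero; [ring|].
    intros j Hj; rewrite Z by auto; ring.
  - set (t := fnorm J x) in *.
    assert (Ht : 0 < / t) by (apply Rinv_0_lt_compat; lra).
    destruct (l2_scal (/ t) x' Hx1) as [S1 S2].
    rewrite Rabs_pos_eq in S2 by lra.
    assert (S3 : l2norm (fun i => / t * x' i) <= 1).
    { eapply Rle_trans; [exact S2|]. apply Rle_trans with (/ t * t);
        [apply Rmult_le_compat_l; lra | rewrite Rinv_l; lra]. }
    generalize (H _ S1 S3 N); intros HN.
    assert (E2 : fnorm N (mat_apply A x') = t * fnorm N (mat_apply A (fun i => / t * x' i))).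
    { unfold fnorm; rewrite <- (sqrt_pow2 t) at 1 by lra.
      rewrite <- sqrt_mult_alt by apply pow2_ge_0; f_equal.
      rewrite <- rsum_scal_l; apply rsum_ext; intros i.
      replace (mat_apply A (fun k => / t * x' k) i) with (/ t * mat_apply A x' i).
      - field; lra.
      - unfold mat_apply; rewrite <- Series_scal_l; apply Series_ext; intros; ring. }
    rewrite E2; nra. }
apply Rle_trans with (rsum (fun i => y i * mat_apply A x' i) N).
- apply rsum_le; intros i; rewrite rsum_scal_l, HAx; apply Rmult_le_compat_l; auto.
  apply rsum_le; intros j; rewrite Rabs_pos_eq by auto; lra.
- eapply Rle_trans; [apply cauchy_schwarz_sum|]; fold (fnorm N y) (fnorm N (mat_apply A x')).
  generalize (fnorm_ge0 N y); nra.
Qed.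

(** The absolute value is there because [bounded_set] does not fix the sign of its constant, while
    [opb] asks for a nonnegative one. *)
Lemma defines_op_opb A M : nonneg_mat A -> defines_op A ->
  (forall x, l2 x -> l2norm (mat_apply A x) <= M * l2norm x) -> opb A (Rabs M).
Proof.
intros HA Hd HM; apply opb_of_apply; [apply Rabs_pos | exact HA|].
intros x Hx Hx1 N; eapply Rle_trans; [apply fnorm_le_l2norm, Hd, Hx|].
eapply Rle_trans; [apply HM, Hx|].
generalize (l2norm_ge0 x) (Rle_abs M) (Rabs_pos M); nra.
Qed.

Lemma grid1 M eps : 0 < eps ->
  exists gs : list R, forall x, Rabs x <= M -> exists g, In g gs /\ Rabs (x - g) <= eps.
Proof.
intros He.
assert (H : forall K, exists gs : list R, forall x, - M <= x <= - M + INR K * eps ->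
   exists g, In g gs /\ Rabs (x - g) <= eps).
{ induction K as [|K [gs IH]].
  - exists (cons (- M) nil); intros x Hx; exists (- M); split; [now left|].
    simpl in Hx; rewrite Rabs_pos_eq; lra.
  - exists (cons (- M + INR (S K) * eps) gs); intros x Hx; rewrite S_INR in *.
    destruct (Rle_dec x (- M + INR K * eps)) as [Hle|Hle].
    + destruct (IH x) as (g & Hg & Hd); [lra|]; exists g; split; [now right | exact Hd].
    + exists (- M + (INR K + 1) * eps); split; [left; reflexivity|].
      apply Rabs_le; lra. }
destruct (INR_unbounded (2 * M / eps)) as [K HK].
destruct (H K) as [gs Hgs]; exists gs; intros x Hx; apply Hgs.
apply Rabs_le_between in Hx; split; [lra|].
assert (2 * M < INR K * eps); [|lra].
apply Rmult_lt_reg_r with (/ eps); [now apply Rinv_0_lt_compat|].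
replace (INR K * eps * / eps) with (INR K) by (field; lra); exact HK.
Qed.

(** Bounded sets in finite dimension are totally bounded. At each step half of [eps] is spent on the
    coordinates below n and half on the coordinate n. *)
Lemma grid_head n M eps : 0 < eps -> exists cs : list vec, List.Forall l2 cs /\
  forall y, (forall i, Rabs (y i) <= M) ->
    exists c, In c cs /\ l2 (vsub (vhead n y) c) /\ l2norm (vsub (vhead n y) c) <= eps.
Proof.
revert eps; induction n as [|n IH]; intros eps He.
- destruct l2_zero as [Z1 Z2].
  exists (cons (fun _ => 0) nil); split; [constructor; auto|].
  intros y _; exists (fun _ => 0); split; [now left|].
  replace (vsub (vhead 0 y) (fun _ => 0)) with (fun _ : nat => 0); [split; [auto | rewrite Z2; lra]|].
  apply functional_extensionality; intros i; unfold vsub, vhead; simpl; ring.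
- destruct (IH (eps / 2)) as (cs & Hcs & Hnet); [lra|].
  destruct (grid1 M (eps / 2)) as [gs Hgs]; [lra|].
  assert (Hb : l2 (basis n) /\ l2norm (basis n) <= 1)
    by (apply l2_of_fnorm; intros; apply fnorm_basis).
  exists (map (fun p : vec * R => fun i => fst p i + snd p * basis n i) (list_prod cs gs)); split.
  + rewrite Forall_forall in *; intros v Hv; apply in_map_iff in Hv.
    destruct Hv as [[c g] [<- Hp]]; apply in_prod_iff in Hp; destruct Hp as [Hc _].
    apply l2_lincomb; simpl; auto; now apply Hb.
  + intros y Hy; destruct (Hnet y Hy) as (c & Hc & Hc1 & Hc2).
    destruct (Hgs (y n) (Hy n)) as (g & Hg & Hd).
    exists (fun i => c i + g * basis n i); split.
    { apply in_map_iff; exists (c, g); split; [reflexivity|]; now apply in_prod. }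
    replace (vsub (vhead (S n) y) (fun i => c i + g * basis n i))
      with (fun i => vsub (vhead n y) c i + (y n - g) * basis n i).
    * destruct (l2_lincomb (y n - g) (vsub (vhead n y) c) (basis n)) as [L1 L2]; auto.
      { apply Hb. }
      split; [exact L1|].
      generalize (Rabs_pos (y n - g)) (proj2 Hb) (l2norm_ge0 (basis n)); nra.
    * apply functional_extensionality; intros i; unfold vsub, vhead.
      destruct (Nat.eq_dec i n) as [->|Hi].
      -- rewrite basis_same, (proj2 (Nat.leb_le n n)), (proj2 (Nat.leb_gt (S n) n)) by lia; ring.
      -- rewrite basis_diff by auto.
         destruct (Nat.leb_spec n i), (Nat.leb_spec (S n) i); try lia; ring.
Qed.

Lemma l2_vtail n x : l2 x -> l2 (vtail n x).
Proof. intros Hx; apply (l2_le _ x Hx), vtail_le. Qed.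

Lemma l2_vhead n x : l2 x -> l2 (vhead n x).
Proof. intros Hx; apply (l2_le _ x Hx), vhead_le. Qed.

Lemma l2_entry x i : l2 x -> Rabs (x i) <= l2norm x.
Proof.
intros Hx; eapply Rle_trans; [|apply (fnorm_le_l2norm i x Hx)].
rewrite <- (sqrt_pow2 (Rabs (x i))) by apply Rabs_pos.
apply sqrt_le_1_alt; rewrite pow2_abs.
apply (rsum_term (fun i => x i ^ 2)); auto; intros; apply pow2_ge_0.
Qed.

Lemma l2_sub x y : l2 x -> l2 y -> l2 (vsub x y) /\ l2norm (vsub x y) <= l2norm x + l2norm y.
Proof.
intros Hx Hy.
destruct (l2_lincomb (-1) x y Hx Hy) as [H1 H2].
replace (vsub x y) with (fun i => x i + -1 * y i)
  by (apply functional_extensionality; intros; unfold vsub; ring).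
split; [exact H1|]; rewrite Rabs_left in H2; lra.
Qed.

(** The heads of a bounded set have finite nets of any mesh, so only the tails contribute to the
    radius of a finite covering. *)
Lemma net_of_tail n M d eps : 0 < eps -> exists cs : list vec, List.Forall l2 cs /\
  forall y, l2 y -> l2norm y <= M -> l2norm (vtail n y) <= d ->
    exists c, In c cs /\ l2norm (vsub y c) <= d + eps.
Proof.
intros He; destruct (grid_head n M eps He) as (cs & Hcs & Hnet).
exists cs; split; [exact Hcs|]; intros y Hy HM Hd.
destruct (Hnet y) as (c & Hc & H1 & H2).
{ intros i; eapply Rle_trans; [now apply l2_entry | exact HM]. }
exists c; split; [exact Hc|].
replace (vsub y c) with (fun i => vtail n y i + 1 * vsub (vhead n y) c i).
- eapply Rle_trans; [apply l2_lincomb; auto using l2_vtail|].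
  rewrite Rabs_R1; lra.
- apply functional_extensionality; intros i; unfold vsub.
  rewrite (vhead_vtail n y i); ring.
Qed.

Lemma l2_tail_small x eps : l2 x -> 0 < eps -> exists n, l2norm (vtail n x) <= eps.
Proof.
intros Hx He.
assert (Hl : is_lim_seq (rsum (fun i => x i ^ 2)) (Series (fun i => x i ^ 2)))
  by exact (Series_correct _ Hx).
apply is_lim_seq_spec in Hl.
assert (He2 : 0 < eps ^ 2) by (apply pow_lt; lra).
destruct (Hl (mkposreal _ He2)) as [n Hn]; change (pos (mkposreal _ He2)) with (eps ^ 2) in Hn.
exists (S n); apply l2_of_fnorm; intros N.
rewrite <- (sqrt_pow2 eps) by lra; apply sqrt_le_1_alt.
assert (E : forall N, (n <= N)%nat -> rsum (fun i => vtail (S n) x i ^ 2) N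
   = rsum (fun i => x i ^ 2) N - rsum (fun i => x i ^ 2) n).
{ clear N; induction 1.
  - rewrite (rsum_ext_loc _ (fun _ => 0)), rsum_zero; [ring|].
    intros i Hi; unfold vtail; rewrite (proj2 (Nat.leb_gt (S n) i)) by lia; ring.
  - rewrite !rsum_S, IHle; unfold vtail at 1.
    rewrite (proj2 (Nat.leb_le (S n) (S m))) by lia; ring. }
apply Rle_trans with (rsum (fun i => vtail (S n) x i ^ 2) (Nat.max n N)).
- apply rsum_incr; [intros; apply pow2_ge_0 | lia].
- rewrite E by lia.
  generalize (Hn n (le_n n)); intros H; apply Rabs_def2 in H; destruct H.
  assert (rsum (fun i => x i ^ 2) (Nat.max n N) <= Series (fun i => x i ^ 2))
    by (apply rsum_le_Series; [intros; apply pow2_ge_0 | exact Hx]).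
  lra.
Qed.

Lemma l2_tail_anti n k x : l2 x -> (n <= k)%nat -> l2norm (vtail k x) <= l2norm (vtail n x).
Proof. intros Hx Hk; apply l2_le; [now apply l2_vtail | intros; now apply vtail_anti]. Qed.

Lemma l2_tails_small (cs : list vec) eps : List.Forall l2 cs -> 0 < eps ->
  exists n, forall c, In c cs -> l2norm (vtail n c) <= eps.
Proof.
intros H He; induction H as [|c cs Hc Hcs [n IH]].
- exists 0%nat; intros c [].
- destruct (l2_tail_small c eps Hc He) as [k Hk].
  exists (Nat.max n k); intros d [<-|Hd].
  + eapply Rle_trans; [apply (l2_tail_anti k); auto; lia | exact Hk].
  + rewrite Forall_forall in Hcs.
    eapply Rle_trans; [apply (l2_tail_anti n); auto; lia | auto].
Qed.

Lemma vtail_net_bound n y c d eps : l2 y -> l2 c ->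
  l2norm (vsub y c) <= d -> l2norm (vtail n c) <= eps -> l2norm (vtail n y) <= d + eps.
Proof.
intros Hy Hc Hd He.
destruct (l2_sub y c Hy Hc) as [Hs _].
replace (vtail n y) with (fun i => vtail n (vsub y c) i + 1 * vtail n c i).
- eapply Rle_trans; [apply l2_lincomb; now apply l2_vtail|].
  rewrite Rabs_R1.
  destruct (l2_le (vtail n (vsub y c)) _ Hs (vtail_le _ _)); lra.
- apply functional_extensionality; intros i; unfold vtail, vsub; destruct Nat.leb; ring.
Qed.

(** A member and the lower bound 0 together make the infimum finite, so that [real] does not return
    its default value. *)
Lemma Glb_Rbar_real (E : R -> Prop) d0 : E d0 -> (forall d, E d -> 0 <= d) ->
  0 <= real (Glb_Rbar E) /\ (forall d, E d -> real (Glb_Rbar E) <= d) /\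
  (forall eps, 0 < eps -> exists d, E d /\ d < real (Glb_Rbar E) + eps).
Proof.
intros H0 Hpos; destruct (Glb_Rbar_correct E) as [Hlb Hg].
assert (H0' : Rbar_le 0 (Glb_Rbar E)) by (apply Hg; intros d Hd; now apply Hpos).
generalize (Hlb d0 H0); intros H1.
destruct (Glb_Rbar E) as [g| |]; simpl in *; try easy.
split; [exact H0'|]; split; [exact Hlb|].
intros eps He; apply NNPP; intros Hn.
assert (H2 : Rbar_le (g + eps) g).
{ apply Hg; intros d Hd; simpl; apply Rnot_lt_le; intros Hlt; apply Hn; now exists d. }
simpl in H2; lra.
Qed.

Lemma gamma_covers A c d eps : opb A c -> (exists n, opb (rtail n A) d) -> 0 < eps ->
  covered_by (unit_ball_image A) (d + eps).
Proof.
intros HA [n Hn] He.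
destruct (net_of_tail n c d eps He) as (cs & Hcs & Hnet).
exists cs; split; [exact Hcs|]; intros y (x & Hx & Hx1 & ->).
apply Exists_exists.
destruct (mat_apply_bound A c x HA Hx) as [B1 B2].
destruct (Hnet (mat_apply A x)) as (v & Hv & Hd); auto.
- generalize (opb_ge0 _ _ HA); nra.
- rewrite <- (functional_extensionality _ _ (mat_apply_rtail n A x)).
  destruct (mat_apply_bound _ _ x Hn Hx) as [_ B3]; generalize (opb_ge0 _ _ Hn); nra.
- now exists v.
Qed.

(** Coverings and row tails control each other. Finitely many centres in l2 have uniformly small
    tails, so a covering of radius d bounds the tails of the image by d plus an error. Conversely,
    [gamma_covers] turns a bound on some row tail into finite coverings. *)
Lemma gamma_spec A c : opb A c -> nonneg_mat A ->
  0 <= gamma A /\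
  (forall eps, 0 < eps -> exists n, opb (rtail n A) (gamma A + eps)) /\
  (forall d, 0 <= d -> (forall eps, 0 < eps -> exists n, opb (rtail n A) (d + eps)) ->
     gamma A <= d).
Proof.
intros HA HA0.
destruct (Glb_Rbar_real (fun d => 0 < d /\ covered_by (unit_ball_image A) d) (c + 1))
  as (G1 & G2 & G3).
{ generalize (opb_ge0 _ _ HA); intros Hc; split; [lra|].
  apply (gamma_covers A c); auto; [|lra]. exists 0%nat; exact HA. }
{ intros; lra. }
change (real (Glb_Rbar (fun d => 0 < d /\ covered_by (unit_ball_image A) d))) with (gamma A) in *.
split; [exact G1|]; split.
- intros eps He; destruct (G3 (eps / 2)) as (d & (Hd & cs & Hcs & Hnet) & Hlt); [lra|].
  destruct (l2_tails_small cs (eps / 2) Hcs) as [n Hn]; [lra|].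
  exists n; apply (opb_weaken _ (d + eps / 2)); [|lra].
  apply opb_of_apply; [lra | |].
  { intros i j; unfold rtail; destruct Nat.leb; auto; lra. }
  intros x Hx Hx1 N.
  rewrite (functional_extensionality _ _ (mat_apply_rtail n A x)).
  assert (HAx : l2 (mat_apply A x)) by (apply (mat_apply_bound A c x HA Hx)).
  eapply Rle_trans; [apply fnorm_le_l2norm; now apply l2_vtail|].
  assert (Hy : unit_ball_image A (mat_apply A x)) by (exists x; auto).
  apply Hnet, Exists_exists in Hy; destruct Hy as (v & Hv & Hd').
  rewrite Forall_forall in Hcs.
  apply (vtail_net_bound n _ v); auto.
- intros d Hd H; apply Rnot_lt_le; intros Hlt.
  (* One [eps] is lost to the tail bound and one to the mesh of the net, so a third of the gap
     leaves a contradiction. *)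
  set (eps := (gamma A - d) / 3).
  destruct (H eps) as [n Hn]; [unfold eps; lra|].
  assert (gamma A <= d + eps + eps); [|unfold eps in *; lra].
  apply G2; split; [unfold eps; lra|].
  apply (gamma_covers A c); eauto; unfold eps; lra.
Qed.

(** * Real powers and finite products *)

Lemma rpow_gt0 x t : 0 < x -> rpow x t = Rpower x t.
Proof. intros; unfold rpow; destruct Rlt_dec; [reflexivity | lra]. Qed.

Lemma rpow_le0 x t : x <= 0 -> rpow x t = 0.
Proof. intros; unfold rpow; destruct Rlt_dec; [lra | reflexivity]. Qed.

Lemma rpow_pos x t : 0 < x -> 0 < rpow x t.
Proof. intros; rewrite rpow_gt0 by auto; apply exp_pos. Qed.

Lemma rpow_ge0 x t : 0 <= rpow x t.
Proof. unfold rpow; destruct Rlt_dec; [left; apply exp_pos | lra]. Qed.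

Lemma rpow_le x y t : 0 <= t -> x <= y -> rpow x t <= rpow y t.
Proof.
intros Ht H; destruct (Rle_dec x 0) as [Hx|Hx].
- rewrite (rpow_le0 x) by auto; apply rpow_ge0.
- rewrite !rpow_gt0 by lra; apply Rle_Rpower_l; lra.
Qed.

Lemma rpow_mult x y t : 0 <= x -> 0 <= y -> rpow (x * y) t = rpow x t * rpow y t.
Proof.
intros [Hx|<-] [Hy|<-]; rewrite ?Rmult_0_l, ?Rmult_0_r, ?(rpow_le0 0), ?Rmult_0_l, ?Rmult_0_r by lra;
  try reflexivity.
rewrite !rpow_gt0 by (auto; nra); symmetry; now apply Rpower_mult_distr.
Qed.

Lemma rpow_rpow x s t : rpow (rpow x s) t = rpow x (s * t).
Proof.
destruct (Rle_dec x 0) as [Hx|Hx].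
- now rewrite !(rpow_le0 x), rpow_le0 by lra.
- rewrite (rpow_gt0 x), !rpow_gt0 by (try apply exp_pos; lra); apply Rpower_mult.
Qed.

Lemma rpow_1_l t : rpow 1 t = 1.
Proof.
rewrite rpow_gt0 by lra; unfold Rpower; rewrite ln_1, Rmult_0_r; apply exp_0.
Qed.

Lemma rpow_1_r x : 0 <= x -> rpow x 1 = x.
Proof.
intros [Hx|<-]; [rewrite rpow_gt0 by auto; now apply Rpower_1 | apply rpow_le0; lra].
Qed.

Lemma rpow_pow_l x n t : 0 <= x -> rpow (x ^ n) t = rpow x t ^ n.
Proof.
intros Hx; induction n; simpl; [apply rpow_1_l|].
now rewrite rpow_mult, IHn by auto using pow_le.
Qed.

Lemma rpow_INR x n : 0 <= x -> rpow x (INR (S n)) = x ^ S n.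
Proof.
intros Hx; induction n.
- simpl; rewrite rpow_1_r; lra.
- rewrite S_INR; destruct Hx as [Hx|<-].
  + rewrite rpow_gt0, Rpower_plus, Rpower_1, <- rpow_gt0, IHn by auto; simpl; ring.
  + rewrite rpow_le0 by lra; simpl; ring.
Qed.

Lemma INR_S_pos n : 0 < INR (S n).
Proof. apply lt_0_INR; lia. Qed.

Lemma rpow_root x n : 0 <= x -> rpow (x ^ S n) (/ INR (S n)) = x.
Proof.
intros Hx; rewrite <- rpow_INR by auto; rewrite rpow_rpow, Rinv_r, rpow_1_r; auto.
apply Rgt_not_eq, INR_S_pos.
Qed.

Lemma root_pow x n : 0 <= x -> rpow x (/ INR (S n)) ^ S n = x.
Proof.
intros Hx; rewrite <- rpow_INR by apply rpow_ge0; rewrite rpow_rpow, Rinv_l, rpow_1_r; auto.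
apply Rgt_not_eq, INR_S_pos.
Qed.

Lemma rpow_root_le x y n : 0 <= y -> x <= y ^ S n -> rpow x (/ INR (S n)) <= y.
Proof.
intros Hy H; rewrite <- (rpow_root y n Hy); apply rpow_le; auto.
left; apply Rinv_0_lt_compat, INR_S_pos.
Qed.

(** Continuity is needed at 0 as well, since the measures of noncompactness to which it is applied
    may vanish; there the constant branch and the power branch meet. *)
Lemma rpow_continuous a t : 0 < t -> continuity_pt (fun x => rpow x t) a.
Proof.
intros Ht; destruct (total_order_T a 0) as [[Ha|Ha]|Ha].
- apply continuity_pt_ext_loc with (f := fun _ => 0); [|apply continuity_pt_const; now intros ? ?].
  exists (mkposreal (- a) ltac:(lra)); intros y Hy.
  change (Rabs (y - a) < - a) in Hy; apply Rabs_def2 in Hy; destruct Hy.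
  symmetry; apply rpow_le0; lra.
- subst a; intros eps Heps.
  (* The inverse of the power function at [eps]. *)
  exists (rpow eps (/ t)); split; [now apply rpow_pos|].
  intros x [_ Hx]; simpl in *; unfold R_dist in *.
  rewrite Rminus_0_r in Hx; rewrite (rpow_le0 0), Rminus_0_r by lra.
  rewrite Rabs_pos_eq by apply rpow_ge0.
  destruct (Rle_dec x 0); [rewrite rpow_le0 by lra; lra|].
  rewrite Rabs_pos_eq in Hx by lra.
  replace eps with (rpow (rpow eps (/ t)) t).
  + rewrite !rpow_gt0 by (try apply exp_pos; try (rewrite rpow_gt0 by lra; apply exp_pos); lra).
    apply Rlt_Rpower_l; [lra|]. rewrite <- rpow_gt0 by lra; lra.
  + rewrite rpow_rpow, Rinv_l, rpow_1_r; lra.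
- apply continuity_pt_ext_loc with (f := fun x => exp (t * ln x)).
  + exists (mkposreal a Ha); intros y Hy.
    change (Rabs (y - a) < a) in Hy; apply Rabs_def2 in Hy; destruct Hy.
    now rewrite rpow_gt0 by lra.
  + apply (continuity_pt_comp (fun x => t * ln x) exp).
    * apply continuity_pt_scal, derivable_continuous_pt.
      exists (/ a); now apply derivable_pt_lim_ln.
    * apply derivable_continuous_pt, derivable_pt_exp.
Qed.

Lemma is_lim_seq_rpow u (a : R) t : 0 < t -> is_lim_seq u a ->
  is_lim_seq (fun n => rpow (u n) t) (rpow a t).
Proof.
intros Ht Hu; apply (is_lim_seq_continuous (fun x => rpow x t)); [now apply rpow_continuous | exact Hu].
Qed.

(** * Finite products and the inequality between geometric and arithmetic means *)

Definition prodm (m : nat) (f : nat -> R) : R := fold_right Rmult 1 (map f (seq 0 m)).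

Lemma prodm_S m f : prodm (S m) f = prodm m f * f m.
Proof.
unfold prodm; rewrite seq_S, map_app, fold_right_app; simpl.
rewrite Rmult_1_r; generalize (map f (seq 0 m)); intros l.
induction l; simpl; [ring | rewrite IHl; ring].
Qed.

Lemma prodm_ext m f g : (forall j, (j < m)%nat -> f j = g j) -> prodm m f = prodm m g.
Proof.
induction m; intros H; [reflexivity|]; rewrite !prodm_S, IHm, H; auto.
Qed.

Lemma prodm_ge0 m f : (forall j, (j < m)%nat -> 0 <= f j) -> 0 <= prodm m f.
Proof.
induction m; intros H; [unfold prodm; simpl; lra|]; rewrite prodm_S; apply Rmult_le_pos; auto.
Qed.

Lemma prodm_le m f g : (forall j, (j < m)%nat -> 0 <= f j <= g j) -> prodm m f <= prodm m g.
Proof.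
induction m; intros H; [unfold prodm; simpl; lra|]; rewrite !prodm_S.
apply Rmult_le_compat; auto; try (now apply H; auto); apply prodm_ge0; intros; now apply H; auto.
Qed.

Lemma prodm_mult m f g : prodm m (fun j => f j * g j) = prodm m f * prodm m g.
Proof.
induction m; [unfold prodm; simpl; ring | rewrite !prodm_S, IHm; ring].
Qed.

Lemma prodm_zero m f j : (j < m)%nat -> f j = 0 -> prodm m f = 0.
Proof.
induction m; intros Hj H; [lia|]; rewrite prodm_S.
destruct (Nat.eq_dec j m) as [<-|]; [rewrite H; ring | rewrite IHm by (auto; lia); ring].
Qed.

Lemma prodm_pow m f n : prodm m (fun j => f j ^ n) = prodm m f ^ n.
Proof.
induction m; [unfold prodm; simpl; now rewrite pow1 | rewrite !prodm_S, IHm, Rpow_mult_distr; ring].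
Qed.

Lemma prodm_rpow m f t : (forall j, (j < m)%nat -> 0 <= f j) ->
  rpow (prodm m f) t = prodm m (fun j => rpow (f j) t).
Proof.
induction m; intros H; [unfold prodm; simpl; apply rpow_1_l|].
rewrite !prodm_S, rpow_mult, IHm; auto using prodm_ge0.
Qed.

Lemma prodm_shift m f : prodm (S m) f = f 0%nat * prodm m (fun j => f (S j)).
Proof.
induction m; [unfold prodm; simpl; ring|].
rewrite prodm_S, IHm, prodm_S; ring.
Qed.

Lemma prodm_cyclic m f t : (1 <= m)%nat -> prodm m (fun j => f ((j + t) mod m)) = prodm m f.
Proof.
intros Hm; induction t.
- apply prodm_ext; intros j Hj; rewrite Nat.add_0_r, Nat.mod_small; auto.
- rewrite <- IHt; destruct m as [|p]; [lia|].
  rewrite prodm_S, (prodm_shift p), Rmult_comm; f_equal.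
  + f_equal; replace (p + S t)%nat with (t + 1 * S p)%nat by lia.
    rewrite Nat.Div0.mod_add; f_equal; lia.
  + apply prodm_ext; intros j Hj; f_equal; f_equal; lia.
Qed.

Lemma is_lim_seq_prodm m (u : nat -> nat -> R) (l : nat -> R) :
  (forall j, (j < m)%nat -> is_lim_seq (u j) (l j)) ->
  is_lim_seq (fun n => prodm m (fun j => u j n)) (prodm m l).
Proof.
induction m; intros H.
- apply is_lim_seq_const.
- rewrite prodm_S; apply (is_lim_seq_ext (fun n => prodm m (fun j => u j n) * u m n)).
  { intros n; now rewrite prodm_S. }
  apply is_lim_seq_mult'; auto.
Qed.

Lemma prodm_exp_ln p u a : (forall j, (j < S p)%nat -> 0 < u j) ->
  prodm (S p) (fun j => rpow (u j) a) = exp (a * rsum (fun j => ln (u j)) p).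
Proof.
induction p; intros H.
- rewrite rsum_0; unfold prodm; simpl; rewrite rpow_gt0 by auto; unfold Rpower; ring.
- rewrite prodm_S, IHp, rsum_S by auto; rewrite rpow_gt0 by auto.
  unfold Rpower; rewrite <- exp_plus; f_equal; ring.
Qed.

Lemma rsum_const c n : rsum (fun _ => c) n = INR (S n) * c.
Proof.
induction n; [rewrite rsum_0; simpl; ring | rewrite rsum_S, IHn, (S_INR (S n)); ring].
Qed.

Lemma ln_le_sub1 x : 0 < x -> ln x <= x - 1.
Proof.
intros Hx; generalize (exp_ineq1_le (ln x)); rewrite exp_ln by auto; lra.
Qed.

(* When [a = / m] this is the inequality between geometric and arithmetic means. *)
Lemma prodm_le_mean m u a : (1 <= m)%nat -> / INR m <= a ->
  (forall j, (j < m)%nat -> 0 <= u j <= 1) ->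
  prodm m (fun j => rpow (u j) a) <= / INR m * rsum u (m - 1).
Proof.
destruct m as [|p]; [lia|]; intros _ Ha Hu; simpl Nat.sub; rewrite Nat.sub_0_r.
generalize (INR_S_pos p); intros Hp.
assert (Hip : 0 < / INR (S p)) by now apply Rinv_0_lt_compat.
assert (Hs : forall k, (k <= p)%nat -> 0 <= rsum u k).
{ induction k; intros Hk; [rewrite rsum_0; apply Hu; lia|].
  rewrite rsum_S; generalize (IHk ltac:(lia)) (proj1 (Hu (S k) ltac:(lia))); lra. }
(* A vanishing factor is treated apart, because logarithms are taken below. *)
destruct (classic (exists j, (j < S p)%nat /\ u j = 0)) as [(j & Hj & E)|Hne].
{ rewrite (prodm_zero _ _ j) by (auto; apply rpow_le0; lra).
  generalize (Hs p (le_n p)); nra. }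
assert (Hpos : forall j, (j < S p)%nat -> 0 < u j).
{ intros j Hj; destruct (Hu j Hj) as [[H|H] _]; [exact H|].
  exfalso; apply Hne; now exists j. }
rewrite prodm_exp_ln by exact Hpos.
set (A := / INR (S p) * rsum u p).
assert (HA : 0 < A).
{ apply Rmult_lt_0_compat; [exact Hip|].
  destruct p; [rewrite rsum_0; auto|].
  rewrite rsum_S; generalize (Hs p ltac:(lia)) (Hpos (S p) ltac:(lia)); lra. }
set (L := rsum (fun j => ln (u j)) p).
assert (HL0 : L <= 0).
{ unfold L; rewrite <- (rsum_zero p); apply rsum_le_loc; intros i Hi.
  generalize (ln_le_sub1 (u i) (Hpos i ltac:(lia))) (proj2 (Hu i ltac:(lia))); lra. }
(* The tangent inequality ln x <= x - 1 at x = u_j / A; after summation the linear terms cancel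
   because A is the mean of the u_j. *)
assert (HL : L <= INR (S p) * ln A).
{ apply Rle_trans with (rsum (fun j => (ln A - 1) + / A * u j) p).
  - apply rsum_le_loc; intros j Hj.
    assert (Hj' : 0 < u j) by (apply Hpos; lia).
    assert (Hq : 0 < u j / A) by now apply Rdiv_lt_0_compat.
    generalize (ln_le_sub1 (u j / A) Hq); rewrite ln_div by auto.
    unfold Rdiv; lra.
  - rewrite rsum_add, rsum_const, rsum_scal_l.
    assert (E : / A * rsum u p = INR (S p)).
    { apply (Rmult_eq_reg_l A); [|lra]; rewrite <- Rmult_assoc, Rinv_r by lra.
      unfold A; field; lra. }
    rewrite E; lra. }
rewrite <- (exp_ln A HA).
(* All u_j are at most 1, so L <= 0, and an exponent a >= 1/m gives at most the value for 1/m. *)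
assert (a * L <= ln A).
{ apply Rle_trans with (/ INR (S p) * L); [nra|].
  apply (Rmult_le_reg_l (INR (S p))); [exact Hp|].
  rewrite <- Rmult_assoc, Rinv_r by lra; lra. }
destruct H as [H| ->]; [left; now apply exp_increasing | lra].
Qed.

(** Dividing by N_j brings every factor into [0, 1]. A product of powers is thereby bounded by a
    linear expression in the c_j, which can be summed over entries or read as a combination of
    matrices. *)
Lemma prodm_le_weighted_mean m c N a : (1 <= m)%nat -> / INR m <= a ->
  (forall j, (j < m)%nat -> 0 < N j) -> (forall j, (j < m)%nat -> 0 <= c j <= N j) ->
  prodm m (fun j => rpow (c j) a)
  <= prodm m (fun j => rpow (N j) a) * (/ INR m * rsum (fun j => c j / N j) (m - 1)).
Proof.
intros Hm Ha HN Hc.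
assert (Hu : forall j, (j < m)%nat -> 0 <= c j / N j <= 1).
{ intros j Hj; generalize (HN j Hj) (Hc j Hj); intros H1 [H2 H3].
  assert (0 < / N j) by now apply Rinv_0_lt_compat.
  unfold Rdiv; split; [nra|].
  apply Rle_trans with (N j * / N j); [nra | rewrite Rinv_r; lra]. }
rewrite (prodm_ext _ _ (fun j => rpow (N j) a * rpow (c j / N j) a)).
- rewrite prodm_mult; apply Rmult_le_compat_l.
  + apply prodm_ge0; intros; apply rpow_ge0.
  + now apply prodm_le_mean.
- intros j Hj; generalize (HN j Hj) (Hu j Hj); intros.
  rewrite <- rpow_mult by lra; f_equal; field; lra.
Qed.

Lemma exponent_pos m a : (1 <= m)%nat -> / INR m <= a -> 0 < a.
Proof.
intros Hm Ha; eapply Rlt_le_trans; [|exact Ha].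
apply Rinv_0_lt_compat, lt_0_INR; lia.
Qed.

(** A form of Hölder's inequality for m equal exponents with m a >= 1. After each series is
    normalised to sum 1, the mean inequality holds term by term and the majorant sums exactly to
    P. *)
Lemma Series_prodm_le m (f : nat -> nat -> R) a : (1 <= m)%nat -> / INR m <= a ->
  (forall j, (j < m)%nat -> (forall k, 0 <= f j k) /\ ex_series (f j)) ->
  ex_series (fun k => prodm m (fun j => rpow (f j k) a)) /\
  Series (fun k => prodm m (fun j => rpow (f j k) a))
  <= prodm m (fun j => rpow (Series (f j)) a).
Proof.
intros Hm Ha Hf.
assert (Hp0 : forall k, 0 <= prodm m (fun j => rpow (f j k) a))
  by (intros; apply prodm_ge0; intros; apply rpow_ge0).
assert (Hs : forall j, (j < m)%nat -> 0 <= Series (f j)) by (intros; apply Series_nonneg; now apply Hf).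
(* A series with sum 0 cannot be normalised, but then all its terms vanish and so do the
   products. *)
destruct (classic (exists j, (j < m)%nat /\ Series (f j) = 0)) as [(j & Hj & E)|Hne].
{ apply series_bounded; [exact Hp0|]; intros n.
  rewrite (rsum_ext _ (fun _ => 0)), rsum_zero.
  - apply prodm_ge0; intros; apply rpow_ge0.
  - intros k; apply (prodm_zero _ _ j Hj), rpow_le0.
    rewrite <- E; apply term_le_Series; now apply Hf. }
assert (Hpos : forall j, (j < m)%nat -> 0 < Series (f j)).
{ intros j Hj; destruct (Hs j Hj) as [H|H]; [exact H|].
  exfalso; apply Hne; now exists j. }
set (P := prodm m (fun j => rpow (Series (f j)) a)).
assert (HP : 0 <= P) by (apply prodm_ge0; intros; apply rpow_ge0).
destruct m as [|p]; [lia|]; replace (S p - 1)%nat with p in * by lia.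
assert (Hj' : forall j, (j <= p)%nat -> ex_series (fun k => f j k / Series (f j)) /\
    Series (fun k => f j k / Series (f j)) = 1).
{ intros j Hj; split.
  - apply (ex_series_ext (fun k => / Series (f j) * f j k)); [intros; apply Rmult_comm|].
    apply (ex_series_scal (V := R_NormedModule)); apply Hf; lia.
  - unfold Rdiv; rewrite Series_scal_r; apply Rinv_r, Rgt_not_eq, Hpos; lia. }
(* Cut off to 0 beyond p because [ex_series_finite_sum] asks for convergence at every index. *)
set (g := fun j k => if Nat.leb j p then f j k / Series (f j) else 0).
assert (Hg : forall j, ex_series (g j)).
{ intros j; unfold g; destruct (Nat.leb_spec j p); [now apply Hj'|].
  apply series_bounded with (M := 0); [intros; lra | intros n; rewrite rsum_zero; lra]. }
destruct (ex_series_finite_sum (fun k j => g j k) p Hg) as [G1 G2].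
assert (G3 : Series (fun k => rsum (fun j => g j k) p) = INR (S p)).
{ rewrite G2, (rsum_ext_loc _ (fun _ => 1)); [rewrite rsum_const; ring|].
  intros j Hj; rewrite <- (proj2 (Hj' j Hj)); apply Series_ext; intros k.
  unfold g; now rewrite (proj2 (Nat.leb_le j p) Hj). }
assert (Hle : forall k, 0 <= prodm (S p) (fun j => rpow (f j k) a)
   <= P * / INR (S p) * rsum (fun j => g j k) p).
{ intros k; split; [apply Hp0|].
  rewrite Rmult_assoc.
  rewrite (rsum_ext_loc _ (fun j => f j k / Series (f j)));
    [|intros j Hj; unfold g; now rewrite (proj2 (Nat.leb_le j p) Hj)].
  generalize (prodm_le_weighted_mean (S p) (fun j => f j k) (fun j => Series (f j)) a).
  replace (S p - 1)%nat with p by lia; intros H; apply H; auto.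
  intros j Hj; split; [now apply Hf | apply term_le_Series; now apply Hf]. }
assert (Hex : ex_series (fun k => P * / INR (S p) * rsum (fun j => g j k) p))
  by (apply (ex_series_scal (V := R_NormedModule)); exact G1).
split.
- apply ex_series_Rabs, (ex_series_le_nonneg _ _) with (2 := Hex).
  intros k; rewrite Rabs_pos_eq; apply Hle.
- eapply Rle_trans; [apply Series_le; [exact Hle | exact Hex]|].
  rewrite Series_scal_l, G3, Rmult_assoc, Rinv_l; [lra|].
  apply Rgt_not_eq, INR_S_pos.
Qed.

(** * Tails of nonnegative matrices *)

Definition nb (A : Mat) : Prop := nonneg_mat A /\ bmat A.

(* For a nonnegative matrix, [tails A c] means [gamma A <= c]. *)
Definition tails (A : Mat) (c : R) : Prop :=
  forall eps, 0 < eps -> exists n, opb (rtail n A) (c + eps).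

Definition ctail (n : nat) (A : Mat) : Mat := fun i j => if Nat.leb n j then A i j else 0.
Definition chead (n : nat) (A : Mat) : Mat := fun i j => if Nat.leb n j then 0 else A i j.

Lemma nb_nonneg A i j : nb A -> 0 <= A i j.
Proof. now intros [H _]. Qed.

Lemma nb_bmat A : nb A -> bmat A.
Proof. now intros []. Qed.

Lemma nb_mmul A B : nb A -> nb B -> nb (mmul A B).
Proof.
intros [HA HA'] [HB HB']; split; [now apply nonneg_mmul | now apply bmat_mmul].
Qed.

Lemma nb_transp A : nb A -> nb (transp A).
Proof. intros [HA HA']; split; [intros i j; apply HA | now apply bmat_transp]. Qed.

Lemma nb_one : nb mone.
Proof. split; [intros i j; apply basis_ge0 | apply bmat_one]. Qed.

Lemma nb_rtail n A : nb A -> nb (rtail n A).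
Proof.
intros [HA HA']; split.
- intros i j; unfold rtail; destruct Nat.leb; auto; lra.
- apply (bmat_mono _ A HA'), rtail_le.
Qed.

Lemma gamma_ge0 A : nb A -> 0 <= gamma A.
Proof. intros [HA [c Hc]]; now apply (gamma_spec A c). Qed.

Lemma gamma_tails A : nb A -> tails A (gamma A).
Proof. intros [HA [c Hc]]; exact (proj1 (proj2 (gamma_spec A c Hc HA))). Qed.

Lemma gamma_le A d : nb A -> 0 <= d -> tails A d -> gamma A <= d.
Proof. intros [HA [c Hc]]; exact (proj2 (proj2 (gamma_spec A c Hc HA)) d). Qed.

Lemma opb_tails n A d : opb (rtail n A) d -> tails A d.
Proof. intros H eps He; exists n; apply (opb_weaken _ d); auto; lra. Qed.

Lemma gamma_le_rtail n A d : nb A -> opb (rtail n A) d -> gamma A <= d.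
Proof.
intros HA H; apply gamma_le; [exact HA | now apply opb_ge0 in H | now apply (opb_tails n)].
Qed.

Lemma gamma_le_opb A c : nonneg_mat A -> opb A c -> gamma A <= c.
Proof. intros HA H; apply (gamma_le_rtail 0); [split; [exact HA | now exists c] | exact H]. Qed.

Lemma opb_rtail_anti n k A c : opb (rtail n A) c -> (n <= k)%nat -> opb (rtail k A) c.
Proof. intros H Hk; apply (opb_mono _ _ c c H); [intros; now apply rtail_anti | lra]. Qed.

Lemma tails_mono A B c : tails B c -> (forall i j, Rabs (A i j) <= Rabs (B i j)) -> tails A c.
Proof.
intros HB H eps He; destruct (HB eps He) as [n Hn]; exists n.
apply (opb_mono _ _ _ _ Hn); [|lra].
intros i j; unfold rtail; destruct Nat.leb; auto; lra.
Qed.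

Lemma gamma_mono A B : nb A -> nb B -> (forall i j, A i j <= B i j) -> gamma A <= gamma B.
Proof.
intros HA HB H; apply gamma_le; [exact HA | now apply gamma_ge0|].
apply (tails_mono A B); [now apply gamma_tails|].
intros i j; rewrite !Rabs_pos_eq by (now apply nb_nonneg); apply H.
Qed.

Lemma column_tail_small A k eps : bmat A -> 0 < eps ->
  exists n, opb (rtail n (fun i j => if Nat.eqb j k then A i j else 0)) eps.
Proof.
intros [c HA] He; destruct (opb_column A c k HA) as [Hl _].
destruct (l2_tail_small _ eps Hl He) as [n Hn]; exists n.
apply (opb_single_column _ k); [lra | |].
- intros i j Hj; unfold rtail; destruct (Nat.eqb_spec j k); [easy|]; now destruct Nat.leb.
- intros N.
  rewrite (rsum_ext _ (fun i => vtail n (fun i => A i k) i ^ 2)).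
  + rewrite <- fnorm_sq.
    generalize (fnorm_le_l2norm N _ (l2_vtail n _ Hl)) (fnorm_ge0 N (vtail n (fun i => A i k))).
    intros; assert (fnorm N (vtail n (fun i => A i k)) <= eps) by lra; nra.
  + intros i; unfold rtail, vtail; now rewrite Nat.eqb_refl.
Qed.

(** Finitely many columns form a finite-rank operator: each column lies in l2 and hence has small
    tails, and [eps] is halved at every new column. *)
Lemma chead_tail_small A k eps : bmat A -> 0 < eps -> exists n, opb (rtail n (chead k A)) eps.
Proof.
intros HA; revert eps; induction k as [|k IH]; intros eps He.
- exists 0%nat; apply (opb_mono _ mzero 0 eps opb_zero); [|lra].
  intros i j; unfold rtail, chead, mzero; simpl; lra.
- destruct (IH (eps / 2)) as [n Hn]; [lra|].
  destruct (column_tail_small A k (eps / 2) HA) as [p Hp]; [lra|].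
  exists (Nat.max n p).
  assert (H := opb_add _ _ _ _ (opb_rtail_anti _ (Nat.max n p) _ _ Hn ltac:(lia))
                 (opb_rtail_anti _ (Nat.max n p) _ _ Hp ltac:(lia))).
  apply (opb_mono _ _ _ _ H); [|lra].
  intros i j; apply Req_le; f_equal; unfold madd, rtail, chead.
  destruct Nat.leb; [|ring].
  destruct (Nat.leb_spec (S k) j), (Nat.leb_spec k j), (Nat.eqb_spec j k); try lia; ring.
Qed.

(** B is split at row k. Against the upper rows of B only the first k columns of A count, and their
    row tails are small; against the lower rows the two tail bounds multiply. *)
Lemma tails_mmul A B a b : 0 <= a -> 0 <= b -> bmat A -> bmat B -> tails A a -> tails B b ->
  tails (mmul A B) (a * b).
Proof.
intros Ha Hb HA [b0 HB] HtA HtB eps He.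
assert (Hb0 := opb_ge0 _ _ HB).
(* With d <= 1 the total bound d b0 + (a + d) (b + d) exceeds a b by at most d (a + b + 1 + b0). *)
set (d := Rmin 1 (eps / (a + b + 1 + b0))).
assert (Hd : 0 < d) by (apply Rmin_glb_lt; [lra | apply Rdiv_lt_0_compat; lra]).
assert (Hd1 : d <= 1) by apply Rmin_l.
assert (Hd2 : d * (a + b + 1 + b0) <= eps).
{ apply Rle_trans with (eps / (a + b + 1 + b0) * (a + b + 1 + b0)).
  - apply Rmult_le_compat_r; [lra | apply Rmin_r].
  - apply Req_le; field; lra. }
destruct (HtB d Hd) as [k Hk].
destruct (HtA d Hd) as [n1 Hn1].
destruct (chead_tail_small A k d HA Hd) as [n2 Hn2].
set (n := Nat.max n1 n2); exists n.
apply (opb_rtail_anti _ n) in Hn1; [|unfold n; lia].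
apply (opb_rtail_anti _ n) in Hn2; [|unfold n; lia].
assert (HnA : bmat (rtail n A)) by (apply (bmat_mono _ A HA), rtail_le).
rewrite rtail_mmul, (rhead_rtail k B), mmul_add_r; auto.
2:{ apply (bmat_mono _ B); [now exists b0 | apply rhead_le]. }
2:{ apply (bmat_mono _ B); [now exists b0 | apply rtail_le]. }
replace (mmul (rtail n A) (rhead k B)) with (mmul (rtail n (chead k A)) B).
- apply (opb_weaken _ (d * b0 + (a + d) * (b + d))).
  + apply opb_add; now apply opb_mmul.
  + nra.
- apply mat_ext; intros i j; apply Series_ext; intros l; unfold rtail, chead, rhead.
  destruct Nat.leb, Nat.leb; ring.
Qed.

Lemma gamma_mmul A B : nb A -> nb B -> gamma (mmul A B) <= gamma A * gamma B.
Proof.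
intros HA HB; generalize (gamma_ge0 A HA) (gamma_ge0 B HB); intros.
apply gamma_le; [now apply nb_mmul | nra|].
apply tails_mmul; auto using nb_bmat, gamma_tails.
Qed.

Lemma transp_rtail n A : rtail n (transp A) = transp (ctail n A).
Proof. reflexivity. Qed.

(** The columns of the transpose with index at least k are the rows of A that the tail bound
    controls, and its remaining k columns have small row tails. Hence the row tail is dominated by
    the sum of two controlled matrices. *)
Lemma gamma_transp_le A : nb A -> gamma (transp A) <= gamma A.
Proof.
intros HA; apply gamma_le; [now apply nb_transp | now apply gamma_ge0|].
intros eps He.
destruct (gamma_tails A HA (eps / 2)) as [k Hk]; [lra|].
destruct (chead_tail_small (transp A) k (eps / 2)) as [n Hn]; [now apply nb_bmat, nb_transp | lra|].
exists n.
apply (opb_mono _ _ _ _ (opb_add _ _ _ _ (opb_transp _ _ Hk) Hn)); [|lra].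
intros i j; unfold madd, rtail, chead, transp.
assert (H0 := nb_nonneg A j i HA).
destruct (Nat.leb n i), (Nat.leb k j); rewrite !Rabs_pos_eq by lra; lra.
Qed.

Lemma gamma_transp A : nb A -> gamma (transp A) = gamma A.
Proof.
intros HA; apply Rle_antisym; [now apply gamma_transp_le|].
exact (gamma_transp_le (transp A) (nb_transp A HA)).
Qed.

(** Here [w] is a finite section of A applied to the tail of x. Its squared norm expands into the
    quadratic form of the Gram matrix; a partial Gram entry is at most the full one by
    nonnegativity, and only rows of index at least n occur. *)
Lemma opb_ctail_gram A n d : nb A -> opb (rtail n (mmul (transp A) A)) d ->
  opb (ctail n A) (sqrt d).
Proof.
intros HA Hd; assert (Hd0 := opb_ge0 _ _ Hd); split; [apply sqrt_pos|].
intros N J x y Hx Hy.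
set (x' := vtail n x).
assert (Hx' : forall i, 0 <= x' i) by (intros; unfold x', vtail; destruct Nat.leb; auto; lra).
set (w := fun i => rsum (fun j => A i j * x' j) J).
apply Rle_trans with (rsum (fun i => w i * y i) N).
{ apply Req_le, rsum_ext; intros i; unfold w; rewrite rsum_scal_l, Rmult_comm; f_equal.
  apply rsum_ext; intros j; unfold ctail, x', vtail; destruct Nat.leb; [|rewrite Rabs_R0; ring].
  now rewrite Rabs_pos_eq by (now apply nb_nonneg). }
eapply Rle_trans; [apply cauchy_schwarz_sum|].
fold (fnorm N w) (fnorm N y); rewrite <- Rmult_assoc.
apply Rmult_le_compat_r; [apply fnorm_ge0|].
unfold fnorm; rewrite <- sqrt_mult_alt by exact Hd0; apply sqrt_le_1_alt.
assert (Hww : forall i, w i ^ 2 = rsum (fun j => rsum (fun l => A i j * A i l * x' j * x' l) J) J).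
{ intros i; simpl; rewrite Rmult_1_r; unfold w at 1; rewrite <- rsum_scal_r.
  apply rsum_ext; intros j; unfold w; rewrite <- rsum_scal_l.
  apply rsum_ext; intros l; ring. }
rewrite (rsum_ext _ _ N Hww), rsum_switch.
apply Rle_trans with (rsum (fun j => rsum (fun l =>
    x j * (Rabs (rtail n (mmul (transp A) A) j l) * x' l)) J) J).
- apply rsum_le; intros j; rewrite rsum_switch; apply rsum_le; intros l.
  apply Rle_trans with (rsum (fun i => A i j * A i l) N * (x' j * x' l)).
  { rewrite <- rsum_scal_r; apply Req_le, rsum_ext; intros; ring. }
  unfold x', vtail at 1, rtail; destruct (Nat.leb n j); [|rewrite Rabs_R0; lra].
  fold x'.
  assert (rsum (fun i => A i j * A i l) N <= Rabs (mmul (transp A) A j l)).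
  { eapply Rle_trans; [|apply Rle_abs]; unfold mmul, transp.
    apply rsum_le_Series; [intros; apply Rmult_le_pos; now apply nb_nonneg|].
    apply ex_series_Rabs.
    apply (mmul_ex_series (transp A) A); auto using nb_bmat, nb_transp. }
  assert (Hp : 0 <= x j * x' l) by now apply Rmult_le_pos.
  generalize (Rmult_le_compat_r _ _ _ Hp H); lra.
- eapply Rle_trans; [apply Hd; auto|].
  apply Rmult_le_compat_l; [exact Hd0|].
  rewrite <- (fnorm_sq J x); apply Rmult_le_compat_r; [apply fnorm_ge0|].
  apply fnorm_le, vtail_le.
Qed.

(* With [Q] the projection on the coordinates [>= n], [|A Q x|^2 = <Q A^T A Q x, x>]. *)
Lemma gamma_gram A : nb A -> gamma A ^ 2 <= gamma (mmul (transp A) A).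
Proof.
intros HA; set (H := mmul (transp A) A).
assert (HH : nb H) by (apply nb_mmul; auto using nb_transp).
apply le_epsilon; intros eps He.
destruct (gamma_tails H HH eps He) as [n Hn].
assert (Hs := opb_transp _ _ (opb_ctail_gram A n _ HA Hn)).
(* The bound concerns the columns of A, hence the row tails of its transpose, whose measure of
   noncompactness is the same. *)
rewrite <- transp_rtail in Hs.
apply gamma_le_rtail in Hs; [|now apply nb_transp].
rewrite gamma_transp in Hs by exact HA.
generalize (gamma_ge0 A HA) (gamma_ge0 H HH); intros.
assert (E := sqrt_sqrt (gamma H + eps)); nra.
Qed.

Fixpoint mpow (A : Mat) (n : nat) : Mat :=
  match n with O => mone | S n => mmul (mpow A n) A end.

Lemma nb_mpow A n : nb A -> nb (mpow A n).
Proof. intros HA; induction n; simpl; auto using nb_one, nb_mmul. Qed.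

Lemma mpow_add A n k : nb A -> mpow A (n + k) = mmul (mpow A n) (mpow A k).
Proof.
intros HA; induction k; simpl.
- now rewrite Nat.add_0_r, mmul_1_r.
- rewrite Nat.add_succ_r; simpl; rewrite IHk, mmul_assoc; auto using nb_bmat, nb_mpow.
Qed.

Lemma mpow_1 A : mpow A 1 = A.
Proof. apply mmul_1_l. Qed.

Lemma mpow_S_l A n : nb A -> mpow A (S n) = mmul A (mpow A n).
Proof. intros HA; change (S n) with (1 + n)%nat; now rewrite mpow_add, mpow_1. Qed.

Lemma mpow_mul A n k : nb A -> mpow (mpow A n) k = mpow A (n * k).
Proof.
intros HA; induction k; simpl; [now rewrite Nat.mul_0_r|].
now rewrite Nat.mul_succ_r, mpow_add, IHk.
Qed.

Lemma transp_one : transp mone = mone.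
Proof.
apply mat_ext; intros i j; unfold transp, mone, basis; now rewrite Nat.eqb_sym.
Qed.

Lemma transp_mpow A n : nb A -> transp (mpow A n) = mpow (transp A) n.
Proof.
intros HA; induction n; [apply transp_one|].
rewrite mpow_S_l by auto using nb_transp; simpl; now rewrite transp_mmul, IHn.
Qed.

Lemma gamma_mpow A n : nb A -> gamma (mpow A n) <= gamma A ^ n.
Proof.
intros HA; induction n; simpl.
- apply gamma_le_opb; [apply nb_one | apply opb_one].
- eapply Rle_trans; [apply gamma_mmul; auto using nb_mpow|].
  rewrite Rmult_comm; apply Rmult_le_compat_l; auto using gamma_ge0.
Qed.

(* First for exponents [2^j], by [gamma_gram]; then [gamma H^p <= gamma (H^q) gamma H^(p-q)]
   with [p = 2^j >= q]. *)
Lemma gamma_mpow_sym H q : nb H -> transp H = H -> gamma H ^ q <= gamma (mpow H q).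
Proof.
intros HH Hs; destruct q as [|q].
(* The exponent 0 requires [gamma mone >= 1]: every row tail of the identity retains a diagonal
   entry 1. *)
{ apply le_epsilon; intros eps He.
  destruct (Rle_dec 1 (gamma mone + eps)) as [|Hn]; [simpl; lra|]; exfalso.
  destruct (gamma_tails mone nb_one eps He) as [n Hn'].
  assert (E := opb_entry _ _ n n Hn'); unfold rtail in E.
  change (mone n n) with (basis n n) in E.
  rewrite Nat.leb_refl, basis_same, Rabs_R1 in E; lra. }
assert (H2 : forall j, gamma H ^ (2 ^ j) <= gamma (mpow H (2 ^ j))).
{ induction j; simpl Nat.pow.
  - rewrite mpow_1; simpl; lra.
  - rewrite Nat.add_0_r, mpow_add, pow_add by auto.
    replace (mpow H (2 ^ j)) with (transp (mpow H (2 ^ j))) at 1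
      by now rewrite transp_mpow, Hs.
    eapply Rle_trans; [|apply gamma_gram; now apply nb_mpow].
    assert (0 <= gamma H ^ 2 ^ j) by (apply pow_le; now apply gamma_ge0).
    rewrite <- Rsqr_pow2; unfold Rsqr; apply Rmult_le_compat; auto. }
destruct (gamma_ge0 H HH) as [Hg|Hg].
2:{ rewrite <- Hg; simpl pow; rewrite Rmult_0_l; now apply gamma_ge0, nb_mpow. }
assert (Hq : (S q <= 2 ^ S q)%nat).
{ generalize (Nat.pow_gt_lin_r 2 (S q)); lia. }
specialize (H2 (S q)).
replace (2 ^ S q)%nat with (S q + (2 ^ S q - S q))%nat in H2 by lia.
rewrite pow_add, mpow_add in H2 by auto.
set (k := (2 ^ S q - S q)%nat) in *.
assert (Hk : 0 < gamma H ^ k) by now apply pow_lt.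
apply (Rmult_le_reg_r (gamma H ^ k)); [exact Hk|].
eapply Rle_trans; [exact H2|].
eapply Rle_trans; [apply gamma_mmul; now apply nb_mpow|].
apply Rmult_le_compat_l; [now apply gamma_ge0, nb_mpow | now apply gamma_mpow].
Qed.

(** * Hadamard products of powers *)

Definition had (m : nat) (a : R) (F : nat -> Mat) : Mat :=
  fun i k => prodm m (fun j => rpow (F j i k) a).

Lemma had_nonneg m a F : nonneg_mat (had m a F).
Proof. intros i k; apply prodm_ge0; intros; apply rpow_ge0. Qed.

Lemma opb_mean (F : nat -> Mat) (N : nat -> R) p :
  (forall j, (j <= p)%nat -> 0 < N j /\ opb (F j) (N j)) ->
  opb (fun i k => rsum (fun j => F j i k / N j) p) (INR (S p)).
Proof.
assert (H1 : forall j, 0 < N j -> opb (F j) (N j) -> opb (fun i k => F j i k / N j) 1).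
{ intros j Hj Ho; assert (Hi : 0 < / N j) by now apply Rinv_0_lt_compat.
  apply (opb_mono _ _ _ _ (opb_scal (/ N j) (F j) (N j) Ho)).
  - intros i k; unfold mscal, Rdiv; rewrite Rmult_comm; lra.
  - rewrite Rabs_pos_eq, Rinv_l; lra. }
induction p; intros H.
- apply (opb_mono _ (fun i k => F 0%nat i k / N 0%nat) 1); [now apply H1; apply H | | simpl; lra].
  intros; rewrite rsum_0; lra.
- apply (opb_mono _ (madd (fun i k => rsum (fun j => F j i k / N j) p)
                     (fun i k => F (S p) i k / N (S p))) (INR (S p) + 1)).
  + apply opb_add; [apply IHp; auto | apply H1; apply H; auto].
  + intros; rewrite rsum_S; unfold madd; lra.
  + rewrite (S_INR (S p)); lra.
Qed.

(* Entrywise, the Hadamard product is at most [prod N_j^a] times the mean of the [F_j / N_j]. *)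
Lemma opb_had m a F N : (1 <= m)%nat -> / INR m <= a ->
  (forall j, (j < m)%nat -> nonneg_mat (F j) /\ 0 < N j /\ opb (F j) (N j)) ->
  opb (had m a F) (prodm m (fun j => rpow (N j) a)).
Proof.
intros Hm Ha H.
set (P := prodm m (fun j => rpow (N j) a)).
assert (HP : 0 <= P) by (apply prodm_ge0; intros; apply rpow_ge0).
assert (Hp : 0 < INR m) by (apply lt_0_INR; lia).
assert (Hip : 0 < / INR m) by now apply Rinv_0_lt_compat.
assert (Hmean := opb_mean F N (m - 1) ltac:(intros j Hj; apply H; lia)).
apply (opb_scal (P * / INR m)) in Hmean.
apply (opb_mono _ _ _ _ Hmean).
- intros i k; rewrite Rabs_pos_eq by apply had_nonneg.
  eapply Rle_trans; [|apply Rle_abs]; unfold mscal; rewrite Rmult_assoc.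
  apply prodm_le_weighted_mean; auto.
  + intros j Hj; now apply H.
  + intros j Hj; destruct (H j Hj) as (H1 & H2 & H3); split; [apply H1|].
    eapply Rle_trans; [apply Rle_abs | now apply opb_entry].
- rewrite Rabs_pos_eq by nra.
  replace (S (m - 1)) with m by lia.
  rewrite Rmult_assoc, Rinv_l; lra.
Qed.

Lemma nb_had m a F : (1 <= m)%nat -> / INR m <= a ->
  (forall j, (j < m)%nat -> nb (F j)) -> nb (had m a F).
Proof.
intros Hm Ha H; split; [apply had_nonneg|].
assert (HN : exists N : nat -> R, forall j, (j < m)%nat -> 0 < N j /\ opb (F j) (N j)).
{ clear Hm Ha; induction m as [|p IH].
  - exists (fun _ => 0); intros; lia.
  - destruct IH as [N HN]; [intros; apply H; lia|].
    destruct (H p ltac:(lia)) as [_ [c Hc]].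
    (* [c + 1] instead of [c], since the normalisation divides by the bound. *)
    exists (fun j => if Nat.eqb j p then c + 1 else N j); intros j Hj.
    destruct (Nat.eqb_spec j p) as [->|].
    + generalize (opb_ge0 _ _ Hc); split; [lra|]; apply (opb_weaken _ c); auto; lra.
    + apply HN; lia. }
destruct HN as [N HN].
eexists; apply (opb_had m a F N); auto.
intros j Hj; split; [now apply H | now apply HN].
Qed.

Lemma rtail_had m a F n : (1 <= m)%nat ->
  rtail n (had m a F) = had m a (fun j => rtail n (F j)).
Proof.
intros Hm; apply mat_ext; intros i k; unfold rtail, had.
destruct Nat.leb; [reflexivity|].
symmetry; apply (prodm_zero _ _ 0); [lia | apply rpow_le0; lra].
Qed.

Lemma common_index m (P : nat -> nat -> Prop) :
  (forall j n k, P j n -> (n <= k)%nat -> P j k) ->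
  (forall j, (j < m)%nat -> exists n, P j n) -> exists n, forall j, (j < m)%nat -> P j n.
Proof.
intros Hmono; induction m as [|m IH]; intros H.
- exists 0%nat; intros; lia.
- destruct IH as [n Hn]; [auto|]; destruct (H m) as [k Hk]; [lia|].
  exists (Nat.max n k); intros j Hj; destruct (Nat.eq_dec j m) as [->|].
  + apply (Hmono _ k); auto; lia.
  + apply (Hmono _ n); [apply Hn; lia | lia].
Qed.

Lemma is_lim_seq_inv_S : is_lim_seq (fun n => / INR (S n)) 0.
Proof.
replace (Finite 0) with (Rbar_inv p_infty) by reflexivity.
apply is_lim_seq_inv; [|easy].
apply (is_lim_seq_incr_1 (fun n => INR n)), is_lim_seq_INR.
Qed.

(** A common row index serves all m factors, and truncation commutes with the Hadamard product. The
    bounds [gamma (F j) + / INR (S n)] are positive, as [opb_had] requires; continuity of [rpow]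
    removes the excess. *)
Lemma gamma_had m a F : (1 <= m)%nat -> / INR m <= a ->
  (forall j, (j < m)%nat -> nb (F j)) ->
  gamma (had m a F) <= prodm m (fun j => rpow (gamma (F j)) a).
Proof.
intros Hm Ha H.
assert (Ha0 := exponent_pos m a Hm Ha).
apply (is_lim_seq_le (fun _ => gamma (had m a F))
  (fun n => prodm m (fun j => rpow (gamma (F j) + / INR (S n)) a))
  (gamma (had m a F)) (prodm m (fun j => rpow (gamma (F j)) a))).
- intros n; assert (He : 0 < / INR (S n)) by apply Rinv_0_lt_compat, INR_S_pos.
  destruct (common_index m (fun j n0 => opb (rtail n0 (F j)) (gamma (F j) + / INR (S n))))
    as [N HN].
  + intros j k l Hk Hl; now apply (opb_rtail_anti k).
  + intros j Hj; now apply gamma_tails; [apply H|].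
  + apply (gamma_le_rtail N); [now apply nb_had|].
    rewrite rtail_had by exact Hm.
    apply opb_had; auto; intros j Hj; split; [now apply nb_rtail, H|]; split; [|auto].
    generalize (gamma_ge0 _ (H j Hj)); lra.
- apply is_lim_seq_const.
- apply is_lim_seq_prodm; intros j Hj; apply is_lim_seq_rpow; [exact Ha0|].
  replace (gamma (F j)) with (gamma (F j) + 0) at 1 by ring.
  apply is_lim_seq_plus'; [apply is_lim_seq_const | apply is_lim_seq_inv_S].
Qed.

(** Each entry is a sum over the middle index of a product of powers, so this is
    [Series_prodm_le]. *)
Lemma mmul_had_le m a F G : (1 <= m)%nat -> / INR m <= a ->
  (forall j, (j < m)%nat -> nb (F j)) -> (forall j, (j < m)%nat -> nb (G j)) ->
  forall i k, mmul (had m a F) (had m a G) i k <= had m a (fun j => mmul (F j) (G j)) i k.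
Proof.
intros Hm Ha HF HG i k; unfold mmul at 1, had.
rewrite (Series_ext _ (fun l => prodm m (fun j => rpow (F j i l * G j l k) a))).
- apply (Series_prodm_le m (fun j l => F j i l * G j l k) a); auto.
  intros j Hj; split.
  + intros l; apply Rmult_le_pos; apply nb_nonneg; auto.
  + apply ex_series_Rabs, mmul_ex_series; apply nb_bmat; auto.
- intros l; rewrite <- prodm_mult; apply prodm_ext; intros j Hj.
  symmetry; apply rpow_mult; apply nb_nonneg; auto.
Qed.

(** * Sets of matrices and their joint essential radius *)

(** The bound M excludes the value [p_infty], which [real] would turn into 0. *)
Lemma Rsup_ge (E : R -> Prop) M t : (forall s, E s -> s <= M) -> E t -> t <= Rsup E.
Proof.
intros HM Ht; unfold Rsup; destruct (Lub_Rbar_correct E) as [Hub Hl].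
assert (H1 := Hub t Ht).
assert (H2 : Rbar_le (Lub_Rbar E) M) by (apply Hl; intros s Hs; now apply HM).
destruct (Lub_Rbar E); easy.
Qed.

(** The condition 0 <= c takes care of the empty set, on which [Rsup] is 0. *)
Lemma Rsup_le (E : R -> Prop) c : 0 <= c -> (forall t, E t -> t <= c) -> Rsup E <= c.
Proof.
intros Hc H; unfold Rsup; destruct (Lub_Rbar_correct E) as [Hub Hl].
assert (H2 : Rbar_le (Lub_Rbar E) c) by (apply Hl; intros s Hs; now apply H).
destruct (Lub_Rbar E); easy.
Qed.

Lemma Rsup_ge0 (E : R -> Prop) : (forall t, E t -> 0 <= t) -> 0 <= Rsup E.
Proof.
intros H; unfold Rsup; destruct (Lub_Rbar_correct E) as [Hub Hl].
destruct (classic (exists t, E t)) as [[t Ht]|Hn].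
- assert (H1 := Hub t Ht); assert (H2 := H t Ht).
  destruct (Lub_Rbar E); simpl in *; lra.
- assert (H2 : Rbar_le (Lub_Rbar E) m_infty) by (apply Hl; intros s Hs; exfalso; eauto).
  destruct (Lub_Rbar E); simpl in *; easy || lra.
Qed.

Lemma set_ext (S T : matset) : (forall A, S A <-> T A) -> S = T.
Proof.
intros H; apply functional_extensionality; intros A; apply propositional_extensionality, H.
Qed.

Definition bset (S : matset) : Prop := exists c, 0 <= c /\ forall A, S A -> nonneg_mat A /\ opb A c.
Definition sing (A : Mat) : matset := fun B => B = A.

Lemma bset_nb S A : bset S -> S A -> nb A.
Proof. intros [c [Hc H]] HA; destruct (H A HA); split; [auto | now exists c]. Qed.

Lemma bset_sing A : nb A -> bset (sing A).
Proof.
intros [HA [c Hc]]; exists c; split; [now apply opb_ge0 in Hc|]; intros B ->; auto.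
Qed.

Lemma bset_prodset P Q : bset P -> bset Q -> bset (prodset P Q).
Proof.
intros HP HQ; assert (HP' := HP); assert (HQ' := HQ).
destruct HP as [a [Ha HP]], HQ as [b [Hb HQ]].
exists (a * b); split; [nra|]; intros C (A & B & HA & HB & ->); split.
- apply (nb_mmul A B); [now apply (bset_nb P) | now apply (bset_nb Q)].
- apply opb_mmul; [now apply HP | now apply HQ].
Qed.

Lemma bset_adjset S : bset S -> bset (adjset S).
Proof.
intros [c [Hc H]]; exists c; split; [exact Hc|]; intros B (A & HA & ->).
destruct (H A HA) as [H1 H2]; split; [intros i j; apply H1 | now apply opb_transp].
Qed.

Lemma bset_mchain f n : (forall t, (t <= n)%nat -> bset (f t)) -> bset (mchain f n).
Proof. induction n; intros H; simpl; auto using bset_prodset. Qed.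

Lemma bset_spow S n : bset S -> bset (spow S n).
Proof. intros; apply bset_mchain; auto. Qed.

Lemma mchain_ext f g n : (forall t, (t <= n)%nat -> f t = g t) -> mchain f n = mchain g n.
Proof. induction n; intros H; simpl; [apply H; auto | rewrite IHn, (H (S n)); auto]. Qed.

Lemma prodset_assoc P Q T : bset P -> bset Q -> bset T ->
  prodset (prodset P Q) T = prodset P (prodset Q T).
Proof.
intros HP HQ HT; apply set_ext; intros X; split.
- intros (Y & D & (A & B & HA & HB & ->) & HD & ->).
  exists A, (mmul B D); repeat split; auto; [now exists B, D|].
  rewrite mmul_assoc; eauto using nb_bmat, bset_nb.
- intros (A & Y & HA & (B & D & HB & HD & ->) & ->).
  exists (mmul A B), D; repeat split; auto; [now exists A, B|].
  rewrite mmul_assoc; eauto using nb_bmat, bset_nb.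
Qed.

Lemma adjset_prodset P Q : adjset (prodset P Q) = prodset (adjset Q) (adjset P).
Proof.
apply set_ext; intros X; split.
- intros (Y & (A & B & HA & HB & ->) & ->).
  exists (transp B), (transp A); repeat split; [now exists B | now exists A | apply transp_mmul].
- intros (A' & B' & (A & HA & ->) & (B & HB & ->) & ->).
  exists (mmul B A); split; [now exists B, A | symmetry; apply transp_mmul].
Qed.

Lemma mchain_left f n : (forall t, (t <= S n)%nat -> bset (f t)) ->
  mchain f (S n) = prodset (f O) (mchain (fun t => f (S t)) n).
Proof.
induction n; intros H; [reflexivity|].
change (mchain f (S (S n))) with (prodset (mchain f (S n)) (f (S (S n)))).
rewrite IHn by auto.
apply prodset_assoc; auto with arith; apply bset_mchain; intros; apply H; lia.
Qed.

Lemma mchain_adjset f n : (forall t, (t <= n)%nat -> bset (f t)) ->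
  adjset (mchain f n) = mchain (fun t => adjset (f (n - t)%nat)) n.
Proof.
induction n; intros H; [reflexivity|].
rewrite (mchain_left (fun t => adjset (f (S n - t)%nat)))
  by (intros; apply bset_adjset, H; lia).
simpl Nat.sub; rewrite <- IHn by auto; apply adjset_prodset.
Qed.

Lemma mchain_add f n k : (forall t, (t <= S (n + k))%nat -> bset (f t)) ->
  mchain f (S (n + k)) = prodset (mchain f n) (mchain (fun t => f (S (n + t))) k).
Proof.
induction k; intros H.
- simpl; now rewrite !Nat.add_0_r.
- rewrite Nat.add_succ_r.
  change (mchain f (S (S (n + k)))) with (prodset (mchain f (S (n + k))) (f (S (S (n + k))))).
  change (mchain (fun t => f (S (n + t))) (S k))
    with (prodset (mchain (fun t => f (S (n + t))) k) (f (S (n + S k)))).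
  rewrite IHk by (intros; apply H; lia); rewrite (Nat.add_succ_r n k).
  apply prodset_assoc; [apply bset_mchain | apply bset_mchain |]; intros; apply H; lia.
Qed.

Lemma spow_add S n k : bset S -> spow S (Datatypes.S (n + k)) = prodset (spow S n) (spow S k).
Proof. intros H; apply mchain_add; auto. Qed.

Lemma spow_adjset S n : bset S -> spow (adjset S) n = adjset (spow S n).
Proof. intros H; symmetry; apply mchain_adjset; auto. Qed.

Lemma prodset_sing A B : prodset (sing A) (sing B) = sing (mmul A B).
Proof.
apply set_ext; intros X; split; [now intros (? & ? & -> & -> & ->)|].
intros ->; now exists A, B.
Qed.

Lemma spow_sing A n : spow (sing A) n = sing (mpow A (S n)).
Proof.
induction n; [now rewrite mpow_1|].
change (spow (sing A) (S n)) with (prodset (spow (sing A) n) (sing A)).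
now rewrite IHn, prodset_sing.
Qed.

Lemma adjset_sing A : adjset (sing A) = sing (transp A).
Proof. apply set_ext; intros X; split; [now intros (? & -> & ->) | intros ->; now exists A]. Qed.

Fixpoint mprod (X : nat -> Mat) (n : nat) : Mat :=
  match n with O => X O | S n' => mmul (mprod X n') (X n) end.

Lemma mprod_ext X Y n : (forall t, (t <= n)%nat -> X t = Y t) -> mprod X n = mprod Y n.
Proof. induction n; intros H; simpl; [apply H; auto | rewrite IHn, (H (S n)); auto]. Qed.

(** Membership in a product of sets becomes a choice of one matrix per letter, the form in which
    words are compared entry by entry. *)
Lemma mchain_mprod f n A :
  mchain f n A <-> exists X, (forall t, (t <= n)%nat -> f t (X t)) /\ A = mprod X n.
Proof.
revert A; induction n as [|n IH]; intros A.
- split.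
  + intros H; exists (fun _ => A); split; [|reflexivity].
    intros t Ht; now replace t with 0%nat by lia.
  + intros (X & H & ->); simpl; auto.
- split.
  + intros (B & D & HB & HD & ->); apply IH in HB; destruct HB as (X & HX & ->).
    exists (fun t => if Nat.leb t n then X t else D); split.
    * intros t Ht; destruct (Nat.leb_spec t n); [auto|]; now replace t with (S n) by lia.
    * change (mmul (mprod X n) D = mmul (mprod (fun t => if Nat.leb t n then X t else D) n)
        (if Nat.leb (S n) n then X (S n) else D)).
      rewrite (proj2 (Nat.leb_gt (S n) n)) by lia; f_equal.
      apply mprod_ext; intros t Ht; now rewrite (proj2 (Nat.leb_le t n)).
  + intros (X & HX & ->); exists (mprod X n), (X (S n)); repeat split; auto.
    apply IH; now exists X; auto.
Qed.

Lemma nb_mprod X n : (forall t, (t <= n)%nat -> nb (X t)) -> nb (mprod X n).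
Proof. induction n; intros H; simpl; auto using nb_mmul. Qed.

Lemma mprod_had_le m a (F : nat -> nat -> Mat) n : (1 <= m)%nat -> / INR m <= a ->
  (forall j t, (j < m)%nat -> (t <= n)%nat -> nb (F j t)) ->
  forall i k, mprod (fun t => had m a (fun j => F j t)) n i k
              <= had m a (fun j => mprod (F j) n) i k.
Proof.
intros Hm Ha; induction n; intros H i k; simpl; [lra|].
assert (N1 : forall j, (j < m)%nat -> nb (mprod (F j) n)) by (intros; apply nb_mprod; auto).
assert (N2 : forall t, (t <= S n)%nat -> nb (had m a (fun j => F j t)))
  by (intros; apply nb_had; auto).
eapply Rle_trans; [|apply mmul_had_le; auto].
apply mmul_le; auto using nb_bmat, nb_had, had_nonneg.
- apply nb_mprod; auto.
- intros; lra.
Qed.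

Lemma finite_choice m (P : nat -> R -> Prop) :
  (forall j, (j < m)%nat -> exists c, P j c) ->
  exists N : nat -> R, forall j, (j < m)%nat -> P j (N j).
Proof.
induction m as [|m IH]; intros H.
- exists (fun _ => 0); intros; lia.
- destruct IH as [N HN]; [auto|]; destruct (H m) as [c Hc]; [lia|].
  exists (fun j => if Nat.eqb j m then c else N j); intros j Hj.
  destruct (Nat.eqb_spec j m) as [->|]; [exact Hc | apply HN; lia].
Qed.

(** [prodm] repeats the [fold_right] expression of [hadset], so conversion suffices. *)
Lemma hadset_iff f m a A :
  hadset f m a A <-> exists F, (forall j, (j < m)%nat -> f j (F j)) /\ A = had m a F.
Proof. reflexivity. Qed.

Lemma bset_hadset f m a : (1 <= m)%nat -> / INR m <= a ->
  (forall j, (j < m)%nat -> bset (f j)) -> bset (hadset f m a).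
Proof.
intros Hm Ha H.
destruct (finite_choice m (fun j c => 0 < c /\ forall A, f j A -> nonneg_mat A /\ opb A c))
  as [N HN].
{ intros j Hj; destruct (H j Hj) as [c [Hc Hf]]; exists (c + 1); split; [lra|].
  intros A HA; destruct (Hf A HA); split; [auto|]; apply (opb_weaken _ c); auto; lra. }
exists (prodm m (fun j => rpow (N j) a)); split.
{ apply prodm_ge0; intros; apply rpow_ge0. }
intros A HA; destruct (proj1 (hadset_iff _ _ _ _) HA) as (F & HF & ->).
split; [apply had_nonneg|]; apply opb_had; auto.
intros j Hj; destruct (HN j Hj) as [H1 H2]; destruct (H2 (F j) (HF j Hj)); auto.
Qed.

Lemma gamma_set_ge0 S : bset S -> 0 <= gamma_set S.
Proof.
intros HS; apply Rsup_ge0; intros t (A & HA & ->); eapply gamma_ge0, bset_nb; eauto.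
Qed.

Lemma gamma_le_set S A : bset S -> S A -> gamma A <= gamma_set S.
Proof.
intros [c [Hc H]] HA; apply (Rsup_ge _ c).
- intros t (B & HB & ->); apply gamma_le_opb; now apply H.
- now exists A.
Qed.

Lemma gamma_set_le S c : 0 <= c -> (forall A, S A -> gamma A <= c) -> gamma_set S <= c.
Proof. intros Hc H; apply Rsup_le; auto; intros t (A & HA & ->); auto. Qed.

Lemma gamma_set_prodset P Q : bset P -> bset Q ->
  gamma_set (prodset P Q) <= gamma_set P * gamma_set Q.
Proof.
intros HP HQ; apply gamma_set_le.
- apply Rmult_le_pos; now apply gamma_set_ge0.
- intros C (A & B & HA & HB & ->).
  eapply Rle_trans; [apply gamma_mmul; eauto using bset_nb|].
  apply Rmult_le_compat; eauto using gamma_ge0, bset_nb, gamma_le_set.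
Qed.

Lemma gamma_set_adjset S : bset S -> gamma_set (adjset S) = gamma_set S.
Proof.
intros HS; apply Rle_antisym; apply gamma_set_le; try (apply gamma_set_ge0; auto using bset_adjset).
- intros X (A & HA & ->); rewrite gamma_transp by eauto using bset_nb; now apply gamma_le_set.
- intros A HA; rewrite <- gamma_transp by eauto using bset_nb.
  apply gamma_le_set; [now apply bset_adjset | now exists A].
Qed.

Lemma gamma_set_sing A : nb A -> gamma_set (sing A) = gamma A.
Proof.
intros HA; apply Rle_antisym.
- apply gamma_set_le; [now apply gamma_ge0 | intros B ->; lra].
- apply gamma_le_set; [now apply bset_sing | reflexivity].
Qed.

(* Fekete's argument, stated for an upper-closed submultiplicative predicate so that it
   applies both to sequences of numbers and to operator bounds. *)
Lemma geometric_bound (Q : nat -> R -> Prop) p b :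
  (forall n c d, Q n c -> c <= d -> Q n d) ->
  (forall n k c d, 0 <= c -> 0 <= d -> Q n c -> Q k d -> Q (S (n + k)) (c * d)) ->
  (forall n, exists c, Q n c) -> 0 < b -> Q p (b ^ S p) ->
  exists C, 1 <= C /\ forall n, Q n (C * b ^ S n).
Proof.
intros Hup Hmul Hex Hb Hp.
assert (H0 : forall N, exists C, 1 <= C /\ forall n, (n <= N)%nat -> Q n (C * b ^ S n)).
{ assert (H1 : forall n, exists C, 1 <= C /\ Q n (C * b ^ S n)).
  { intros n; destruct (Hex n) as [c Hc].
    assert (Hbn : 0 < b ^ S n) by now apply pow_lt.
    exists (Rmax 1 (c / b ^ S n)); split; [apply Rmax_l|].
    apply (Hup n c); [exact Hc|].
    apply Rle_trans with (c / b ^ S n * b ^ S n); [apply Req_le; field; lra|].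
    apply Rmult_le_compat_r; [lra | apply Rmax_r]. }
  induction N as [|N [C [HC IH]]].
  - destruct (H1 0%nat) as [C [HC HQ]]; exists C; split; [exact HC|].
    intros n Hn; now replace n with 0%nat by lia.
  - destruct (H1 (S N)) as [C' [HC' HQ]]; exists (C * C'); split; [nra|].
    intros n Hn; assert (Hbn : 0 < b ^ S n) by now apply pow_lt.
    destruct (Nat.eq_dec n (S N)) as [->|].
    + apply (Hup _ _ _ HQ); apply Rmult_le_compat_r; nra.
    + apply (Hup _ (C * b ^ S n)); [apply IH; lia|]; apply Rmult_le_compat_r; nra. }
destruct (H0 p) as [C [HC H]]; exists C; split; [exact HC|].
(* Index n stands for n + 1 factors. A block of p + 1 of them is split off and contributes exactly
   b^(p+1), so the constant C does not grow. *)
intros n; induction n as [n IH] using (well_founded_induction lt_wf).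
destruct (le_lt_dec n p) as [Hn|Hn]; [auto|].
replace n with (S (p + (n - p - 1))) by lia.
set (k := (n - p - 1)%nat).
replace (C * b ^ S (S (p + k))) with (b ^ S p * (C * b ^ S k)).
- apply Hmul; auto.
  + apply pow_le; lra.
  + apply Rmult_le_pos; [lra | apply pow_le; lra].
  + apply IH; unfold k; lia.
- replace (S (S (p + k))) with (S p + S k)%nat by lia; rewrite pow_add; ring.
Qed.

Lemma is_lim_seq_root C : 1 <= C -> is_lim_seq (fun n => rpow C (/ INR (S n))) 1.
Proof.
intros HC; apply (is_lim_seq_ext (fun n => exp (/ INR (S n) * ln C))).
{ intros n; now rewrite rpow_gt0 by lra. }
replace 1 with (exp (0 * ln C)) by (rewrite Rmult_0_l; apply exp_0).
apply (is_lim_seq_continuous (fun x => exp (x * ln C)) _ 0); [|apply is_lim_seq_inv_S].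
apply (continuity_pt_comp (fun x => x * ln C) exp).
- apply derivable_continuous_pt; exists (1 * ln C + 0 * 0).
  apply (derivable_pt_lim_mult id (fun _ => ln C) 0 1 0);
    [apply derivable_pt_lim_id | apply derivable_pt_lim_const].
- apply derivable_continuous_pt, derivable_pt_exp.
Qed.

(** The index n stands for the exponent n + 1, whence the successor in the submultiplicativity
    hypothesis. The limit is the infimum of the roots: a root close to it gives a n <= C b^(n+1),
    and the roots of C tend to 1. *)
Lemma fekete (a : nat -> R) : (forall n, 0 <= a n) ->
  (forall n k, a (S (n + k)) <= a n * a k) ->
  exists L, 0 <= L /\ is_lim_seq (fun n => rpow (a n) (/ INR (S n))) L /\
    forall n, L <= rpow (a n) (/ INR (S n)).
Proof.
intros Ha Hmul.
set (u := fun n => rpow (a n) (/ INR (S n))).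
destruct (Glb_Rbar_real (fun t => exists n, t = u n) (u 0%nat)) as (G1 & G2 & G3).
{ now exists 0%nat. }
{ intros d [n ->]; apply rpow_ge0. }
set (L := real (Glb_Rbar (fun t => exists n, t = u n))) in *.
exists L; split; [exact G1|]; split; [|intros n; apply G2; now exists n].
apply is_lim_seq_spec; intros eps.
assert (He := cond_pos eps).
destruct (G3 (eps / 2)) as (d & [p ->] & Hp); [lra|].
set (b := L + eps / 2) in *.
assert (Hb : 0 < b) by (unfold b; lra).
destruct (geometric_bound (fun n c => a n <= c) p b) as (C & HC & HQ); auto.
- intros; lra.
- intros n k c e Hc He' H1 H2; eapply Rle_trans; [apply Hmul|]; now apply Rmult_le_compat.
- intros n; exists (a n); lra.
- rewrite <- (root_pow (a p) p) by auto; apply pow_incr; split; [apply rpow_ge0|].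
  fold (u p); lra.
- assert (Hl : is_lim_seq (fun n => rpow C (/ INR (S n)) * b) (1 * b))
    by (apply is_lim_seq_mult'; [now apply is_lim_seq_root | apply is_lim_seq_const]).
  apply is_lim_seq_spec in Hl; destruct (Hl (mkposreal (eps / 2) ltac:(lra))) as [N HN].
  exists N; intros n Hn; specialize (HN n Hn); simpl pos in HN.
  apply Rabs_def2 in HN; destruct HN as [HN _].
  assert (Hu : u n <= rpow C (/ INR (S n)) * b).
  { apply rpow_root_le.
    - apply Rmult_le_pos; [apply rpow_ge0 | lra].
    - rewrite Rpow_mult_distr, root_pow by lra; apply HQ. }
  assert (L <= u n) by (apply G2; now exists n).
  apply Rabs_def1; unfold b in *; lra.
Qed.

(** The sequence converges, so that [Lim_seq] in [rho_hat_set] is a true limit, and it is a lower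
    bound for every term. *)
Lemma rho_hat_fekete S : bset S ->
  0 <= rho_hat_set S /\
  is_lim_seq (fun n => rpow (gamma_set (spow S n)) (/ INR (Datatypes.S n))) (rho_hat_set S) /\
  forall n, rho_hat_set S <= rpow (gamma_set (spow S n)) (/ INR (Datatypes.S n)).
Proof.
intros HS.
destruct (fekete (fun n => gamma_set (spow S n))) as (L & H1 & H2 & H3).
- intros; now apply gamma_set_ge0, bset_spow.
- intros; rewrite spow_add by auto; apply gamma_set_prodset; now apply bset_spow.
- unfold rho_hat_set; rewrite (is_lim_seq_unique _ _ H2); auto.
Qed.

Lemma rho_hat_ge0 S : bset S -> 0 <= rho_hat_set S.
Proof. intros HS; now apply rho_hat_fekete. Qed.

Lemma rho_hat_pow_le S n : bset S -> rho_hat_set S ^ Datatypes.S n <= gamma_set (spow S n).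
Proof.
intros HS; destruct (rho_hat_fekete S HS) as (H1 & H2 & H3).
rewrite <- (root_pow (gamma_set (spow S n)) n) by now apply gamma_set_ge0, bset_spow.
apply pow_incr; auto.
Qed.

Lemma rho_hat_exists S b : bset S -> rho_hat_set S < b ->
  exists N, forall n, (N <= n)%nat -> gamma_set (spow S n) < b ^ Datatypes.S n.
Proof.
intros HS Hb; destruct (rho_hat_fekete S HS) as (H1 & H2 & H3).
apply is_lim_seq_spec in H2; destruct (H2 (mkposreal (b - rho_hat_set S) ltac:(lra))) as [N HN].
exists N; intros n Hn; specialize (HN n Hn); simpl pos in HN.
apply Rabs_def2 in HN; destruct HN as [HN _].
rewrite <- (root_pow (gamma_set (spow S n)) n) by now apply gamma_set_ge0, bset_spow.
set (u := rpow _ _) in *; assert (Hu : 0 <= u) by apply rpow_ge0.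
assert (Hub : u < b) by lra; clearbody u; clear - Hu Hub.
induction n; [simpl; lra|].
change (u * u ^ S n < b * b ^ S n).
apply Rmult_le_0_lt_compat; auto; apply pow_le; auto.
Qed.

Lemma pow_growth x b K N : 0 < b -> (forall n, (N <= n)%nat -> x ^ n <= K * b ^ n) -> x <= b.
Proof.
intros Hb H; apply Rnot_lt_le; intros Hlt.
assert (Hr : 1 < x / b).
{ apply (Rmult_lt_reg_r b); [exact Hb|]; unfold Rdiv; rewrite Rmult_assoc, Rinv_l; lra. }
destruct (Pow_x_infinity (x / b)) with (b := K + 1) as [M HM].
{ rewrite Rabs_pos_eq; lra. }
specialize (HM (Nat.max N M) ltac:(lia)); specialize (H (Nat.max N M) ltac:(lia)).
assert (Hbn : 0 < b ^ Nat.max N M) by now apply pow_lt.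
rewrite Rabs_pos_eq in HM by (apply pow_le; lra).
assert ((x / b) ^ Nat.max N M <= K); [|lra].
unfold Rdiv; rewrite Rpow_mult_distr, pow_inv.
apply (Rmult_le_reg_r (b ^ Nat.max N M)); [exact Hbn|].
rewrite Rmult_assoc, Rinv_l; lra.
Qed.

(** A constant factor and a shift of the exponent by one both disappear when roots are taken. This
    is the loss that occurs when a word is rotated in [rho_hat_swap]. *)
Lemma rho_hat_le_shift S T K : bset S -> bset T -> 0 <= K ->
  (forall n, gamma_set (spow S (Datatypes.S n)) <= K * gamma_set (spow T n)) ->
  rho_hat_set S <= rho_hat_set T.
Proof.
intros HS HT HK H; apply le_epsilon; intros eps He.
assert (HT0 := rho_hat_ge0 T HT).
set (b := rho_hat_set T + eps).
assert (Hb : 0 < b) by (unfold b; lra).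
destruct (rho_hat_exists T b HT) as [N HN]; [unfold b; lra|].
(* The left word has n + 2 factors and the right one n + 1; the missing power of b is absorbed into
   K / b. *)
apply (pow_growth _ b (K / b) (Datatypes.S (Datatypes.S N)) Hb).
intros [|[|n]] Hn; try lia.
eapply Rle_trans; [apply (rho_hat_pow_le S _ HS)|].
eapply Rle_trans; [apply H|].
replace (K / b * b ^ Datatypes.S (Datatypes.S n)) with (K * b ^ Datatypes.S n)
  by (simpl; field; lra).
apply Rmult_le_compat_l; [exact HK|]; left; apply HN; lia.
Qed.

Lemma rho_hat_le_of_gamma S T : bset S -> bset T ->
  (forall n, gamma_set (spow S n) <= gamma_set (spow T n)) -> rho_hat_set S <= rho_hat_set T.
Proof.
intros HS HT H; destruct (rho_hat_fekete S HS) as (_ & HS2 & _), (rho_hat_fekete T HT) as (_ & HT2 & _).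
apply (is_lim_seq_le _ _ (rho_hat_set S) (rho_hat_set T)) with (2 := HS2) (3 := HT2).
intros n; apply rpow_le; auto; left; apply Rinv_0_lt_compat, INR_S_pos.
Qed.

(* Moving the leading factor of a word in [P Q P Q ... P Q] to the end. *)
Lemma spow_prodset_rotate P Q n D : bset P -> bset Q -> spow (prodset P Q) n D ->
  exists A Y, P A /\ nb Y /\ D = mmul A Y /\
    (forall A', P A' -> spow (prodset Q P) n (mmul Y A')).
Proof.
intros HP HQ; revert D; induction n as [|n IH]; intros D.
- intros (A & B & HA & HB & ->); exists A, B; split; [exact HA|]; split; [eauto using bset_nb|].
  split; [reflexivity|]. intros A' HA'; now exists B, A'.
- intros (D' & E & HD & (A' & B & HA' & HB & ->) & ->).
  destruct (IH D' HD) as (A & Y & HA & HY & -> & Hrot).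
  assert (nb A) by eauto using bset_nb.
  assert (nb A') by eauto using bset_nb.
  assert (nb B) by eauto using bset_nb.
  exists A, (mmul Y (mmul A' B)); split; [exact HA|]; split; [auto using nb_mmul|]; split.
  + rewrite <- mmul_assoc; auto using nb_bmat, nb_mmul.
  + intros A'' HA''; assert (nb A'') by eauto using bset_nb.
    exists (mmul Y A'), (mmul B A''); split; [exact (Hrot A' HA')|]; split;
      [change (prodset Q P (mmul B A'')); now exists B, A''|].
    rewrite !mmul_assoc; auto using nb_bmat, nb_mmul.
Qed.

(** A word of n + 2 pairs P Q is one factor from P, a word of n + 1 pairs Q P, and one factor from
    Q. The two outer factors cost at most a constant. *)
Lemma rho_hat_swap P Q : bset P -> bset Q -> rho_hat_set (prodset P Q) <= rho_hat_set (prodset Q P).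
Proof.
intros HP HQ.
assert (HP0 := gamma_set_ge0 P HP); assert (HQ0 := gamma_set_ge0 Q HQ).
apply (rho_hat_le_shift _ _ (gamma_set P * gamma_set Q)); auto using bset_prodset.
{ nra. }
intros n.
assert (HG := gamma_set_ge0 _ (bset_spow _ n (bset_prodset Q P HQ HP))).
apply gamma_set_le; [apply Rmult_le_pos; nra|].
intros D (D' & E & HD & (A' & B & HA' & HB & ->) & ->).
destruct (spow_prodset_rotate P Q n D' HP HQ HD) as (A & Y & HA & HY & -> & Hrot).
assert (nb A) by eauto using bset_nb.
assert (nb A') by eauto using bset_nb.
assert (nb B) by eauto using bset_nb.
replace (mmul (mmul A Y) (mmul A' B)) with (mmul A (mmul (mmul Y A') B))
  by (rewrite !mmul_assoc; auto using nb_bmat, nb_mmul).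
eapply Rle_trans; [apply gamma_mmul; auto using nb_mmul|].
rewrite Rmult_assoc, (Rmult_comm (gamma_set Q)).
apply Rmult_le_compat; [now apply gamma_ge0 | auto using gamma_ge0, nb_mmul | now apply gamma_le_set |].
eapply Rle_trans; [apply gamma_mmul; auto using nb_mmul|].
apply Rmult_le_compat; auto using gamma_ge0, nb_mmul, gamma_le_set.
apply gamma_le_set; auto; apply bset_spow; now apply bset_prodset.
Qed.

Lemma rho_hat_adjset S : bset S -> rho_hat_set (adjset S) = rho_hat_set S.
Proof.
intros HS; unfold rho_hat_set; f_equal; apply Lim_seq_ext; intros n.
rewrite spow_adjset, gamma_set_adjset; auto using bset_spow.
Qed.

(** Only domination can be had, since a product of Hadamard products is in general not a Hadamard
    product of the corresponding products. *)
Lemma spow_hadset_le f m a n D : (1 <= m)%nat -> / INR m <= a ->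
  (forall j, (j < m)%nat -> bset (f j)) -> spow (hadset f m a) n D ->
  exists E, (forall j, (j < m)%nat -> spow (f j) n (E j)) /\ forall i k, D i k <= had m a E i k.
Proof.
intros Hm Ha Hf; revert D; induction n as [|n IH]; intros D HD.
- destruct (proj1 (hadset_iff _ _ _ _) HD) as (F & HF & ->); exists F; split; [exact HF | intros; apply Rle_refl].
- destruct HD as (D' & H & HD' & HH & ->).
  destruct (proj1 (hadset_iff _ _ _ _) HH) as (F & HF & ->).
  assert (ND' : nb D').
  { eapply bset_nb; [|exact HD']; apply bset_spow; now apply bset_hadset. }
  destruct (IH D' HD') as (E & HE & HDE).
  assert (NF : forall j, (j < m)%nat -> nb (F j)) by eauto using bset_nb.
  assert (NE : forall j, (j < m)%nat -> nb (E j)).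
  { intros j Hj; eapply bset_nb; [|apply HE, Hj]; now apply bset_spow, Hf. }
  exists (fun j => mmul (E j) (F j)); split.
  + intros j Hj; exists (E j), (F j); split; [exact (HE j Hj)|]; split; [exact (HF j Hj) | reflexivity].
  + intros i k; eapply Rle_trans; [|apply mmul_had_le; auto].
    apply mmul_le; auto using nb_bmat, nb_had, had_nonneg; [apply ND' | intros; apply Rle_refl].
Qed.

Lemma gamma_set_spow_hadset f m a n : (1 <= m)%nat -> / INR m <= a ->
  (forall j, (j < m)%nat -> bset (f j)) ->
  gamma_set (spow (hadset f m a) n) <= prodm m (fun j => rpow (gamma_set (spow (f j) n)) a).
Proof.
intros Hm Ha Hf; assert (Ha0 := exponent_pos m a Hm Ha).
apply gamma_set_le; [apply prodm_ge0; intros; apply rpow_ge0|].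
intros D HD; destruct (spow_hadset_le f m a n D) as (E & HE & HDE); auto.
assert (NE : forall j, (j < m)%nat -> nb (E j)).
{ intros j Hj; eapply bset_nb; [|apply HE, Hj]; now apply bset_spow, Hf. }
eapply Rle_trans; [apply (gamma_mono D (had m a E)); auto using nb_had|].
{ eapply bset_nb; [|exact HD]; apply bset_spow; now apply bset_hadset. }
eapply Rle_trans; [apply gamma_had; auto|].
apply prodm_le; intros j Hj; split; [apply rpow_ge0|].
apply rpow_le; [lra|]; apply gamma_le_set; auto using bset_spow.
Qed.

Lemma rho_hat_hadset f m a : (1 <= m)%nat -> / INR m <= a ->
  (forall j, (j < m)%nat -> bset (f j)) ->
  rho_hat_set (hadset f m a) <= prodm m (fun j => rpow (rho_hat_set (f j)) a).
Proof.
intros Hm Ha Hf; assert (Ha0 := exponent_pos m a Hm Ha).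
destruct (rho_hat_fekete _ (bset_hadset f m a Hm Ha Hf)) as (_ & H2 & _).
apply (is_lim_seq_le _ (fun n => prodm m (fun j =>
    rpow (rpow (gamma_set (spow (f j) n)) (/ INR (S n))) a)) (rho_hat_set (hadset f m a))
  (prodm m (fun j => rpow (rho_hat_set (f j)) a))) with (2 := H2).
- intros n; eapply Rle_trans.
  + apply rpow_le; [left; apply Rinv_0_lt_compat, INR_S_pos|].
    apply gamma_set_spow_hadset; auto.
  + rewrite prodm_rpow by (intros; apply rpow_ge0).
    apply Req_le, prodm_ext; intros j Hj; rewrite !rpow_rpow; f_equal; ring.
- apply is_lim_seq_prodm; intros j Hj; apply is_lim_seq_rpow; [exact Ha0|].
  now apply rho_hat_fekete, Hf.
Qed.

(* The Gelfand-type limit of [gamma (A^n)^(1/n)]; [rho_ess_eq] below identifies it with the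
   spectral quantity [rho_ess A]. *)
Definition ess (A : Mat) : R := rho_hat_set (sing A).

Lemma ess_ge0 A : nb A -> 0 <= ess A.
Proof. intros; now apply rho_hat_ge0, bset_sing. Qed.

Lemma ess_pow_le A n : nb A -> ess A ^ S n <= gamma (mpow A (S n)).
Proof.
intros HA; eapply Rle_trans; [apply (rho_hat_pow_le (sing A) n); now apply bset_sing|].
rewrite spow_sing, gamma_set_sing by (now apply nb_mpow); apply Rle_refl.
Qed.

Lemma ess_le_gamma A : nb A -> ess A <= gamma A.
Proof.
intros HA; generalize (ess_pow_le A 0 HA); rewrite mpow_1; simpl; lra.
Qed.

Lemma ess_exists A b : nb A -> ess A < b ->
  exists N, forall n, (N <= n)%nat -> gamma (mpow A (S n)) < b ^ S n.
Proof.
intros HA Hb; destruct (rho_hat_exists (sing A) b (bset_sing A HA) Hb) as [N HN].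
exists N; intros n Hn; generalize (HN n Hn).
now rewrite spow_sing, gamma_set_sing by now apply nb_mpow.
Qed.

Lemma ess_swap A B : nb A -> nb B -> ess (mmul A B) = ess (mmul B A).
Proof.
intros HA HB; unfold ess; rewrite <- !prodset_sing.
apply Rle_antisym; apply rho_hat_swap; now apply bset_sing.
Qed.

Lemma ess_transp A : nb A -> ess (transp A) = ess A.
Proof. intros HA; unfold ess; rewrite <- adjset_sing; now apply rho_hat_adjset, bset_sing. Qed.

Lemma mpow_le A B n : nb A -> nb B -> (forall i j, A i j <= B i j) ->
  forall i j, mpow A n i j <= mpow B n i j.
Proof.
intros HA HB H; induction n; intros i j; simpl; [lra|].
apply mmul_le; auto using nb_bmat, nb_mpow; apply nb_mpow || apply HA; auto.
Qed.

Lemma ess_mono A B : nb A -> nb B -> (forall i j, A i j <= B i j) -> ess A <= ess B.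
Proof.
intros HA HB H; apply rho_hat_le_of_gamma; auto using bset_sing.
intros n; rewrite !spow_sing, !gamma_set_sing by now apply nb_mpow.
apply gamma_mono; auto using nb_mpow; now apply mpow_le.
Qed.

Lemma ess_le_rho_hat S A : bset S -> S A -> ess A <= rho_hat_set S.
Proof.
intros HS HA; assert (NA : nb A) by eauto using bset_nb.
apply rho_hat_le_of_gamma; auto using bset_sing.
intros n; rewrite spow_sing, gamma_set_sing by now apply nb_mpow.
apply gamma_le_set; [now apply bset_spow|].
clear - HA; induction n; [now rewrite mpow_1|].
now exists (mpow A (Datatypes.S n)), A.
Qed.

Lemma ess_had m a F : (1 <= m)%nat -> / INR m <= a -> (forall j, (j < m)%nat -> nb (F j)) ->
  ess (had m a F) <= prodm m (fun j => rpow (ess (F j)) a).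
Proof.
intros Hm Ha HF; unfold ess.
assert (HS : forall j, (j < m)%nat -> bset (sing (F j))) by auto using bset_sing.
eapply Rle_trans; [|apply (rho_hat_hadset (fun j => sing (F j))); auto].
apply ess_le_rho_hat; [now apply bset_hadset|].
apply hadset_iff; now exists F.
Qed.

(** The Gram matrix H is symmetric, so [gamma_mpow_sym] bounds below every term of the sequence
    whose limit is [ess]. The k + 1 Gram factors account for 2 (k + 1) letters. *)
Lemma ess_gram_ge A k : nb A -> gamma A ^ (2 * S k) <= ess (mpow (mmul (transp A) A) (S k)).
Proof.
intros HA; set (H := mmul (transp A) A).
assert (HH : nb H) by (apply nb_mmul; auto using nb_transp).
assert (Hsym : transp H = H) by (unfold H; rewrite transp_mmul; reflexivity).
assert (Hg : gamma A ^ (2 * S k) <= gamma H ^ S k).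
{ rewrite pow_mult; apply pow_incr; split; [apply pow2_ge_0 | now apply gamma_gram]. }
eapply Rle_trans; [exact Hg|].
assert (Hs := bset_sing _ (nb_mpow H (S k) HH)).
destruct (rho_hat_fekete _ Hs) as (_ & H2 & _).
apply (is_lim_seq_le (fun _ => gamma H ^ S k) _ (gamma H ^ S k) (ess (mpow H (S k))))
  with (2 := is_lim_seq_const _) (3 := H2).
intros n; rewrite spow_sing, gamma_set_sing by auto using nb_mpow.
rewrite <- (rpow_root (gamma H ^ S k) n) by now apply pow_le, gamma_ge0.
apply rpow_le; [left; apply Rinv_0_lt_compat, INR_S_pos|].
rewrite <- pow_mult, mpow_mul by auto; now apply gamma_mpow_sym.
Qed.

(** * The essential spectrum of a nonnegative matrix *)

Definition mseries (T : nat -> Mat) : Mat := fun i j => Series (fun l => T l i j).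

Section MatrixSeries.
Variables (T : nat -> Mat) (beta : nat -> R).
Hypothesis HT : forall l, opb (T l) (beta l).
Hypothesis Hbeta : ex_series beta.

Lemma mseries_ex i j : ex_series (fun l => Rabs (T l i j)).
Proof.
apply (ex_series_le_nonneg _ beta); [|exact Hbeta]; intros l; now apply opb_entry.
Qed.

Lemma opb_mseries : opb (mseries T) (Series beta).
Proof.
assert (Hb0 : forall l, 0 <= beta l) by (intros l; eapply opb_ge0, HT).
split; [now apply Series_nonneg|]; intros N J x y Hx Hy.
assert (H0 : forall i j, ex_series (fun l => y i * (Rabs (T l i j) * x j))).
{ intros i j; apply (ex_series_ext (fun l => (y i * x j) * Rabs (T l i j))).
  { intros; ring_simplify; reflexivity. }
  apply (ex_series_scal (V := R_NormedModule)), mseries_ex. }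
assert (H1 : forall i, ex_series (fun l => rsum (fun j => y i * (Rabs (T l i j) * x j)) J)).
{ intros i; apply (ex_series_finite_sum (fun l j => y i * (Rabs (T l i j) * x j)) J); auto. }
apply Rle_trans with (Series (fun l => rsum (fun i => rsum (fun j => y i * (Rabs (T l i j) * x j)) J) N)).
- rewrite (proj2 (ex_series_finite_sum
    (fun l i => rsum (fun j => y i * (Rabs (T l i j) * x j)) J) N H1)).
  apply rsum_le; intros i.
  rewrite (proj2 (ex_series_finite_sum (fun l j => y i * (Rabs (T l i j) * x j)) J (H0 i))).
  apply rsum_le; intros j; rewrite Series_scal_l; apply Rmult_le_compat_l; [auto|].
  rewrite Series_scal_r; apply Rmult_le_compat_r; [auto|].
  apply Series_Rabs, mseries_ex.
- rewrite <- Series_scal_r; apply Series_le.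
  + intros l; split.
    * apply rsum_nonneg; intros i; apply rsum_nonneg; intros j.
      repeat apply Rmult_le_pos; auto using Rabs_pos.
    * now apply HT.
  + apply (ex_series_ext (fun l => (fnorm J x * fnorm N y) * beta l)).
    { intros; ring_simplify; reflexivity. }
    now apply (ex_series_scal (V := R_NormedModule)).
Qed.

(** The exchange of the two summations is justified by the summable bound b beta_l on the entries of
    the products |T_l| |B|. *)
Lemma mseries_mul_r B : bmat B -> mmul (mseries T) B = mseries (fun l => mmul (T l) B).
Proof.
intros [b HB]; apply mat_ext; intros i j; unfold mmul, mseries.
rewrite (Series_ext _ (fun k => Series (fun l => T l i k * B k j)))
  by (intros; symmetry; apply Series_scal_r).
apply Series_exchange.
- intros l; apply mmul_ex_series; [now exists (beta l) | now exists b].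
- apply (ex_series_ext (fun l => Rabs (Series (fun k => Rabs (T l i k * B k j))))).
  { intros l; apply Rabs_pos_eq, Series_nonneg; [intros; apply Rabs_pos|].
    apply mmul_ex_series; [now exists (beta l) | now exists b]. }
  apply (ex_series_le_nonneg _ (fun l => b * beta l)).
  + intros l.
    assert (H := opb_entry _ _ i j (opb_mmul _ _ _ _ (opb_abs _ _ (HT l)) (opb_abs _ _ HB))).
    rewrite (Rmult_comm b); eapply Rle_trans; [|exact H]; apply Req_le; f_equal.
    apply Series_ext; intros; apply Rabs_mult.
  + now apply (ex_series_scal (V := R_NormedModule)).
Qed.

End MatrixSeries.

Lemma mseries_mul_l T beta B : (forall l, opb (T l) (beta l)) -> ex_series beta -> bmat B ->
  mmul B (mseries T) = mseries (fun l => mmul B (T l)).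
Proof.
intros HT Hb HB.
change (mmul B (mseries T)) with (mmul (transp (transp B)) (transp (transp (mseries T)))).
rewrite <- transp_mmul.
change (transp (mseries T)) with (mseries (fun l => transp (T l))).
rewrite (mseries_mul_r _ beta); auto using opb_transp, bmat_transp.
apply mat_ext; intros i j; unfold transp at 1, mseries; apply Series_ext; intros l.
now rewrite <- transp_mmul.
Qed.

(** * Complex vectors and compact operators *)

Definition re (z : cvec) : vec := fun n => fst (z n).
Definition im (z : cvec) : vec := fun n => snd (z n).

Lemma Cmod_sq (c : C) : Cmod c ^ 2 = fst c ^ 2 + snd c ^ 2.
Proof. unfold Cmod; apply pow2_sqrt; generalize (pow2_ge_0 (fst c)) (pow2_ge_0 (snd c)); lra. Qed.

Lemma cl2_iff z : cl2 z <-> l2 (re z) /\ l2 (im z).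
Proof.
split.
- intros Hz.
  assert (H : forall x : vec, (forall n, x n ^ 2 <= Cmod (z n) ^ 2) -> l2 x).
  { intros x Hx; unfold l2; apply ex_series_Rabs.
    apply (ex_series_le_nonneg _ (fun n => Cmod (z n) ^ 2)); [|exact Hz].
    intros n; rewrite Rabs_pos_eq by apply pow2_ge_0; apply Hx. }
  split; apply H; intros n; rewrite Cmod_sq; unfold re, im;
    generalize (pow2_ge_0 (fst (z n))) (pow2_ge_0 (snd (z n))); lra.
- intros [H1 H2]; apply (ex_series_ext (fun n => re z n ^ 2 + im z n ^ 2)).
  { intros n; symmetry; apply Cmod_sq. }
  now apply (ex_series_plus (V := R_NormedModule)).
Qed.

Lemma cnorm_sq z : cl2 z -> cnorm z ^ 2 = l2norm (re z) ^ 2 + l2norm (im z) ^ 2.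
Proof.
intros Hz; destruct (proj1 (cl2_iff z) Hz) as [H1 H2].
assert (P : forall x, l2 x -> 0 <= Series (fun n => x n ^ 2))
  by (intros; apply Series_nonneg; auto using pow2_ge_0).
unfold cnorm, l2norm; rewrite !pow2_sqrt; auto.
rewrite <- Series_plus by assumption; apply Series_ext; intros n; apply Cmod_sq.
Qed.

Lemma cnorm_ge0 z : 0 <= cnorm z.
Proof. apply sqrt_pos. Qed.

Lemma cnorm_bounds z : cl2 z ->
  l2norm (re z) <= cnorm z /\ l2norm (im z) <= cnorm z /\
  cnorm z <= l2norm (re z) + l2norm (im z).
Proof.
intros Hz; generalize (cnorm_sq z Hz) (cnorm_ge0 z) (l2norm_ge0 (re z)) (l2norm_ge0 (im z)).
intros; repeat split; apply Rnot_lt_le; intros Hlt; nra.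
Qed.

(* The complex matrix [U + i V] acting on a complex vector. *)
Definition cmat (U V : Mat) : cop := fun z i =>
  (mat_apply U (re z) i - mat_apply V (im z) i, mat_apply U (im z) i + mat_apply V (re z) i).

Lemma cmat_parts U V u v z : opb U u -> opb V v -> cl2 z ->
  l2 (re (cmat U V z)) /\ l2norm (re (cmat U V z)) <= (u + v) * cnorm z /\
  l2 (im (cmat U V z)) /\ l2norm (im (cmat U V z)) <= (u + v) * cnorm z.
Proof.
intros HU HV Hz; destruct (proj1 (cl2_iff z) Hz) as [Hx Hy].
destruct (cnorm_bounds z Hz) as (B1 & B2 & _).
destruct (mat_apply_bound U u _ HU Hx) as [U1 U2], (mat_apply_bound U u _ HU Hy) as [U3 U4].
destruct (mat_apply_bound V v _ HV Hx) as [V1 V2], (mat_apply_bound V v _ HV Hy) as [V3 V4].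
assert (Hu := opb_ge0 _ _ HU); assert (Hv := opb_ge0 _ _ HV).
destruct (l2_sub (mat_apply U (re z)) (mat_apply V (im z)) U1 V3) as [S1 S2].
destruct (l2_lincomb 1 (mat_apply U (im z)) (mat_apply V (re z)) U3 V1) as [S3 S4].
rewrite Rabs_R1 in S4.
assert (Ei : (fun i => mat_apply U (im z) i + 1 * mat_apply V (re z) i) = im (cmat U V z)).
{ apply functional_extensionality; intros i; unfold im at 2, cmat; simpl; ring. }
rewrite Ei in S3, S4.
assert (u * l2norm (re z) <= u * cnorm z) by now apply Rmult_le_compat_l.
assert (u * l2norm (im z) <= u * cnorm z) by now apply Rmult_le_compat_l.
assert (v * l2norm (re z) <= v * cnorm z) by now apply Rmult_le_compat_l.
assert (v * l2norm (im z) <= v * cnorm z) by now apply Rmult_le_compat_l.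
change (re (cmat U V z)) with (vsub (mat_apply U (re z)) (mat_apply V (im z))).
repeat split; auto; lra.
Qed.

Lemma cmat_bounded_linear U V : bmat U -> bmat V -> bounded_linear (cmat U V).
Proof.
intros HU HV; assert (HU' := HU); assert (HV' := HV).
destruct HU as [u HU], HV as [v HV]; split; [|split].
- intros z Hz; apply cl2_iff; destruct (cmat_parts U V u v z HU HV Hz) as (H1 & _ & H2 & _); auto.
- intros z w c Hz Hw n.
  apply cl2_iff in Hz; destruct Hz as [Hx Hy]; apply cl2_iff in Hw; destruct Hw as [Hp Hq].
  destruct c as [a b].
  assert (Lin : forall M, bmat M ->
    mat_apply M (re (cadd z (cscal (a, b) w))) n
      = mat_apply M (re z) n + a * mat_apply M (re w) n + - b * mat_apply M (im w) n /\
    mat_apply M (im (cadd z (cscal (a, b) w))) n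
      = mat_apply M (im z) n + a * mat_apply M (im w) n + b * mat_apply M (re w) n).
  { intros M HM; split.
    - rewrite <- mat_apply_lincomb, <- mat_apply_lincomb by (auto; now apply l2_lincomb).
      f_equal; apply functional_extensionality; intros i; unfold re, im, cadd, cscal; simpl; ring.
    - rewrite <- mat_apply_lincomb, <- mat_apply_lincomb by (auto; now apply l2_lincomb).
      f_equal; apply functional_extensionality; intros i; unfold re, im, cadd, cscal; simpl; ring. }
  destruct (Lin U HU') as [L1 L2], (Lin V HV') as [L3 L4].
  unfold cmat at 1; rewrite L1, L2, L3, L4.
  unfold cadd, cscal, cmat, Cplus, Cmult; simpl; f_equal; ring.
- exists (2 * (u + v)); intros z Hz.
  destruct (cmat_parts U V u v z HU HV Hz) as (H1 & H2 & H3 & H4).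
  destruct (cnorm_bounds (cmat U V z)) as (_ & _ & H5); [now apply cl2_iff|].
  lra.
Qed.

Lemma cmat_compact U V : bmat U -> bmat V -> tails U 0 -> tails V 0 -> compact_op (cmat U V).
Proof.
intros HU HV TU TV; split; [now apply cmat_bounded_linear|].
intros eps He.
destruct HU as [u HU], HV as [v HV].
(* The tails of U and V together give eps/4 in each of the real and imaginary parts, the net adds
   eps/4 to each, and the two parts add up to [eps]. *)
destruct (TU (eps / 8)) as [n1 H1]; [lra|]; destruct (TV (eps / 8)) as [n2 H2]; [lra|].
set (n := Nat.max n1 n2).
apply (opb_rtail_anti _ n) in H1; [|unfold n; lia].
apply (opb_rtail_anti _ n) in H2; [|unfold n; lia].
destruct (net_of_tail n (u + v) (eps / 4) (eps / 4)) as (cs & Hcs & Hnet); [lra|].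
exists (map (fun p : vec * vec => fun i => (fst p i, snd p i)) (list_prod cs cs)); split.
- rewrite Forall_forall in *; intros w Hw; apply in_map_iff in Hw.
  destruct Hw as [[c d] [<- Hp]]; apply in_prod_iff in Hp; apply cl2_iff; split; now apply Hcs.
- intros z Hz Hz1; apply Exists_exists.
  destruct (cmat_parts U V u v z HU HV Hz) as (P1 & P2 & P3 & P4).
  destruct (cmat_parts _ _ _ _ z H1 H2 Hz) as (Q1 & Q2 & Q3 & Q4).
  assert (E1 : re (cmat (rtail n U) (rtail n V) z) = vtail n (re (cmat U V z))).
  { apply functional_extensionality; intros i; unfold re at 1, cmat; simpl.
    rewrite !mat_apply_rtail; unfold vtail, re, cmat; simpl; destruct Nat.leb; ring. }
  assert (E2 : im (cmat (rtail n U) (rtail n V) z) = vtail n (im (cmat U V z))).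
  { apply functional_extensionality; intros i; unfold im at 1, cmat; simpl.
    rewrite !mat_apply_rtail; unfold vtail, im, cmat; simpl; destruct Nat.leb; ring. }
  rewrite E1 in Q2; rewrite E2 in Q4.
  assert (Huv : 0 <= u + v) by (generalize (opb_ge0 _ _ HU) (opb_ge0 _ _ HV); lra).
  assert (Hn := cnorm_ge0 z).
  destruct (Hnet (re (cmat U V z))) as (c & Hc & Hc1); auto; [nra | nra |].
  destruct (Hnet (im (cmat U V z))) as (d & Hd & Hd1); auto; [nra | nra |].
  exists (fun i => (c i, d i)); split.
  { apply in_map_iff; exists (c, d); split; [reflexivity | now apply in_prod]. }
  rewrite Forall_forall in Hcs.
  set (D := csub (cmat U V z) (fun i => (c i, d i))).
  assert (R1 : re D = vsub (re (cmat U V z)) c) by reflexivity.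
  assert (R2 : im D = vsub (im (cmat U V z)) d) by reflexivity.
  destruct (cnorm_bounds D) as (_ & _ & H5).
  { apply cl2_iff; rewrite R1, R2; split; now apply l2_sub; auto. }
  rewrite R1, R2 in H5; lra.
Qed.

Lemma tails_rhead n A : tails (rhead n A) 0.
Proof.
intros eps He; exists n; apply (opb_mono _ mzero 0 _ opb_zero); [|lra].
intros i j; unfold rtail, rhead, mzero; destruct Nat.leb; lra.
Qed.

Lemma bmat_tails A : bmat A -> exists c, 0 <= c /\ tails A c.
Proof.
intros [c Hc]; exists c; split; [now apply opb_ge0 in Hc|]; now apply (opb_tails 0).
Qed.

(** By positivity, deleting the first n rows in every factor leaves no more than deleting them in
    the leftmost factor alone. *)
Lemma mpow_rtail_le n A k : nb A ->
  forall i j, mpow (rtail n A) (S k) i j <= rtail n (mpow A (S k)) i j.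
Proof.
intros HA i j; rewrite !mpow_S_l by auto using nb_rtail; rewrite rtail_mmul.
assert (Hr := nb_rtail n A HA).
apply mmul_le; auto using nb_bmat, nb_mpow; [apply Hr | now apply nb_mpow | intros; lra |].
apply mpow_le; auto; intros i' j'.
generalize (rtail_le n A i' j'); rewrite !Rabs_pos_eq; auto; [apply HA | apply Hr].
Qed.

(** The coefficient lam^(-l-1) of A^l in the Neumann series. *)
Fixpoint inv_powers (lam : C) (l : nat) : C :=
  match l with O => Cinv lam | S l' => Cmult (Cinv lam) (inv_powers lam l') end.

Lemma inv_powers_mod lam l : lam <> RtoC 0 -> Cmod (inv_powers lam l) = (/ Cmod lam) ^ S l.
Proof.
intros H; induction l; simpl.
- rewrite Cmod_inv by auto; ring.
- rewrite Cmod_mult, IHl, Cmod_inv by auto; simpl; ring.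
Qed.

Lemma Rabs_fst_le c : Rabs (fst c) <= Cmod c.
Proof. eapply Rle_trans; [apply Rmax_l | apply Rmax_Cmod]. Qed.

Lemma Rabs_snd_le c : Rabs (snd c) <= Cmod c.
Proof. eapply Rle_trans; [apply Rmax_r | apply Rmax_Cmod]. Qed.

(* The inverse of [lam - A] as the Neumann series [sum lam^(-l-1) A^l], split into its real
   and imaginary parts [U] and [V]. *)
Lemma neumann_resolvent A (a b q D : R) : bmat A -> 0 < q -> q < Cmod (a, b) ->
  (forall n, opb (mpow A n) (D * q ^ n)) ->
  exists U V, bmat U /\ bmat V /\
    mmul A U = mmul U A /\ mmul A V = mmul V A /\
    madd (mscal a U) (mscal (- b) V) = madd mone (mmul U A) /\
    madd (mscal a V) (mscal b U) = mmul V A.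
Proof.
intros HA Hq Hlam HP; set (lam := (a, b) : C) in *; set (rho := Cmod lam) in *.
assert (Hrho : 0 < rho) by lra.
assert (Hl0 : lam <> RtoC 0) by (intros E; unfold rho in Hrho; rewrite E, Cmod_0 in Hrho; lra).
set (u := fun l => fst (inv_powers lam l)); set (v := fun l => snd (inv_powers lam l)).
assert (Hu : forall l, Rabs (u l) <= (/ rho) ^ S l)
  by (intros l; eapply Rle_trans; [apply Rabs_fst_le | rewrite inv_powers_mod by auto; apply Rle_refl]).
assert (Hv : forall l, Rabs (v l) <= (/ rho) ^ S l)
  by (intros l; eapply Rle_trans; [apply Rabs_snd_le | rewrite inv_powers_mod by auto; apply Rle_refl]).
assert (R0 : Cmult lam (inv_powers lam 0) = RtoC 1) by (simpl; now apply Cinv_r).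
assert (RS : forall l, Cmult lam (inv_powers lam (S l)) = inv_powers lam l).
{ intros l; simpl; rewrite Cmult_assoc, Cinv_r by auto; apply Cmult_1_l. }
assert (Hir : 0 < / rho) by now apply Rinv_0_lt_compat.
set (beta := fun l => / rho * D * (q / rho) ^ l).
assert (Hbeta : ex_series beta).
{ apply (ex_series_scal (V := R_NormedModule)), ex_series_geom.
  rewrite Rabs_pos_eq.
  - apply (Rmult_lt_reg_r rho); [exact Hrho|]; unfold Rdiv; rewrite Rmult_assoc, Rinv_l; lra.
  - left; now apply Rdiv_lt_0_compat. }
assert (HT : forall w : nat -> R, (forall l, Rabs (w l) <= (/ rho) ^ S l) ->
   forall l, opb (mscal (w l) (mpow A l)) (beta l)).
{ intros w Hw l; apply (opb_weaken _ _ _ (opb_scal (w l) _ _ (HP l))).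
  apply Rle_trans with ((/ rho) ^ S l * (D * q ^ l)).
  - apply Rmult_le_compat_r; [eapply opb_ge0, HP | apply Hw].
  - apply Req_le; unfold beta, Rdiv; rewrite Rpow_mult_distr; simpl; ring. }
assert (HTu := HT u Hu); assert (HTv := HT v Hv).
set (Tu := fun l => mscal (u l) (mpow A l)) in *.
set (Tv := fun l => mscal (v l) (mpow A l)) in *.
assert (Comm : forall n, mmul A (mpow A n) = mpow A (S n)).
{ induction n; [simpl; now rewrite mmul_1_l, mmul_1_r|].
  simpl; rewrite mmul_assoc, IHn; auto; exists (D * q ^ n); apply HP. }
assert (Right : forall w T, (forall l, T l = mscal (w l) (mpow A l)) -> (forall l, opb (T l) (beta l)) ->
  mmul (mseries T) A = mseries (fun l => mscal (w l) (mpow A (S l)))).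
{ intros w T HTw HTb; rewrite (mseries_mul_r T beta) by auto.
  f_equal; apply functional_extensionality; intros l; rewrite HTw; apply mmul_scal_l. }
assert (Left : forall w T, (forall l, T l = mscal (w l) (mpow A l)) -> (forall l, opb (T l) (beta l)) ->
  mmul A (mseries T) = mseries (fun l => mscal (w l) (mpow A (S l)))).
{ intros w T HTw HTb; rewrite (mseries_mul_l T beta) by auto.
  f_equal; apply functional_extensionality; intros l; rewrite HTw, mmul_scal_r, Comm; reflexivity. }
assert (Exu : forall i j, ex_series (fun l => Tu l i j))
  by (intros; apply ex_series_Rabs, (mseries_ex _ beta); auto).
assert (Exv : forall i j, ex_series (fun l => Tv l i j))
  by (intros; apply ex_series_Rabs, (mseries_ex _ beta); auto).
exists (mseries Tu), (mseries Tv).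
split; [exists (Series beta); now apply opb_mseries|].
split; [exists (Series beta); now apply opb_mseries|].
split; [now rewrite (Left u), (Right u)|].
split; [now rewrite (Left v), (Right v)|].
(* Comparison of coefficients: lam c_0 = 1 and lam c_(l+1) = c_l, separated into real and imaginary
   parts. *)
assert (Eu0 : a * u 0%nat + - b * v 0%nat = 1).
{ generalize (f_equal fst R0); unfold u, v, lam; simpl; lra. }
assert (EuS : forall l, a * u (S l) + - b * v (S l) = u l).
{ intros l; unfold u at 2; rewrite <- RS; unfold u, v, lam; simpl; ring. }
assert (Ev0 : a * v 0%nat + b * u 0%nat = 0).
{ generalize (f_equal snd R0); unfold u, v, lam; simpl; lra. }
assert (EvS : forall l, a * v (S l) + b * u (S l) = v l).
{ intros l; unfold v at 2; rewrite <- RS; unfold u, v, lam; simpl; ring. }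
assert (Comb : forall s t i j, ex_series (fun l => s * Tu l i j + t * Tv l i j)).
{ intros; apply (ex_series_plus (V := R_NormedModule));
    now apply (ex_series_scal (V := R_NormedModule)). }
split.
- rewrite (Right u) by auto; apply mat_ext; intros i j; unfold madd, mscal at 1 2, mseries.
  rewrite <- !Series_scal_l, <- Series_plus by now apply (ex_series_scal (V := R_NormedModule)).
  rewrite Series_incr_1 by apply Comb; f_equal.
  + unfold Tu, Tv, mscal; simpl; rewrite <- Rmult_assoc, <- (Rmult_assoc (- b)), <- Rmult_plus_distr_r, Eu0.
    ring.
  + apply Series_ext; intros l; unfold Tu, Tv, mscal.
    rewrite <- Rmult_assoc, <- (Rmult_assoc (- b)), <- Rmult_plus_distr_r, EuS; reflexivity.
- rewrite (Right v) by auto; apply mat_ext; intros i j; unfold madd, mscal at 1 2, mseries.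
  rewrite <- !Series_scal_l, <- Series_plus by now apply (ex_series_scal (V := R_NormedModule)).
  rewrite (Series_ext _ (fun l => b * Tu l i j + a * Tv l i j)) by (intros; ring).
  rewrite Series_incr_1 by apply Comb.
  rewrite (Series_ext _ (fun l => mscal (v l) (mpow A (S l)) i j)).
  + unfold Tu, Tv, mscal; rewrite <- Rmult_assoc, <- (Rmult_assoc a), <- Rmult_plus_distr_r.
    rewrite (Rplus_comm (b * _)), Ev0; ring.
  + intros l; unfold Tu, Tv, mscal.
    rewrite <- Rmult_assoc, <- (Rmult_assoc a), <- Rmult_plus_distr_r.
    now rewrite (Rplus_comm (b * _)), EvS.
Qed.

Lemma tails_scal s A c : tails A c -> tails (mscal s A) (Rabs s * c).
Proof.
intros HA eps He.
assert (Hs := Rabs_pos s).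
set (d := eps / (Rabs s + 1)).
assert (Hd : 0 < d) by (apply Rdiv_lt_0_compat; lra).
assert (Hd2 : Rabs s * d <= eps).
{ apply Rle_trans with ((Rabs s + 1) * d); [nra|].
  apply Req_le; unfold d; field; lra. }
destruct (HA d Hd) as [n Hn]; exists n.
apply (opb_mono _ _ _ _ (opb_scal s _ _ Hn)); [|lra].
intros i j; unfold rtail, mscal; destruct Nat.leb; rewrite ?Rmult_0_r; lra.
Qed.

Lemma nb_mscal s A : 0 <= s -> nb A -> nb (mscal s A).
Proof.
intros Hs [H1 H2]; split; [|now apply bmat_scal].
intros i j; apply Rmult_le_pos; auto.
Qed.

Lemma gamma_mscal_le s A : 0 <= s -> nb A -> gamma (mscal s A) <= s * gamma A.
Proof.
intros Hs HA; apply gamma_le; [now apply nb_mscal | |].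
- apply Rmult_le_pos; auto using gamma_ge0.
- rewrite <- (Rabs_pos_eq s) at 2 by auto; now apply tails_scal, gamma_tails.
Qed.

Lemma gamma_mscal_ge s A : 0 < s -> nb A -> s * gamma A <= gamma (mscal s A).
Proof.
intros Hs HA.
assert (Hi : 0 < / s) by now apply Rinv_0_lt_compat.
assert (E : mscal (/ s) (mscal s A) = A).
{ apply mat_ext; intros; unfold mscal; field; lra. }
assert (HsA : nb (mscal s A)) by (apply nb_mscal; auto; lra).
assert (H := gamma_mscal_le (/ s) (mscal s A) ltac:(lra) HsA); rewrite E in H.
apply (Rmult_le_reg_l (/ s)); [exact Hi|].
rewrite <- Rmult_assoc, Rinv_l by lra; lra.
Qed.

Lemma mat_apply_madd2 M N c d P Q e f x i :
  bmat M -> bmat N -> bmat P -> bmat Q -> l2 x ->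
  madd (mscal c M) (mscal d N) = madd (mscal e P) (mscal f Q) ->
  c * mat_apply M x i + d * mat_apply N x i = e * mat_apply P x i + f * mat_apply Q x i.
Proof.
intros HM HN HP HQ Hx E.
rewrite <- !mat_apply_mscal, <- !mat_apply_madd by auto using bmat_scal.
now rewrite E.
Qed.

Lemma mscal_1 A : mscal 1 A = A.
Proof. apply mat_ext; intros; unfold mscal; ring. Qed.

Lemma mscal_0 A : mscal 0 A = mzero.
Proof. apply mat_ext; intros; unfold mscal, mzero; ring. Qed.

Lemma madd_zero_l A : madd mzero A = A.
Proof. apply mat_ext; intros; unfold madd, mzero; ring. Qed.

(* The resolvent of [A' = rtail n A] at [lam] inverts [lam - A] modulo compact operators:
   positivity gives [A'^k <= rtail n (A^k)] entrywise, so the spectral radius of [A'] can be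
   brought below any number exceeding [ess A]. *)
Lemma ess_spec_le A lam : nb A -> ess_spec A lam -> Cmod lam <= ess A.
Proof.
intros HA Hspec; apply Rnot_lt_le; intros Hlt; apply Hspec; clear Hspec.
destruct lam as [a b].
assert (He := ess_ge0 A HA).
set (q := (ess A + Cmod (a, b)) / 2).
assert (Hq : 0 < q) by (unfold q; lra).
destruct (ess_exists A q HA) as [N HN]; [unfold q; lra|].
specialize (HN N (le_n N)).
(* The gap below q^(N+1) is used as the error, so one row tail of A^(N+1) has norm at most
   q^(N+1). *)
destruct (gamma_tails _ (nb_mpow A (S N) HA) (q ^ S N - gamma (mpow A (S N)))) as [n Hn]; [lra|].
replace (gamma (mpow A (S N)) + (q ^ S N - gamma (mpow A (S N)))) with (q ^ S N) in Hn by ring.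
set (A' := rtail n A) in *; set (F := rhead n A).
assert (HA' : nb A') by now apply nb_rtail.
assert (HF : bmat F) by (apply (bmat_mono _ A); [now apply nb_bmat | apply rhead_le]).
assert (EA : A = madd F A') by apply rhead_rtail.
assert (HN' : opb (mpow A' (S N)) (q ^ S N)).
{ apply (opb_mono _ _ _ _ Hn); [|lra]; intros i j.
  assert (H0 := proj1 (nb_mpow A' (S N) HA') i j).
  assert (H1 := mpow_rtail_le n A N HA i j); fold A' in H1.
  rewrite !Rabs_pos_eq; lra. }
(* A single power of [A'] with this bound controls all its powers up to a constant D, and q < |lam|
   makes the Neumann series converge. *)
destruct (geometric_bound (fun n c => opb (mpow A' (S n)) c) N q) as (D & HD & HP); auto.
{ intros; eapply opb_weaken; eauto. }
{ intros p k c d Hc Hd H1 H2.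
  replace (S (S (p + k))) with (S p + S k)%nat by lia.
  rewrite mpow_add by auto; now apply opb_mmul. }
{ intros p; exact (proj2 (nb_mpow A' (S p) HA')). }
assert (HP' : forall n, opb (mpow A' n) (D * q ^ n)).
{ intros [|p]; [|apply HP]; simpl; apply (opb_weaken _ 1); [apply opb_one | lra]. }
destruct (neumann_resolvent A' a b q D) as (U & V & HU & HV & CU & CV & E1 & E2); auto.
{ now apply nb_bmat. }
{ unfold q; lra. }
assert (BA' := nb_bmat _ HA').
assert (BA := nb_bmat _ HA).
(* F has finitely many nonzero rows, so its row tails vanish from some index on, and products with a
   bounded matrix on either side stay compact. *)
assert (CK : forall X, bmat X -> bmat (mscal (-1) (mmul X F)) /\ tails (mscal (-1) (mmul X F)) 0 /\
   bmat (mscal (-1) (mmul F X)) /\ tails (mscal (-1) (mmul F X)) 0).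
{ intros X HX; destruct (bmat_tails X HX) as (c & Hc & Tc).
  assert (T0 := tails_rhead n A); fold F in T0.
  repeat split; auto using bmat_scal, bmat_mmul.
  - replace 0 with (Rabs (-1) * (c * 0)) by ring.
    apply tails_scal, tails_mmul; auto; lra.
  - replace 0 with (Rabs (-1) * (0 * c)) by ring.
    apply tails_scal, tails_mmul; auto; lra. }
(* With B the inverse of lam - A' and A = F + A', one has B (lam - A) = 1 - B F and (lam - A) B = 1
   - F B, which gives the two compact remainders. *)
exists (cmat U V), (cmat (mscal (-1) (mmul U F)) (mscal (-1) (mmul V F))),
  (cmat (mscal (-1) (mmul F U)) (mscal (-1) (mmul F V))).
split; [now apply cmat_bounded_linear|].
destruct (CK U HU) as (KU1 & KU2 & KU3 & KU4), (CK V HV) as (KV1 & KV2 & KV3 & KV4).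
split; [exact (cmat_compact _ _ KU1 KV1 KU2 KV2)|].
split; [exact (cmat_compact _ _ KU3 KV3 KU4 KV4)|].
clear CK KU1 KU2 KU3 KU4 KV1 KV2 KV3 KV4.
intros z Hz i; apply cl2_iff in Hz; destruct Hz as [Hx Hy].
set (x := re z) in *; set (y := im z) in *.
assert (E1v : forall v, l2 v -> a * mat_apply U v i - b * mat_apply V v i
    = v i + mat_apply (mmul U A') v i).
{ intros v Hv; generalize (mat_apply_madd2 U V a (- b) mone (mmul U A') 1 1 v i HU HV bmat_one
    (bmat_mmul _ _ HU BA') Hv); rewrite !mscal_1, mat_apply_one; intros H; specialize (H E1); lra. }
assert (E2v : forall v, l2 v -> a * mat_apply V v i + b * mat_apply U v i
    = mat_apply (mmul V A') v i).
{ intros v Hv; generalize (mat_apply_madd2 V U a b mone (mmul V A') 0 1 v i HV HU bmat_one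
    (bmat_mmul _ _ HV BA') Hv); rewrite mscal_1, mscal_0, madd_zero_l; intros H.
  specialize (H E2); lra. }
assert (XA : forall X v, bmat X -> l2 v -> mat_apply X (mat_apply A v) i
   = mat_apply (mmul X A') v i + mat_apply (mmul X F) v i).
{ intros X v HX Hv; rewrite <- mat_apply_mmul by auto.
  rewrite EA at 1; rewrite mmul_add_r, mat_apply_madd by auto using bmat_mmul; ring. }
assert (AX : forall X v, bmat X -> l2 v -> mat_apply A (mat_apply X v) i
   = mat_apply (mmul A' X) v i + mat_apply (mmul F X) v i).
{ intros X v HX Hv; rewrite <- mat_apply_mmul by auto.
  rewrite EA at 1; rewrite mmul_add_l, mat_apply_madd by auto using bmat_mmul; ring. }
assert (HAx : l2 (mat_apply A x)) by now apply mat_apply_l2.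
assert (HAy : l2 (mat_apply A y)) by now apply mat_apply_l2.
split.
- assert (Lr : forall X, bmat X -> mat_apply X (re (shifted A (a, b) z)) i
     = a * mat_apply X x i - b * mat_apply X y i - mat_apply X (mat_apply A x) i).
  { intros X HX.
    replace (re (shifted A (a, b) z)) with (fun k => (a * x k + - b * y k) + -1 * mat_apply A x k).
    - rewrite mat_apply_lincomb; auto; [|now apply l2_lincomb; [apply l2_scal|]].
      rewrite mat_apply_lincomb; auto; [|now apply l2_scal].
      replace (mat_apply X (fun k => a * x k) i) with (a * mat_apply X x i); [ring|].
      unfold mat_apply; rewrite <- Series_scal_l; apply Series_ext; intros; ring.
    - apply functional_extensionality; intros k; unfold re, shifted, csub, cscal, cx_apply, x, y; simpl.
      unfold mat_apply, re, im; ring. }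
  assert (Li : forall X, bmat X -> mat_apply X (im (shifted A (a, b) z)) i
     = a * mat_apply X y i + b * mat_apply X x i - mat_apply X (mat_apply A y) i).
  { intros X HX.
    replace (im (shifted A (a, b) z)) with (fun k => (a * y k + b * x k) + -1 * mat_apply A y k).
    - rewrite mat_apply_lincomb; auto; [|now apply l2_lincomb; [apply l2_scal|]].
      rewrite mat_apply_lincomb; auto; [|now apply l2_scal].
      replace (mat_apply X (fun k => a * y k) i) with (a * mat_apply X y i); [ring|].
      unfold mat_apply; rewrite <- Series_scal_l; apply Series_ext; intros; ring.
    - apply functional_extensionality; intros k; unfold im, shifted, csub, cscal, cx_apply, x, y; simpl.
      unfold mat_apply, re, im; ring. }
  unfold cmat at 1; rewrite !Lr, !Li by auto.
  unfold cadd, cmat, Cplus; cbn [fst snd]; fold x y; rewrite !mat_apply_mscal, !XA by auto.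
  generalize (E1v x Hx) (E1v y Hy) (E2v x Hx) (E2v y Hy); intros.
  change (fst (z i)) with (x i); change (snd (z i)) with (y i).
  f_equal; lra.
- assert (Hp : mat_apply A (re (cmat U V z)) i
     = mat_apply A (mat_apply U x) i - mat_apply A (mat_apply V y) i).
  { replace (re (cmat U V z)) with (fun k => mat_apply U x k + -1 * mat_apply V y k).
    - rewrite mat_apply_lincomb; auto using mat_apply_l2; ring.
    - apply functional_extensionality; intros k; unfold re at 1, cmat; simpl; fold x y; ring. }
  assert (Hr : mat_apply A (im (cmat U V z)) i
     = mat_apply A (mat_apply U y) i + mat_apply A (mat_apply V x) i).
  { replace (im (cmat U V z)) with (fun k => mat_apply U y k + 1 * mat_apply V x k).
    - rewrite mat_apply_lincomb; auto using mat_apply_l2; ring.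
    - apply functional_extensionality; intros k; unfold im at 1, cmat; simpl; fold x y; ring. }
  assert (ES : shifted A (a, b) (cmat U V z) i =
     (a * (mat_apply U x i - mat_apply V y i) - b * (mat_apply U y i + mat_apply V x i)
        - mat_apply A (re (cmat U V z)) i,
      a * (mat_apply U y i + mat_apply V x i) + b * (mat_apply U x i - mat_apply V y i)
        - mat_apply A (im (cmat U V z)) i)).
  { unfold shifted, csub, cscal, cx_apply, Cminus, Cplus, Copp, Cmult; simpl.
    unfold mat_apply at 5 10; f_equal. }
  rewrite ES, Hp, Hr, !AX, CU, CV by auto.
  unfold cadd, cmat, Cplus; cbn [fst snd]; fold x y; rewrite !mat_apply_mscal.
  generalize (E1v x Hx) (E1v y Hy) (E2v x Hx) (E2v y Hy); intros.
  change (fst (z i)) with (x i); change (snd (z i)) with (y i).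
  f_equal; lra.
Qed.

(** Only the right inverse modulo compact operators is kept. As rho and A are real, the real part of
    its identity on real vectors involves real parts alone. Compactness of the remainder enters as
    uniform smallness of the tails of K x on the unit ball. *)
Lemma not_ess_spec_real_right_inverse A rho : ~ ess_spec A (RtoC rho) ->
  exists (W K : vec -> vec) (M0 M1 : R), 0 < M0 /\ 0 <= M1 /\
    (forall x, l2 x -> l2norm x <= 1 ->
       l2 (W x) /\ l2norm (W x) <= M0 /\ l2 (K x) /\ l2norm (K x) <= M1 /\
       forall i, rho * W x i - mat_apply A (W x) i = x i + K x i) /\
    (forall eps, 0 < eps -> exists n, forall x, l2 x -> l2norm x <= 1 ->
       l2norm (vtail n (K x)) <= eps).
Proof.
intros H; apply NNPP in H.
destruct H as (B & K1 & K2 & (HB1 & _ & M & HB2) & _ & ((HK1 & _ & M' & HK2) & HK3) & Heq).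
set (em := fun x : vec => (fun n => (x n, 0)) : cvec).
assert (Eim : forall x, im (em x) = fun _ => 0) by reflexivity.
destruct l2_zero as [Z1 Z2].
assert (Hem : forall x, l2 x -> l2norm x <= 1 -> cl2 (em x) /\ cnorm (em x) <= 1).
{ intros x Hx Hx1.
  assert (Hc : cl2 (em x)) by (apply cl2_iff; split; [exact Hx | exact Z1]).
  split; [exact Hc|].
  destruct (cnorm_bounds (em x) Hc) as (_ & _ & H3); rewrite Eim, Z2 in H3.
  change (re (em x)) with x in H3; lra. }
exists (fun x => re (B (em x))), (fun x => re (K2 (em x))), (Rabs M + 1), (Rabs M').
split; [generalize (Rabs_pos M); lra|]; split; [apply Rabs_pos|]; split.
- intros x Hx Hx1; destruct (Hem x Hx Hx1) as [Hc Hc1].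
  destruct (cnorm_bounds _ (HB1 _ Hc)) as (B1 & _), (cnorm_bounds _ (HK1 _ Hc)) as (B2 & _).
  assert (Hn := cnorm_ge0 (em x)).
  split; [apply cl2_iff; auto|]; split.
  { generalize (HB2 _ Hc) (Rle_abs M) (Rabs_pos M); nra. }
  split; [apply cl2_iff; auto|]; split.
  { generalize (HK2 _ Hc) (Rle_abs M') (Rabs_pos M'); nra. }
  intros i; destruct (Heq _ Hc i) as [_ E]; apply (f_equal fst) in E.
  unfold shifted, csub, cscal, cx_apply, cadd, Cminus, Cplus, Copp, Cmult, RtoC, em in E; simpl in E.
  unfold re, em, mat_apply; simpl; lra.
- intros eps He; destruct (HK3 (eps / 2)) as (cs & Hcs & Hnet); [lra|].
  destruct (l2_tails_small (map re cs) (eps / 2)) as [n Hn]; [| lra |].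
  { rewrite Forall_forall in *; intros c Hc; apply in_map_iff in Hc.
    destruct Hc as (c' & <- & Hc'); now apply cl2_iff, Hcs. }
  exists n; intros x Hx Hx1; destruct (Hem x Hx Hx1) as [Hc Hc1].
  destruct (proj1 (Exists_exists _ _) (Hnet _ Hc Hc1)) as (c & Hin & Hd).
  rewrite Forall_forall in Hcs.
  destruct (proj1 (cl2_iff _) (HK1 _ Hc)) as [P1 P2].
  destruct (proj1 (cl2_iff _) (Hcs _ Hin)) as [P3 P4].
  replace eps with (eps / 2 + eps / 2) by field.
  apply (vtail_net_bound n _ (re c)); auto.
  + assert (Hs : cl2 (csub (K2 (em x)) c)).
    { apply cl2_iff; split; [apply (l2_sub _ _ P1 P3) | apply (l2_sub _ _ P2 P4)]. }
    destruct (cnorm_bounds _ Hs) as (H1 & _).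
    change (re (csub (K2 (em x)) c)) with (vsub (re (K2 (em x))) (re c)) in H1; lra.
  + apply Hn, in_map, Hin.
Qed.

(** At s = / t these are the partial sums of the Neumann series for the inverse of t - A. *)
Definition geom (A : Mat) (s : R) (n : nat) : Mat :=
  fun i j => rsum (fun l => s ^ S l * mpow A l i j) n.

Lemma geom_S A s n : geom A s (S n) = madd (geom A s n) (mscal (s ^ S (S n)) (mpow A (S n))).
Proof. apply mat_ext; intros i j; unfold geom at 1; now rewrite rsum_S. Qed.

Lemma geom_0 A s : geom A s 0 = mscal s mone.
Proof. apply mat_ext; intros i j; unfold geom; rewrite rsum_0; unfold mscal; simpl; ring. Qed.

Lemma nb_madd A B : nb A -> nb B -> nb (madd A B).
Proof.
intros [H1 H2] [H3 H4]; split; [|now apply bmat_add].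
intros i j; apply Rplus_le_le_0_compat; auto.
Qed.

Lemma nb_geom A s n : nb A -> 0 < s -> nb (geom A s n).
Proof.
intros HA Hs; induction n.
- rewrite geom_0; apply nb_mscal; [lra | apply nb_one].
- rewrite geom_S; apply nb_madd; [exact IHn|]; apply nb_mscal; [|now apply nb_mpow].
  apply pow_le; lra.
Qed.

(** Telescoping: with R the partial sum, R (t - A) = 1 - t^(-n-1) A^(n+1), written without
    subtraction. *)
Lemma geom_identity A t n : nb A -> 0 < t ->
  madd (mscal t (geom A (/ t) n)) (mscal ((/ t) ^ S n) (mpow A (S n)))
  = madd mone (mmul (geom A (/ t) n) A).
Proof.
intros HA Ht; assert (Hi : 0 < / t) by now apply Rinv_0_lt_compat.
induction n.
- rewrite geom_0, mmul_scal_l, mmul_1_l; simpl mpow; rewrite mmul_1_l.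
  apply mat_ext; intros i j; unfold madd, mscal; simpl; field; lra.
- assert (E : forall i j, mmul (geom A (/ t) (S n)) A i j
     = mmul (geom A (/ t) n) A i j + (/ t) ^ S (S n) * mpow A (S (S n)) i j).
  { intros i j; rewrite geom_S, mmul_add_l, mmul_scal_l; [reflexivity | | |].
    - now apply nb_bmat, nb_geom.
    - now apply bmat_scal, nb_bmat, nb_mpow.
    - now apply nb_bmat. }
  apply mat_ext; intros i j; unfold madd; rewrite E.
  apply (f_equal (fun M => M i j)) in IHn; unfold madd in IHn.
  rewrite <- Rplus_assoc, <- IHn, geom_S; unfold madd, mscal.
  set (p := (/ t) ^ S (S n)).
  replace ((/ t) ^ S n) with (t * p) by (unfold p; simpl; field; lra); ring.
Qed.

(** A^q arises as A^l A^(q-l) in q + 1 ways, each with coefficient s^(q+2); by positivity the other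
    terms of the square may be dropped. The factor q + 1 is what [ess_in_ess_spec] exploits. *)
Lemma geom_square_ge A s q n : nb A -> 0 < s -> (q <= n)%nat -> forall i j,
  mscal (INR (S q) * s ^ (q + 2)) (mpow A q) i j <= mmul (geom A s n) (geom A s n) i j.
Proof.
intros HA Hs Hq i j.
assert (HP : forall l i j, 0 <= mpow A l i j) by (intros l; apply (nb_mpow A l HA)).
assert (Hterm : forall l k j, 0 <= s ^ S l * mpow A l k j).
{ intros; apply Rmult_le_pos; [apply pow_le; lra | apply HP]. }
assert (HG := nb_bmat _ (nb_geom A s n HA Hs)).
set (f := fun k l => (s ^ S l * mpow A l i k) * (s ^ S (q - l) * mpow A (q - l) k j)).
assert (Hf : forall l, ex_series (fun k => f k l) /\
   Series (fun k => f k l) = s ^ S l * s ^ S (q - l) * mmul (mpow A l) (mpow A (q - l)) i j).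
{ intros l; split.
  - apply (ex_series_ext (fun k => (s ^ S l * s ^ S (q - l)) * (mpow A l i k * mpow A (q - l) k j))).
    { intros; unfold f; simpl; ring_simplify; reflexivity. }
    apply (ex_series_scal (V := R_NormedModule)), ex_series_Rabs, mmul_ex_series;
      now apply nb_bmat, nb_mpow.
  - unfold mmul; rewrite <- Series_scal_l; apply Series_ext; intros; unfold f; ring. }
destruct (ex_series_finite_sum f q (fun l => proj1 (Hf l))) as [F1 F2].
apply Rle_trans with (Series (fun k => rsum (f k) q)).
- rewrite F2, (rsum_ext_loc _ (fun _ => s ^ (q + 2) * mpow A q i j)).
  + rewrite rsum_const; unfold mscal; lra.
  + intros l Hl; rewrite (proj2 (Hf l)), <- mpow_add, <- pow_add by auto.
    replace (S l + S (q - l))%nat with (q + 2)%nat by lia.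
    now replace (l + (q - l))%nat with q by lia.
- apply Series_le; [|now apply ex_series_Rabs, mmul_ex_series].
  intros k; split.
  { apply rsum_nonneg; intros l; unfold f; now apply Rmult_le_pos. }
  unfold geom at 1; rewrite <- rsum_scal_r.
  eapply Rle_trans; [|apply (rsum_incr _ q n); auto].
  + apply rsum_le; intros l; unfold f; apply Rmult_le_compat_l; [auto|].
    apply (rsum_term (fun l' => s ^ S l' * mpow A l' k j)); [auto | lia].
  + intros l; apply Rmult_le_pos; [auto|]; apply rsum_nonneg; auto.
Qed.

Lemma mat_apply_split_tail R k x i : bmat R -> l2 x ->
  mat_apply R x i = mat_apply (chead k R) x i + mat_apply R (vtail k x) i.
Proof.
intros HR Hx.
rewrite <- (Rmult_1_l (mat_apply R (vtail k x) i)).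
replace (mat_apply (chead k R) x i) with (mat_apply R (vhead k x) i).
- rewrite <- mat_apply_lincomb by auto using l2_vhead, l2_vtail.
  unfold mat_apply; apply Series_ext; intros j; rewrite (vhead_vtail k x j) at 1; ring.
- unfold mat_apply; apply Series_ext; intros j; unfold chead, vhead; destruct Nat.leb; ring.
Qed.

(** From (rho - A) w = x + K x and R (t - A) = 1 - E follows R x = w - E w - (t - rho) R w - R K x.
    Since |w| <= M0 and gamma E <= 1, the first two terms contribute 2 M0 and the third (t - rho) M0
    gamma R; the last is compact and contributes nothing. *)
Lemma gamma_geom_bound A rho t n W K M0 M1 : nb A -> 0 < t -> rho <= t -> 0 < M0 -> 0 <= M1 ->
  (forall x, l2 x -> l2norm x <= 1 ->
     l2 (W x) /\ l2norm (W x) <= M0 /\ l2 (K x) /\ l2norm (K x) <= M1 /\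
     forall i, rho * W x i - mat_apply A (W x) i = x i + K x i) ->
  (forall eps, 0 < eps -> exists n, forall x, l2 x -> l2norm x <= 1 ->
     l2norm (vtail n (K x)) <= eps) ->
  gamma (mpow A (S n)) <= t ^ S n ->
  gamma (geom A (/ t) n) <= 2 * M0 + (t - rho) * M0 * gamma (geom A (/ t) n).
Proof.
intros HA Ht Hrt HM0 HM1 HW HK HE.
assert (Hi : 0 < / t) by now apply Rinv_0_lt_compat.
set (R := geom A (/ t) n).
assert (HR : nb R) by now apply nb_geom.
set (E := mscal ((/ t) ^ S n) (mpow A (S n))).
assert (HEn : nb E) by (apply nb_mscal; [apply pow_le; lra | now apply nb_mpow]).
assert (HgE : gamma E <= 1).
{ eapply Rle_trans; [apply gamma_mscal_le; [apply pow_le; lra | now apply nb_mpow]|].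
  assert (Hp : 0 < (/ t) ^ S n) by now apply pow_lt.
  apply Rle_trans with ((/ t) ^ S n * t ^ S n); [now apply Rmult_le_compat_l; [lra|]|].
  rewrite <- Rpow_mult_distr, Rinv_l, pow1; lra. }
assert (BR := nb_bmat R HR); assert (BE := nb_bmat E HEn); assert (BA := nb_bmat A HA).
destruct BR as [cR HcR].
assert (BR : bmat R) by now exists cR.
assert (HcR0 := opb_ge0 _ _ HcR).
set (g := gamma R).
assert (Hg : 0 <= g) by now apply gamma_ge0.
(* The sum of the coefficients with which [eps] occurs in the bounds [Q2] to [Q5]. *)
set (C := M0 + (t - rho) * M0 + M1 + cR).
assert (HC : 0 <= C) by (unfold C; assert (0 <= (t - rho) * M0) by nra; lra).
apply le_epsilon; intros eps' He'.
set (eps := eps' / (C + 1)).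
assert (He : 0 < eps) by (apply Rdiv_lt_0_compat; lra).
assert (HeC : eps * C <= eps').
{ apply Rle_trans with (eps * (C + 1)); [nra|]; apply Req_le; unfold eps; field; lra. }
destruct (HK eps He) as [k Hk].
destruct (gamma_tails R HR eps He) as [n1 H1].
destruct (gamma_tails E HEn eps He) as [n2 H2].
destruct (chead_tail_small R k eps BR He) as [n3 H3].
set (N := Nat.max n1 (Nat.max n2 n3)).
apply (opb_rtail_anti _ N) in H1; [|unfold N; lia].
apply (opb_rtail_anti _ N) in H2; [|unfold N; lia].
apply (opb_rtail_anti _ N) in H3; [|unfold N; lia].
apply (opb_weaken _ _ (1 + eps)) in H2; [|lra].
fold g in H1.
apply (gamma_le_rtail N); [exact HR|].
assert (Hb0 : 0 <= (t - rho) * M0) by nra.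
apply opb_of_apply; [nra | apply (nb_rtail N R HR) |].
intros x Hx Hx1 N'.
destruct (HW x Hx Hx1) as (W1 & W2 & K1 & K2 & Heq).
set (w := W x) in *; set (ka := K x) in *.
assert (Hkt : l2norm (vtail k ka) <= eps) by (apply Hk; auto).
assert (Id : forall v i, l2 v -> mat_apply R (mat_apply A v) i
    = t * mat_apply R v i + mat_apply E v i - v i).
{ intros v i Hv; rewrite <- mat_apply_mmul by auto.
  assert (G := geom_identity A t n HA Ht); fold R E in G.
  assert (G' : mat_apply (madd (mscal t R) E) v i = mat_apply (madd mone (mmul R A)) v i)
    by now rewrite G.
  rewrite !mat_apply_madd, mat_apply_mscal, mat_apply_one in G'
    by auto using bmat_scal, bmat_one, bmat_mmul.
  lra. }
assert (Hx' : forall i, x i = (rho * w i + -1 * mat_apply A w i) + -1 * ka i).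
{ intros i; generalize (Heq i); lra. }
assert (HAw : l2 (mat_apply A w)) by now apply mat_apply_l2.
assert (HRx : forall i, mat_apply R x i
   = w i - mat_apply E w i - (t - rho) * mat_apply R w i - mat_apply R ka i).
{ intros i; rewrite (functional_extensionality _ _ Hx').
  rewrite mat_apply_lincomb; auto; [|now apply l2_lincomb; [apply l2_scal|]].
  rewrite mat_apply_lincomb; auto; [|now apply l2_scal].
  rewrite Id by auto.
  replace (mat_apply R (fun j => rho * w j) i) with (rho * mat_apply R w i); [ring|].
  unfold mat_apply; rewrite <- Series_scal_l; apply Series_ext; intros; ring. }
(* The tail of R x in five pieces. R K x is split at column k: the first k columns of R have small
   row tails, and beyond k the vector K x is itself small. *)
set (v1 := vtail N w).
set (v2 := mat_apply (rtail N E) w).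
set (v3 := mat_apply (rtail N R) w).
set (v4 := mat_apply (rtail N (chead k R)) ka).
set (v5 := mat_apply (rtail N R) (vtail k ka)).
assert (HRv : mat_apply (rtail N R) x
  = fun i => (((v1 i + -1 * v2 i) + - (t - rho) * v3 i) + -1 * v4 i) + -1 * v5 i).
{ apply functional_extensionality; intros i.
  unfold v1, v2, v3, v4, v5; rewrite !mat_apply_rtail; unfold vtail at 1 2 3 4 5 6.
  destruct Nat.leb; [|ring].
  rewrite HRx, (mat_apply_split_tail R k ka i) by auto; ring. }
destruct (mat_apply_bound _ _ w H2 W1) as [L2 B2]; fold v2 in L2, B2.
destruct (mat_apply_bound _ _ w H1 W1) as [L3 B3]; fold v3 in L3, B3.
destruct (mat_apply_bound _ _ ka H3 K1) as [L4 B4]; fold v4 in L4, B4.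
assert (HcRt : opb (rtail N R) cR) by (apply (opb_mono _ _ _ _ HcR); [apply rtail_le | lra]).
destruct (mat_apply_bound _ _ _ HcRt (l2_vtail k ka K1)) as [L5 B5]; fold v5 in L5, B5.
assert (L1 : l2 v1) by now apply l2_vtail.
assert (B1 : l2norm v1 <= M0).
{ eapply Rle_trans; [apply (l2_le _ w W1), vtail_le | exact W2]. }
destruct (l2_lincomb (-1) v1 v2 L1 L2) as [S1 T1].
destruct (l2_lincomb (- (t - rho)) _ v3 S1 L3) as [S2 T2].
destruct (l2_lincomb (-1) _ v4 S2 L4) as [S3 T3].
destruct (l2_lincomb (-1) _ v5 S3 L5) as [S4 T4].
rewrite Rabs_Ropp, (Rabs_pos_eq (t - rho)) in T2 by lra.
rewrite (Rabs_left (-1)) in T1, T3, T4 by lra.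
rewrite HRv; eapply Rle_trans; [apply fnorm_le_l2norm, S4|].
eapply Rle_trans; [exact T4|].
assert (Q2 : l2norm v2 <= (1 + eps) * M0) by (eapply Rle_trans; [exact B2|]; apply Rmult_le_compat_l; lra).
assert (Q3 : (t - rho) * l2norm v3 <= (t - rho) * ((g + eps) * M0)).
{ apply Rmult_le_compat_l; [lra|]; eapply Rle_trans; [exact B3|]; apply Rmult_le_compat_l; lra. }
assert (Q4 : l2norm v4 <= eps * M1) by (eapply Rle_trans; [exact B4|]; apply Rmult_le_compat_l; lra).
assert (Q5 : l2norm v5 <= cR * eps) by (eapply Rle_trans; [exact B5|]; apply Rmult_le_compat_l; lra).
unfold C in HeC; lra.
Qed.

Lemma pow_1p_le_3 eta k : 0 <= eta -> INR k * eta <= 1 -> (1 + eta) ^ k <= 3.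
Proof.
intros H0 H; apply Rle_trans with (exp (INR k * eta)).
- clear H; induction k; [simpl; rewrite Rmult_0_l, exp_0; lra|].
  rewrite S_INR, Rmult_plus_distr_r, Rmult_1_l, exp_plus, <- tech_pow_Rmult, Rmult_comm.
  apply Rmult_le_compat; auto; [apply pow_le; lra | lra |].
  generalize (exp_ineq1_le eta); lra.
- eapply Rle_trans; [|apply exp_le_3].
  destruct H as [H| ->]; [left; now apply exp_increasing | lra].
Qed.

(* If [ess A] were outside the essential spectrum, the partial sums [R] of the Neumann series
   at [t] would have [gamma R <= 4 M0] uniformly as [t] decreases to [ess A]; since [R R]
   dominates [(q + 1) t^(-q-2) A^q] entrywise, [gamma (A^q)] would be [O (ess A ^ q / q)],
   whereas it is at least [ess A ^ q]. *)
Lemma ess_in_ess_spec A : nb A -> 0 < ess A -> ess_spec A (RtoC (ess A)).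
Proof.
intros HA Hr; apply NNPP; intros Hn.
destruct (not_ess_spec_real_right_inverse A (ess A) Hn) as (W & K & M0 & M1 & HM0 & HM1 & HW & HK).
set (rho := ess A) in *.
(* 48 is 16 times 3: the square of the bound 4 M0 on gamma R, and the bound 3 on (1 + eta)^(q+2). *)
destruct (INR_unbounded (48 * M0 ^ 2 * rho ^ 2)) as [q' Hq'].
set (q := S q').
assert (Hq : 48 * M0 ^ 2 * rho ^ 2 < INR (S q)).
{ unfold q; rewrite !S_INR; lra. }
(* The first bound gives (t - rho) M0 <= 1/2, so that the term in gamma R can be absorbed; the
   second keeps (1 + eta)^(q+2) below 3. *)
set (eta := Rmin (/ (2 * M0 * rho)) (/ INR (q + 2))).
assert (HI : 0 < INR (q + 2)) by (apply lt_0_INR; lia).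
assert (Hmr : 0 < 2 * M0 * rho) by (repeat apply Rmult_lt_0_compat; lra).
assert (Heta : 0 < eta) by (apply Rmin_glb_lt; now apply Rinv_0_lt_compat).
assert (He1 : 2 * M0 * rho * eta <= 1).
{ apply Rle_trans with (2 * M0 * rho * / (2 * M0 * rho)).
  - apply Rmult_le_compat_l; [lra | apply Rmin_l].
  - rewrite Rinv_r; lra. }
assert (He2 : INR (q + 2) * eta <= 1).
{ apply Rle_trans with (INR (q + 2) * / INR (q + 2)).
  - apply Rmult_le_compat_l; [lra | apply Rmin_r].
  - rewrite Rinv_r; lra. }
set (t := rho * (1 + eta)).
assert (Ht : 0 < t) by (unfold t; nra).
assert (Hrt : rho < t) by (unfold t; nra).
destruct (ess_exists A t HA Hrt) as [n0 Hn0].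
(* Large enough for gamma (A^(n+1)) <= t^(n+1), and at least q for [geom_square_ge]. *)
set (n := Nat.max n0 q).
assert (HE : gamma (mpow A (S n)) <= t ^ S n) by (left; apply Hn0; unfold n; lia).
assert (Hb := gamma_geom_bound A rho t n W K M0 M1 HA Ht ltac:(lra) HM0 HM1 HW HK HE).
assert (Hi : 0 < / t) by now apply Rinv_0_lt_compat.
set (R := geom A (/ t) n) in *.
assert (HR : nb R) by now apply nb_geom.
assert (Hg0 := gamma_ge0 R HR).
assert (Hg : gamma R <= 4 * M0).
{ assert (H1 : (t - rho) * M0 * gamma R <= / 2 * gamma R); [|lra].
  apply Rmult_le_compat_r; [exact Hg0|]; unfold t; lra. }
set (c := INR (S q) * (/ t) ^ (q + 2)).
assert (Hc : 0 < c) by (apply Rmult_lt_0_compat; [apply INR_S_pos | now apply pow_lt]).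
assert (Hlow : c * gamma (mpow A q) <= gamma R * gamma R).
{ eapply Rle_trans; [apply gamma_mscal_ge; [exact Hc | now apply nb_mpow]|].
  eapply Rle_trans; [|now apply gamma_mmul].
  apply gamma_mono; [apply nb_mscal; [lra | now apply nb_mpow] | now apply nb_mmul |].
  intros i j; apply geom_square_ge; auto; unfold n; lia. }
assert (Hpow : rho ^ q <= gamma (mpow A q)) by apply (ess_pow_le A q' HA).
assert (H16 : c * rho ^ q <= 16 * M0 ^ 2).
{ apply Rle_trans with (gamma R * gamma R).
  - eapply Rle_trans; [|exact Hlow]; apply Rmult_le_compat_l; lra.
  - replace (16 * M0 ^ 2) with ((4 * M0) * (4 * M0)) by ring.
    apply Rmult_le_compat; auto. }
assert (Hte : t ^ (q + 2) <= 3 * rho ^ (q + 2)).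
{ unfold t; rewrite Rpow_mult_distr, Rmult_comm; apply Rmult_le_compat_r.
  - apply pow_le; lra.
  - apply pow_1p_le_3; lra. }
assert (Htp : 0 < t ^ (q + 2)) by now apply pow_lt.
assert (Hrp : 0 < rho ^ q) by now apply pow_lt.
assert (E : INR (S q) * rho ^ q <= 16 * M0 ^ 2 * t ^ (q + 2)).
{ replace (INR (S q) * rho ^ q) with (c * rho ^ q * t ^ (q + 2)).
  - apply Rmult_le_compat_r; lra.
  - unfold c; rewrite pow_inv; field; lra. }
assert (E2 : INR (S q) * rho ^ q <= 48 * M0 ^ 2 * rho ^ 2 * rho ^ q).
{ eapply Rle_trans; [exact E|].
  apply Rle_trans with (16 * M0 ^ 2 * (3 * rho ^ (q + 2))).
  - apply Rmult_le_compat_l; [generalize (pow2_ge_0 M0); lra | exact Hte].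
  - rewrite pow_add; lra. }
apply Rmult_le_reg_r in E2; [lra | exact Hrp].
Qed.

(** When [ess A] is 0 no point of the essential spectrum has to be exhibited, because [Rsup] of
    nonnegative numbers is nonnegative even on the empty set. *)
Lemma rho_ess_eq A : nb A -> rho_ess A = ess A.
Proof.
intros HA; assert (He := ess_ge0 A HA); apply Rle_antisym.
- apply Rsup_le; [exact He|]; intros t (lam & Hl & ->); now apply ess_spec_le.
- destruct He as [He|He].
  + apply (Rsup_ge _ (ess A)).
    * intros t (lam & Hl & ->); now apply ess_spec_le.
    * exists (RtoC (ess A)); split; [now apply ess_in_ess_spec|].
      rewrite Cmod_R, Rabs_pos_eq; lra.
  + rewrite <- He; apply Rsup_ge0; intros t (lam & Hl & ->); apply Cmod_ge_0.
Qed.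

(** * The two essential radii *)

Lemma gamma_set_spow_le S n : bset S -> gamma_set (spow S n) <= gamma_set S ^ Datatypes.S n.
Proof.
intros HS; induction n.
- unfold spow; simpl; lra.
- change (spow S (Datatypes.S n)) with (prodset (spow S n) S).
  eapply Rle_trans; [apply gamma_set_prodset; auto using bset_spow|].
  change (gamma_set S ^ Datatypes.S (Datatypes.S n)) with (gamma_set S * gamma_set S ^ Datatypes.S n).
  rewrite Rmult_comm; apply Rmult_le_compat_l; auto using gamma_set_ge0.
Qed.

Lemma rho_ess_set_ge0 S : 0 <= rho_ess_set S.
Proof. apply Rsup_ge0; intros t (n & ->); apply rpow_ge0. Qed.

Lemma rho_ess_le_gamma_set S n A : bset S -> spow S n A -> rho_ess A <= gamma_set (spow S n).
Proof.
intros HS HA; assert (HSn := bset_spow S n HS).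
assert (NA : nb A) by (eapply bset_nb; eauto).
rewrite rho_ess_eq by exact NA.
eapply Rle_trans; [now apply ess_le_gamma | now apply gamma_le_set].
Qed.

(** Both suprema in [rho_ess_set] must be known to be bounded before they dominate their members;
    measures of noncompactness supply the bounds. *)
Lemma ess_le_rho_ess_set S n A : bset S -> spow S n A -> ess A <= rho_ess_set S ^ Datatypes.S n.
Proof.
intros HS HA; assert (HSn := bset_spow S n HS).
assert (NA : nb A) by (eapply bset_nb; eauto).
assert (HG := gamma_set_ge0 S HS).
set (s := fun n => Rsup (fun s => exists A, spow S n A /\ s = rho_ess A)).
assert (Hs0 : forall k, 0 <= s k).
{ intros k; apply Rsup_ge0; intros t (B & HB & ->); rewrite rho_ess_eq; [apply ess_ge0|];
    eapply bset_nb; try exact HB; now apply bset_spow. }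
assert (H1 : ess A <= s n).
{ rewrite <- rho_ess_eq by exact NA; apply (Rsup_ge _ (gamma_set (spow S n))).
  - intros t (B & HB & ->); now apply rho_ess_le_gamma_set.
  - now exists A. }
eapply Rle_trans; [exact H1|].
rewrite <- (root_pow (s n) n) by auto; apply pow_incr; split; [apply rpow_ge0|].
apply (Rsup_ge _ (gamma_set S)); [|now exists n].
intros t (k & ->); apply rpow_root_le; [exact HG|].
apply Rsup_le; [now apply pow_le|].
intros u (B & HB & ->); eapply Rle_trans; [exact (rho_ess_le_gamma_set S k B HS HB)|].
now apply gamma_set_spow_le.
Qed.

Lemma rho_ess_set_le S c : bset S -> 0 <= c ->
  (forall n A, spow S n A -> ess A <= c ^ Datatypes.S n) -> rho_ess_set S <= c.
Proof.
intros HS Hc H; apply Rsup_le; [exact Hc|].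
intros t (n & ->); apply rpow_root_le; [exact Hc|].
apply Rsup_le; [now apply pow_le|].
intros u (A & HA & ->); rewrite rho_ess_eq; [now apply H|].
eapply bset_nb; [|exact HA]; now apply bset_spow.
Qed.

Lemma adjset_involutive S : adjset (adjset S) = S.
Proof.
apply set_ext; intros A; split; [now intros (? & (B & HB & ->) & ->)|].
intros HA; exists (transp A); split; [now exists A | reflexivity].
Qed.

(** The properties common to both radii from which the cyclic argument is carried out once. *)
Record radius (r : matset -> R) : Prop := {
  radius_ge0 : forall S, bset S -> 0 <= r S;
  radius_swap_le : forall P Q, bset P -> bset Q -> r (prodset P Q) <= r (prodset Q P);
  radius_adjset : forall S, bset S -> r (adjset S) = r S;
  radius_hadset : forall f m a, (1 <= m)%nat -> / INR m <= a ->
    (forall j, (j < m)%nat -> bset (f j)) ->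
    r (hadset f m a) <= prodm m (fun j => rpow (r (f j)) a);
  radius_ess : forall S A, bset S -> S A -> ess A <= r S }.

Lemma radius_rho_hat : radius rho_hat_set.
Proof.
split; [exact rho_hat_ge0 | exact rho_hat_swap | exact rho_hat_adjset
  | exact rho_hat_hadset | exact ess_le_rho_hat].
Qed.

Lemma radius_rho_ess : radius rho_ess_set.
Proof.
split.
- intros S _; apply rho_ess_set_ge0.
- intros P Q HP HQ; apply rho_ess_set_le; auto using bset_prodset, rho_ess_set_ge0.
  (* In contrast to [rho_hat_swap] no letters are lost: a word A Y rotates to Y A, a word of the
     same length in Q P with the same [ess]. *)
  intros n D HD; destruct (spow_prodset_rotate P Q n D HP HQ HD) as (A & Y & HA & HY & -> & Hrot).
  rewrite ess_swap; [|now apply (bset_nb P)|exact HY].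
  apply ess_le_rho_ess_set; auto using bset_prodset.
- assert (H : forall S, bset S -> rho_ess_set (adjset S) <= rho_ess_set S).
  { intros S HS; apply rho_ess_set_le; auto using bset_adjset, rho_ess_set_ge0.
    intros n D HD; rewrite spow_adjset in HD by auto; destruct HD as (A & HA & ->).
    rewrite ess_transp by (eapply bset_nb; [apply bset_spow, HS | exact HA]).
    now apply ess_le_rho_ess_set. }
  intros S HS; apply Rle_antisym; [now apply H|].
  rewrite <- (adjset_involutive S) at 1; now apply H, bset_adjset.
- intros f m a Hm Ha Hf; assert (Ha0 := exponent_pos m a Hm Ha).
  assert (Hh := bset_hadset f m a Hm Ha Hf).
  apply rho_ess_set_le; [exact Hh | apply prodm_ge0; intros; apply rpow_ge0|].
  intros n D HD; destruct (spow_hadset_le f m a n D) as (E & HE & HDE); auto.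
  assert (NE : forall j, (j < m)%nat -> nb (E j)).
  { intros j Hj; eapply bset_nb; [|apply HE, Hj]; now apply bset_spow, Hf. }
  eapply Rle_trans; [apply (ess_mono D (had m a E)); auto using nb_had|].
  { eapply bset_nb; [|exact HD]; now apply bset_spow. }
  eapply Rle_trans; [apply ess_had; auto|].
  rewrite <- prodm_pow; apply prodm_le; intros j Hj; split; [apply rpow_ge0|].
  rewrite <- rpow_pow_l by apply rho_ess_set_ge0.
  apply rpow_le; [lra|]; apply ess_le_rho_ess_set; auto.
- intros S A HS HA; rewrite <- (pow_1 (rho_ess_set S)); now apply (ess_le_rho_ess_set S 0).
Qed.

Lemma radius_swap r P Q : radius r -> bset P -> bset Q -> r (prodset P Q) = r (prodset Q P).
Proof. intros Hr HP HQ; apply Rle_antisym; now apply (radius_swap_le r Hr). Qed.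

(** One letter at a time: the leading factor is swapped with the rest of the word and returns at the
    end by periodicity. *)
Lemma radius_rotate r f n s : radius r -> (forall t, bset (f t)) ->
  (forall t, f (t + S n)%nat = f t) -> r (mchain (fun t => f (s + t)%nat) n) = r (mchain f n).
Proof.
intros Hr Hf Hp; induction s as [|s IH]; [reflexivity|]; rewrite <- IH; clear IH.
destruct n as [|n].
- simpl; rewrite <- (Hp (s + 0)%nat); f_equal; f_equal; lia.
- rewrite (mchain_left (fun t => f (s + t)%nat)) by auto; rewrite <- radius_swap; auto.
  + simpl mchain; rewrite Nat.add_0_r, <- (Hp s); f_equal; f_equal.
    * apply mchain_ext; intros; f_equal; lia.
    * f_equal; lia.
  + apply bset_mchain; auto.
Qed.

Lemma mprod_alternating A k : nb A ->
  mprod (fun t => if Nat.even t then transp A else A) (S (2 * k)) = mpow (mmul (transp A) A) (S k).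
Proof.
intros HA; set (X := fun t => if Nat.even t then transp A else A).
assert (HT := nb_transp A HA).
assert (HX : forall t, nb (X t)) by (intros t; unfold X; destruct (Nat.even t); auto).
induction k as [|k IH]; [now rewrite mpow_1|].
replace (S (2 * S k)) with (S (S (S (2 * k)))) by lia.
change (mmul (mmul (mprod X (S (2 * k))) (X (S (S (2 * k))))) (X (S (S (S (2 * k)))))
  = mmul (mpow (mmul (transp A) A) (S k)) (mmul (transp A) A)).
rewrite IH, mmul_assoc by auto using nb_bmat, nb_mpow, nb_mmul.
assert (E : Nat.even (S (S (2 * k))) = true) by (apply Nat.even_spec; exists (S k); lia).
assert (O : Nat.even (S (S (S (2 * k)))) = false)
  by (rewrite <- Nat.negb_odd; apply negb_false_iff, Nat.odd_spec; exists (S k); lia).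
unfold X; now rewrite E, O.
Qed.

(** * Alternating words with cyclic indices *)

Section CyclicHadamard.
Variables (m : nat) (Psi : nat -> matset) (alpha : R) (r : matset -> R).
Hypothesis Hm : (1 <= m)%nat.
Hypothesis Ha : / INR m <= alpha.
Hypothesis HPsi : forall j, (j < m)%nat -> bset (Psi j).
Hypothesis Hr : radius r.

Definition altchain (L j : nat) : matset :=
  mchain (fun t => if Nat.even t then adjset (Psi ((j + t) mod m)) else Psi ((j + t) mod m)) (L - 1).

Lemma bset_mod t : bset (Psi (t mod m)).
Proof. apply HPsi, Nat.mod_upper_bound; lia. Qed.

Lemma bset_altchain L j : bset (altchain L j).
Proof.
apply bset_mchain; intros t _; destruct (Nat.even t); [apply bset_adjset|]; apply bset_mod.
Qed.

(** Stated for every even length, so that both parities of m are served: 2 (k + 1) = m, or k + 1 =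
    m. *)
Lemma gamma_le_altchain k :
  gamma_set (hadset Psi m alpha)
  <= rpow (r (hadset (altchain (2 * S k)) m alpha)) (/ INR (2 * S k)).
Proof.
assert (HS : bset (hadset (altchain (2 * S k)) m alpha))
  by (apply bset_hadset; auto; intros; apply bset_altchain).
apply gamma_set_le; [apply rpow_ge0|].
intros A HA; destruct (proj1 (hadset_iff _ _ _ _) HA) as (F & HF & EA).
assert (NF : forall t, nb (F (t mod m))).
{ intros t; assert (t mod m < m)%nat by (apply Nat.mod_upper_bound; lia).
  apply (bset_nb (Psi (t mod m))); auto. }
assert (NA : nb A).
{ apply (bset_nb (hadset Psi m alpha)); auto using bset_hadset. }
set (X := fun j t => if Nat.even t then transp (F ((j + t) mod m)) else F ((j + t) mod m)).
assert (NX : forall j t, nb (X j t)).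
{ intros j t; unfold X; destruct (Nat.even t); [apply nb_transp|]; apply NF. }
assert (EX : forall t, had m alpha (fun j => X j t) = if Nat.even t then transp A else A).
{ intros t; unfold X; rewrite EA; destruct (Nat.even t); apply mat_ext; intros i l;
    unfold had.
  - exact (prodm_cyclic m (fun j => rpow (F j l i) alpha) t Hm).
  - exact (prodm_cyclic m (fun j => rpow (F j i l) alpha) t Hm). }
set (n := (2 * S k - 1)%nat).
set (B := had m alpha (fun j => mprod (X j) n)).
assert (NB : nb B) by (apply nb_had; auto; intros; now apply nb_mprod).
assert (HB : hadset (altchain (2 * S k)) m alpha B).
{ apply (proj2 (hadset_iff _ _ _ _)); exists (fun j => mprod (X j) n); split; [|reflexivity].
  intros j Hj; apply mchain_mprod; exists (X j); split; [|reflexivity].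
  intros t _; unfold X.
  assert (Hjt : Psi ((j + t) mod m) (F ((j + t) mod m)))
    by (apply HF, Nat.mod_upper_bound; lia).
  destruct (Nat.even t); [now exists (F ((j + t) mod m)) | exact Hjt]. }
assert (Hle : gamma A ^ (2 * S k) <= r (hadset (altchain (2 * S k)) m alpha)).
{ eapply Rle_trans; [now apply ess_gram_ge|].
  eapply Rle_trans; [|apply (radius_ess r Hr _ B); auto].
  rewrite <- mprod_alternating by exact NA.
  replace (S (2 * k)) with n by (unfold n; lia).
  apply ess_mono; auto.
  - apply nb_mprod; intros; destruct Nat.even; auto using nb_transp.
  - intros i l; unfold B.
    rewrite <- (mprod_ext _ _ n (fun t _ => EX t)).
    apply mprod_had_le; auto. }
replace (2 * S k)%nat with (S n) in * by (unfold n; lia).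
rewrite <- (rpow_root (gamma A) n) by now apply gamma_ge0.
apply rpow_le; [left; apply Rinv_0_lt_compat, INR_S_pos | exact Hle].
Qed.

Lemma radius_altchain_le L :
  rpow (r (hadset (altchain (S L)) m alpha)) (/ INR (S L))
  <= rpow (prodm m (fun j => rpow (r (altchain (S L) j)) alpha)) (/ INR (S L)).
Proof.
apply rpow_le; [left; apply Rinv_0_lt_compat, INR_S_pos|].
apply (radius_hadset r Hr); auto; intros; apply bset_altchain.
Qed.

(** For even m the parity of a position depends only on its index modulo m, and an even shift
    preserves it. *)
Lemma altchain_even_even j : Nat.Even m -> Nat.even j = true ->
  r (altchain m j)
  = r (mchain (fun t => if Nat.even t then adjset (Psi t) else Psi t) (m - 1)).
Proof.
intros Hme Hj.
set (f := fun t => if Nat.even t then adjset (Psi (t mod m)) else Psi (t mod m)).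
transitivity (r (mchain f (m - 1))).
- rewrite <- (radius_rotate r f (m - 1) j); auto.
  + unfold altchain; f_equal; apply mchain_ext; intros t _; unfold f.
    rewrite Nat.even_add, Hj; now destruct (Nat.even t).
  + intros t; unfold f; destruct (Nat.even t); [apply bset_adjset|]; apply bset_mod.
  + intros t; unfold f; replace (t + S (m - 1))%nat with (t + 1 * m)%nat by lia.
    rewrite Nat.Div0.mod_add, Nat.even_add, Nat.mul_1_l.
    rewrite (proj2 (Nat.even_spec m) Hme); now destruct (Nat.even t).
- f_equal; apply mchain_ext; intros t Ht; unfold f; rewrite Nat.mod_small by lia; reflexivity.
Qed.

(** An odd shift leads to the word with adjoints at the odd positions. Its adjoint reverses the
    order, and as m - 1 - t and t have opposite parity this is the second word. *)
Lemma altchain_even_odd j : Nat.Even m -> Nat.even j = false ->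
  r (altchain m j)
  = r (mchain (fun t => if Nat.even t then Psi (m - 1 - t)%nat
                        else adjset (Psi (m - 1 - t)%nat)) (m - 1)).
Proof.
intros Hme Hj.
set (f := fun t => if Nat.even t then Psi (t mod m) else adjset (Psi (t mod m))).
assert (Hf : forall t, bset (f t)).
{ intros t; unfold f; destruct (Nat.even t); [|apply bset_adjset]; apply bset_mod. }
assert (Em := proj2 (Nat.even_spec m) Hme).
transitivity (r (mchain f (m - 1))).
- rewrite <- (radius_rotate r f (m - 1) j); auto.
  + unfold altchain; f_equal; apply mchain_ext; intros t _; unfold f.
    rewrite Nat.even_add, Hj; now destruct (Nat.even t).
  + intros t; unfold f; replace (t + S (m - 1))%nat with (t + 1 * m)%nat by lia.
    rewrite Nat.Div0.mod_add, Nat.even_add, Nat.mul_1_l, Em; now destruct (Nat.even t).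
- rewrite <- (radius_adjset r Hr) by (apply bset_mchain; auto).
  rewrite mchain_adjset by auto; f_equal; apply mchain_ext; intros t Ht; unfold f.
  rewrite Nat.mod_small by lia.
  assert (Ep : Nat.even (m - 1 - t) = negb (Nat.even t)).
  { assert (E : Nat.even (S (m - 1 - t) + t) = true)
      by (replace (S (m - 1 - t) + t)%nat with m by lia; exact Em).
    rewrite Nat.even_add, Nat.even_succ, <- Nat.negb_even in E.
    destruct (Nat.even (m - 1 - t)), (Nat.even t); easy. }
  rewrite Ep; destruct (Nat.even t); simpl; [apply adjset_involutive | reflexivity].
Qed.

(** For odd m a full lap of m letters flips the parity, so every starting index occurs in one word
    of length 2 m: at position j when j is odd, at j + m when j is even. *)
Lemma altchain_odd j : Nat.Odd m ->
  r (altchain (2 * m) j)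
  = r (mchain (fun t => if Nat.even t then Psi (t mod m) else adjset (Psi (t mod m))) (2 * m - 1)).
Proof.
intros Hmo.
set (f := fun t => if Nat.even t then Psi (t mod m) else adjset (Psi (t mod m))).
assert (Em : Nat.even m = false)
  by (rewrite <- Nat.negb_odd; apply negb_false_iff, Nat.odd_spec, Hmo).
set (s := if Nat.even j then (j + m)%nat else j).
rewrite <- (radius_rotate r f (2 * m - 1) s); auto.
- unfold altchain; f_equal; apply mchain_ext; intros t _; unfold f.
  assert (Es : Nat.even s = false).
  { unfold s; destruct (Nat.even j) eqn:Ej; [|exact Ej]; now rewrite Nat.even_add, Ej, Em. }
  assert (Ei : (s + t) mod m = (j + t) mod m).
  { unfold s; destruct (Nat.even j); [|reflexivity].
    replace (j + m + t)%nat with (j + t + 1 * m)%nat by lia; apply Nat.Div0.mod_add. }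
  rewrite Ei, Nat.even_add, Es; now destruct (Nat.even t).
- intros t; unfold f; destruct (Nat.even t); [|apply bset_adjset]; apply bset_mod.
- intros t; unfold f; replace (t + S (2 * m - 1))%nat with (t + 2 * m)%nat by lia.
  rewrite Nat.Div0.mod_add, Nat.even_add_mul_2; reflexivity.
Qed.

End CyclicHadamard.

Lemma prodm_const m c : prodm m (fun _ => c) = c ^ m.
Proof. induction m; [reflexivity | rewrite prodm_S, IHm; simpl; ring]. Qed.

Lemma prodm_alternating k x y :
  prodm (2 * k) (fun j => if Nat.even j then x else y) = (x * y) ^ k.
Proof.
induction k; [reflexivity|].
replace (2 * S k)%nat with (S (S (2 * k))) by lia; rewrite !prodm_S, IHk.
assert (E : Nat.even (2 * k) = true) by (apply Nat.even_spec; now exists k).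
rewrite Nat.even_succ, <- Nat.negb_even, E; simpl; ring.
Qed.

Lemma rpow_half_root c a k : 0 <= c ->
  rpow (rpow c a ^ S k) (/ INR (2 * S k)) = rpow c (a / 2).
Proof.
intros Hc; rewrite <- rpow_INR by apply rpow_ge0; rewrite !rpow_rpow; f_equal.
rewrite mult_INR; simpl (INR 2); field; apply Rgt_not_eq, INR_S_pos.
Qed.

Lemma bset_of_bounded S : bounded_set S ->
  (forall A, S A -> nonneg_mat A /\ defines_op A) -> bset S.
Proof.
intros [M HM] H; exists (Rabs M); split; [apply Rabs_pos|].
intros A HA; destruct (H A HA) as [H1 H2]; split; [exact H1|].
apply defines_op_opb; auto.
Qed.

(* Psi j (0 <= j < m) is the paper's Psi_(j+1); indices taken mod m. *)
Theorem theorem5p7 (m : nat) (Psi : nat -> matset) (alpha : R)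
  (Hm : (1 <= m)%nat)
  (Hop : forall j, (j < m)%nat -> forall A, Psi j A -> nonneg_mat A /\ defines_op A)
  (Hb : forall j, (j < m)%nat -> bounded_set (Psi j))
  (Ha : / INR m <= alpha)
  (r : matset -> R) (Hr : r = rho_ess_set \/ r = rho_hat_set) :
  (Nat.Even m ->
     let Sigma := hadset (fun j => mchain (fun t =>
                     if Nat.even t then adjset (Psi ((j + t) mod m)) else Psi ((j + t) mod m))
                     (m - 1)) m alpha in
     gamma_set (hadset Psi m alpha) <= rpow (r Sigma) (/ INR m) /\
     rpow (r Sigma) (/ INR m) <=
       rpow (r (mchain (fun t => if Nat.even t then adjset (Psi t) else Psi t) (m - 1)) *
             r (mchain (fun t => if Nat.even t then Psi (m - 1 - t)%nat
                                 else adjset (Psi (m - 1 - t)%nat)) (m - 1)))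
            (alpha / 2))
  /\
  (Nat.Odd m ->
     let Omega := hadset (fun j => mchain (fun t =>
                     if Nat.even t then adjset (Psi ((j + t) mod m)) else Psi ((j + t) mod m))
                     (2 * m - 1)) m alpha in
     gamma_set (hadset Psi m alpha) <= rpow (r Omega) (/ INR (2 * m)) /\
     rpow (r Omega) (/ INR (2 * m)) <=
       rpow (r (mchain (fun t => if Nat.even t then Psi (t mod m) else adjset (Psi (t mod m)))
                       (2 * m - 1)))
            (alpha / 2)).
Proof.
assert (Rr : radius r) by (destruct Hr as [-> | ->]; [apply radius_rho_ess | apply radius_rho_hat]).
assert (HPsi : forall j, (j < m)%nat -> bset (Psi j))
  by (intros j Hj; exact (bset_of_bounded (Psi j) (Hb j Hj) (Hop j Hj))).
split; intros Hpar.
- assert (Hpar' := Hpar); destruct Hpar' as [[|k] Hk]; [lia|].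
  set (f1 := mchain (fun t => if Nat.even t then adjset (Psi t) else Psi t) (m - 1)).
  set (f2 := mchain (fun t => if Nat.even t then Psi (m - 1 - t)%nat
                              else adjset (Psi (m - 1 - t)%nat)) (m - 1)).
  assert (P1 : 0 <= r f1).
  { apply (radius_ge0 r Rr), bset_mchain; intros t Ht.
    destruct (Nat.even t); [apply bset_adjset|]; apply HPsi; lia. }
  assert (P2 : 0 <= r f2).
  { apply (radius_ge0 r Rr), bset_mchain; intros t Ht.
    destruct (Nat.even t); [|apply bset_adjset]; apply HPsi; lia. }
  change (gamma_set (hadset Psi m alpha) <= rpow (r (hadset (altchain m Psi m) m alpha)) (/ INR m) /\
    rpow (r (hadset (altchain m Psi m) m alpha)) (/ INR m) <= rpow (r f1 * r f2) (alpha / 2)).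
  split.
  + generalize (gamma_le_altchain m Psi alpha r Hm Ha HPsi Rr k); now rewrite <- Hk.
  + generalize (radius_altchain_le m Psi alpha r Hm Ha HPsi Rr (m - 1)).
    replace (S (m - 1)) with m by lia; intros H; eapply Rle_trans; [exact H|].
    (* Half of the m starting indices lead to each word, so the root of order m of the product has
       exponent alpha / 2. *)
    rewrite (prodm_ext _ _ (fun j => if Nat.even j then rpow (r f1) alpha else rpow (r f2) alpha)).
    * rewrite Hk at 1 2; rewrite prodm_alternating, <- rpow_mult, rpow_half_root by auto using Rmult_le_pos.
      apply Rle_refl.
    * intros j _; destruct (Nat.even j) eqn:Ej; f_equal.
      -- apply altchain_even_even; auto.
      -- apply altchain_even_odd; auto.
- set (f := mchain (fun t => if Nat.even t then Psi (t mod m) else adjset (Psi (t mod m))) (2 * m - 1)).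
  assert (P : 0 <= r f).
  { apply (radius_ge0 r Rr), bset_mchain; intros t Ht.
    assert (Bt := bset_mod m Psi Hm HPsi t).
    destruct (Nat.even t); [|apply bset_adjset]; exact Bt. }
  change (gamma_set (hadset Psi m alpha)
      <= rpow (r (hadset (altchain m Psi (2 * m)) m alpha)) (/ INR (2 * m)) /\
    rpow (r (hadset (altchain m Psi (2 * m)) m alpha)) (/ INR (2 * m)) <= rpow (r f) (alpha / 2)).
  assert (Em : m = S (m - 1)) by lia.
  split.
  + generalize (gamma_le_altchain m Psi alpha r Hm Ha HPsi Rr (m - 1)); now rewrite <- Em.
  + generalize (radius_altchain_le m Psi alpha r Hm Ha HPsi Rr (2 * m - 1)).
    replace (S (2 * m - 1)) with (2 * m)%nat by lia; intros H; eapply Rle_trans; [exact H|].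
    (* All m starting indices lead to the same word, and m alpha divided by 2 m is alpha / 2. *)
    rewrite (prodm_ext _ _ (fun _ => rpow (r f) alpha))
      by (intros j _; f_equal; apply altchain_odd; auto).
    rewrite prodm_const, Em, rpow_half_root by exact P; apply Rle_refl.
Qed.
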